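(* Let $n\ge2$, $0<a<1$ and let $\omega\in\mathbb{R}^n$ be non-resonant. Then $\omega\in\mathcal{A}^a_\infty$ if and only if the equation $$\Phi^*(X_\omega+F-X_\lambda)=X_\omega\qquad(\text{unknowns }\Phi,\lambda)$$ can be solved in $\mathcal{F}^a_\infty$, that is, if and only if: for every $\eta>0$ there exist $r_0>0$ and $\varepsilon>0$ such that for every vector field $F\in\mathcal{F}^a_\infty$ on $\mathbb{T}^n$ with $\|F\|_{r_0}\le\varepsilon$ there exist $\lambda\in\mathbb{R}^n$ and a diffeomorphism $\Phi:\mathbb{T}^n\to\mathbb{T}^n$ with $\Phi-\mathrm{Id}\in\mathcal{F}^a_\infty$ such that $$\Phi^*(X_\omega+F-X_\lambda)=X_\omega,\qquad |\lambda|\le\eta,\qquad \|\Phi-\mathrm{Id}\|_{C^1}\le\eta .$$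
   Context: $\mathbb{T}^n=\mathbb{R}^n/\mathbb{Z}^n$; $|x|=\max_{1\le i\le n}|x_i|$; $\omega$ is non-resonant if $k\cdot\omega\ne0$ for all nonzero $k\in\mathbb{Z}^n$. For $0<a<1$ set $\varphi_a(t)=t^a/a$. For $r\in\mathbb{R}$, $\mathcal{F}^a_r$ is the Banach space of real formal Fourier series $f=\sum_{k\in\mathbb{Z}^n}f_ke^{2\pi ik\cdot x}$ ($f_k\in\mathbb{C}$, $\overline{f_k}=f_{-k}$) with $\|f\|_r:=\sup_{k}|f_k|e^{r\varphi_a(|k|)}<+\infty$; $\mathcal{F}^a_\infty:=\bigcap_{r>0}\mathcal{F}^a_r$ (its elements are smooth functions on $\mathbb{T}^n$). A vector field or map $F=(f_1,\dots,f_n):\mathbb{T}^n\to\mathbb{R}^n$ is in one of these spaces if all its components are, and $\|F\|_r=\max_i\|f_i\|_r$. For $\tau>0$, $\mathcal{A}^a_\tau$ is the set of $\omega\in\mathbb{R}^n$ with $\sup_{k\in\mathbb{Z}^n\setminus\{0\}}|2\pi k\cdot\omega|^{-1}e^{-\tau\varphi_a(|k|)}<+\infty$; $\mathcal{A}^a_\infty:=\bigcup_{\tau>0}\mathcal{A}^a_\tau$. $X_\omega=\omega$, $X_\lambda=\lambda$ are constant vector fields on $\mathbb{T}^n$. The pullback of a vector field $Y$ by a diffeomorphism $\Phi$ is $(\Phi^*Y)(x)=(D_x\Phi)^{-1}Y(\Phi(x))$. $\|\Phi-\mathrm{Id}\|_{C^1}$ is the maximum of the sup norms on $\mathbb{T}^n$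 of $\Phi-\mathrm{Id}$ (a $\mathbb{Z}^n$-periodic map) and of $D\Phi-\mathrm{Id}$. *)

(* Defs.v *)
From HB Require Import structures.
From mathcomp Require Import all_boot all_order all_algebra.
From mathcomp Require Import all_classical all_reals all_analysis.
From mathcomp Require Import complex.

Set Implicit Arguments.
Unset Strict Implicit.
Unset Printing Implicit Defensive.

Import Order.TTheory GRing.Theory Num.Theory.
Import numFieldNormedType.Exports.

Local Open Scope classical_set_scope.
Local Open Scope ring_scope.

(* Conventions. Points of R^n are row vectors 'rV[R]_n and frequencies are row
   vectors 'rV[int]_n; the library norm `|x| on 'rV[R]_n is the max norm. The
   torus is R^n / Z^n: vector fields on it are functions on 'rV[R]_n, and maps
   from the torus to itself are represented by lifts 'rV[R]_n -> 'rV[R]_n. *)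

Definition freq_norm (n : nat) (k : 'rV[int]_n) : nat :=
  (\max_(i < n) `|k 0%R i|)%N.

Definition phi_pow (R : realType) (a t : R) : R := t `^ a / a.

Definition weight (R : realType) (n : nat) (a r : R) (k : 'rV[int]_n) : R :=
  expR (r * phi_pow a (freq_norm k)%:R).

Definition freq_dot (R : realType) (n : nat) (k : 'rV[int]_n) (x : 'rV[R]_n)
    : R :=
  \sum_(i < n) (k 0 i)%:~R * x 0 i.

Definition non_resonant (R : realType) (n : nat) (omega : 'rV[R]_n) : Prop :=
  forall k : 'rV[int]_n, k != 0 -> freq_dot k omega != 0.

(* The inverse is the one of \bar R, for which 0^-1 = +oo: a resonant vector
   never belongs to this set. *)
Definition small_div (R : realType) (n : nat) (a tau : R) : set 'rV[R]_n :=
  [set omega |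
    (ereal_sup [set (`|2 * pi * freq_dot k omega|%:E)^-1
                    * (weight a (- tau) k)%:E
               | k in [set k : 'rV[int]_n | k != 0%R]] < +oo)%E].

Definition small_div_infty (R : realType) (n : nat) (a : R) : set 'rV[R]_n :=
  \bigcup_(tau in [set tau : R | 0 < tau]) small_div a tau.

Record fourier_series (R : realType) (n : nat) : Type := FourierSeries {
  fcoef :> 'rV[int]_n -> R[i];
  fcoef_conj : forall k : 'rV[int]_n, conjc (fcoef k) = fcoef (- k) }.

Definition fnorm (R : realType) (n : nat) (a r : R) (f : fourier_series R n)
    : \bar R :=
  ereal_sup [set (ComplexField.Normc.normc (f k) * weight a r k)%:E
            | k in [set: 'rV[int]_n]].

Definition fspace (R : realType) (n : nat) (a r : R)
    : set (fourier_series R n) :=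
  [set f | (fnorm a r f < +oo)%E].

Definition fspace_infty (R : realType) (n : nat) (a : R)
    : set (fourier_series R n) :=
  \bigcap_(r in [set r : R | 0 < r]) fspace a r.

(* e^{2 pi i k . x} *)
Definition character (R : realType) (n : nat) (k : 'rV[int]_n) (x : 'rV[R]_n)
    : R[i] :=
  (cos (2 * pi * freq_dot k x) +i* sin (2 * pi * freq_dot k x))%C.

(* The frequencies |k| <= N form a finite set stable under k |-> - k, so each
   partial sum is real by fcoef_conj. The limit is meaningful for
   f \in fspace_infty a with 0 < a, where the series converges absolutely. *)
Definition fpartial (R : realType) (n : nat) (f : fourier_series R n)
    (x : 'rV[R]_n) (N : nat) : R :=
  complex.Re (\sum_(k \in [set k : 'rV[int]_n | (freq_norm k <= N)%N])
                f k * character k x).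

Definition feval (R : realType) (n : nat) (f : fourier_series R n)
    (x : 'rV[R]_n) : R :=
  limn (fpartial f x).

Definition fvector (R : realType) (n : nat) : Type :=
  'I_n -> fourier_series R n.

Definition vfnorm (R : realType) (n : nat) (a r : R) (F : fvector R n)
    : \bar R :=
  \big[maxe/0%E]_(i < n) fnorm a r (F i).

Definition vfspace_infty (R : realType) (n : nat) (a : R)
    : set (fvector R n) :=
  [set F | forall i, fspace_infty a (F i)].

Definition vfeval (R : realType) (n : nat) (F : fvector R n) (x : 'rV[R]_n)
    : 'rV[R]_n :=
  \row_(i < n) feval (F i) x.

Definition map_in_vfspace_infty (R : realType) (n : nat) (a : R)
    (G : 'rV[R]_n -> 'rV[R]_n) : Prop :=
  exists2 U : fvector R n, vfspace_infty a U & G = vfeval U.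

(* f is C^{k+1} when it is Frechet differentiable and x |-> Df_x v is C^k for
   every v; in finite dimension the latter says that x |-> Df_x is C^k. *)
Fixpoint class_C (R : realType) (n k : nat) (f : 'rV[R]_n -> 'rV[R]_n) : Prop :=
  match k with
  | 0%N => continuous f
  | k'.+1 => (forall x, differentiable f x) /\
             (forall v, class_C k' (fun x => 'd f x v))
  end.

Definition smooth (R : realType) (n : nat) (f : 'rV[R]_n -> 'rV[R]_n) : Prop :=
  forall k : nat, class_C k f.

Definition torus_eq (R : realType) (n : nat) (x y : 'rV[R]_n) : Prop :=
  exists k : 'rV[int]_n, x - y = map_mx (fun z : int => z%:~R) k.

Definition descends (R : realType) (n : nat) (f : 'rV[R]_n -> 'rV[R]_n)
    : Prop :=
  forall x y, torus_eq x y -> torus_eq (f x) (f y).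

(* Phi is a lift of a smooth bijection of the torus with smooth inverse (every
   continuous self-map of the torus has a lift, in particular the inverse). *)
Definition torus_diffeo (R : realType) (n : nat) (Phi : 'rV[R]_n -> 'rV[R]_n)
    : Prop :=
  exists Psi : 'rV[R]_n -> 'rV[R]_n,
    [/\ smooth Phi /\ descends Phi, smooth Psi /\ descends Psi,
        forall x, torus_eq (Psi (Phi x)) x
      & forall x, torus_eq (Phi (Psi x)) x].

(* With row vectors, 'd Phi x v = v *m 'J Phi x, so applying (D_x Phi)^{-1} is
   multiplying by invmx ('J Phi x) on the right. This Jacobian matrix is
   invertible when Phi is a diffeomorphism; invmx is the identity function on
   singular matrices. *)
Definition pullback (R : realType) (n : nat) (Phi Y : 'rV[R]_n -> 'rV[R]_n)
    (x : 'rV[R]_n) : 'rV[R]_n :=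
  Y (Phi x) *m invmx ('J Phi x).

(* The norm of a matrix is the maximum of the absolute values of its entries. *)
Definition C1_dist_id (R : realType) (n : nat) (Phi : 'rV[R]_n -> 'rV[R]_n)
    : \bar R :=
  maxe (ereal_sup [set (`|Phi x - x|)%:E | x in [set: 'rV[R]_n]])
       (ereal_sup [set (`|'J Phi x - 1%:M|)%:E | x in [set: 'rV[R]_n]]).

(* Main.v *)
Require Import Defs.
From HB Require Import structures.
From mathcomp Require Import all_boot all_order all_algebra.
From mathcomp Require Import all_classical all_reals all_analysis.
From mathcomp Require Import complex ring lra zify.

Set Implicit Arguments.
Unset Strict Implicit.
Unset Printing Implicit Defensive.

Import Order.TTheory GRing.Theory Num.Theory.
Import numFieldNormedType.Exports.

Local Open Scope classical_set_scope.
Local Open Scope ring_scope.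

(* Sufficiency. With Phi = id + u the equation reads
   omega + F(x + u(x)) - lambda = omega + Du(x) omega, and is solved by a Newton
   iteration on trigonometric polynomials of degree K_j = 2^j K_0, with the defect
   at most exp(-rho_j K_j^a) on a complex strip of width about
   rho_j K_j^a / K_j. A step writes the defect as mu + (I + DU) g up to a tiny
   error, by a Neumann series, and solves the cohomological equation
   d_omega z = g for the frequencies |k| <= K_j, where the small divisors cost
   exp((tau/a) K_j^a). The new defect, of order exp(-(2 rho_j - 2 tau/a) K_j^a),
   beats exp(-rho_{j+1} (2 K_j)^a) because 2^a < 2. As F decays at every rate,
   rho_j can be increased slowly to infinity, so that the limit u decays at every
   rate too. The inverse Psi of Phi is smooth because the scalars generated by the entries of
   (D Phi)^{-1} o Psi and the rapidly decaying series composed with Psi are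
   closed under partial derivatives.

   Necessity. For k <> 0 take v orthogonal to k and F = b cos(2 pi k.x) v. Along
   t |-> Phi(t omega) the function k.Phi is affine, and boundedness of Phi - id
   forces k.lambda = 0; then a coordinate of Phi(t omega) - t omega oscillates
   with amplitude b / |2 pi k.omega|, which is at most eta. *)

(** No derivative of F has to be inverted. With d_omega h the main unknown, the correction is w = (I
    + DU) h, so that id + U + w agrees to second order with (id + U) o (id + h). Evaluating the old
    defect at z + h then accounts at once for DF w and for the term D(d_omega U) h of d_omega w, and
    only (I + DU) d_omega h is left to cancel the defect. Its mean is out of reach of d_omega h and
    goes into lambda. Elements of the class are in general not analytic, but their truncations at
    degree K are entire. The width of the strip is proportional to rho K^a / K because t^a / t
    decreases: for |k| <= K the exponentials grow there at most like exp(const rho |k|^a), which a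
    decay of F at a fixed multiple of rho beats. Only one norm of F is small, with a threshold
    independent of F; the constants at faster rates of decay are arbitrary. All factors polynomial
    in K are paid by spare factors exp(K^a). *)

Local Notation nc := ComplexField.Normc.normc.

Lemma eq_ler (R : realType) (x y : R) : x = y -> x <= y.
Proof. by move->. Qed.

(** * Complex moduli and exponential *)

Section NormC.
Variable R : realType.
Implicit Types z w : R[i].

Lemma nc_ge0 z : 0 <= nc z.
Proof. by case: z => x y; rewrite sqrtr_ge0. Qed.

Lemma ncD z w : nc (z + w) <= nc z + nc w.
Proof. exact: le_normcD. Qed.

Lemma ncM z w : nc (z * w) = nc z * nc w.
Proof. exact: ComplexField.Normc.normcM. Qed.

Lemma ncN z : nc (- z) = nc z.
Proof. exact: normcN. Qed.

Lemma nc0 : nc (0 : R[i]) = 0. Proof. exact: ComplexField.Normc.normc0. Qed.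
Lemma nc1 : nc (1 : R[i]) = 1. Proof. exact: ComplexField.Normc.normc1. Qed.

Lemma ncB z w : nc (z - w) <= nc z + nc w.
Proof. by rewrite -(ncN w) ncD. Qed.

Lemma nc_real (x : R) : nc (x%:C)%C = `|x|.
Proof. by rewrite /= expr0n addr0 sqrtr_sqr. Qed.

Lemma ncX z m : nc (z ^+ m) = nc z ^+ m.
Proof. by elim: m => [|m IH]; rewrite ?expr0 ?nc1// !exprS ncM IH. Qed.

Lemma nc_sum (I : Type) (s : seq I) (P : pred I) (F : I -> R[i]) :
  nc (\sum_(i <- s | P i) F i) <= \sum_(i <- s | P i) nc (F i).
Proof.
elim/big_ind2 : _ => [|x1 x2 y1 y2 h1 h2|//]; first by rewrite nc0.
exact: le_trans (ncD _ _) (lerD h1 h2).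
Qed.

Lemma nc_conj z : nc (conjc z) = nc z.
Proof. by case: z => x y /=; rewrite sqrrN. Qed.

Lemma nc_Re z : `|complex.Re z| <= nc z.
Proof.
by case: z => x y /=; rewrite -sqrtr_sqr ler_wsqrtr// lerDl sqr_ge0.
Qed.

Lemma nc_Im z : `|complex.Im z| <= nc z.
Proof.
by case: z => x y /=; rewrite -sqrtr_sqr ler_wsqrtr// lerDr sqr_ge0.
Qed.

Lemma nc_le_ReIm z : nc z <= `|complex.Re z| + `|complex.Im z|.
Proof.
case: z => x y /=; have h : 0 <= `|x| + `|y| by rewrite addr_ge0.
rewrite -[leRHS](ger0_norm h) -sqrtr_sqr ler_wsqrtr// sqrrD !real_normK ?num_real//.
by rewrite lerD2r lerDl mulrn_wge0// mulr_ge0.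
Qed.

Lemma nc_sqr z : nc z ^+ 2 = complex.Re z ^+ 2 + complex.Im z ^+ 2.
Proof. by case: z => x y /=; rewrite sqr_sqrtr// addr_ge0 ?sqr_ge0. Qed.

Lemma nc_eq0 z : nc z = 0 -> z = 0.
Proof. exact: ComplexField.Normc.eq0_normc. Qed.

Lemma conjc_mul z w : conjc (z * w) = conjc z * conjc w.
Proof. exact: rmorphM. Qed.

Lemma conjc_add z w : conjc (z + w) = conjc z + conjc w.
Proof. exact: rmorphD. Qed.

Lemma conjc_opp z : conjc (- z) = - conjc z.
Proof. exact: rmorphN. Qed.

Lemma conjc_sub z w : conjc (z - w) = conjc z - conjc w.
Proof. exact: rmorphB. Qed.

Lemma ReD z w : complex.Re (z + w) = complex.Re z + complex.Re w.
Proof. by case: z w => [x y] []. Qed.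

Lemma ImD z w : complex.Im (z + w) = complex.Im z + complex.Im w.
Proof. by case: z w => [x y] []. Qed.

Lemma Re_sum (I : Type) (s : seq I) (P : pred I) (F : I -> R[i]) :
  complex.Re (\sum_(i <- s | P i) F i) = \sum_(i <- s | P i) complex.Re (F i).
Proof. exact: (big_morph _ ReD). Qed.

Lemma Im_sum (I : Type) (s : seq I) (P : pred I) (F : I -> R[i]) :
  complex.Im (\sum_(i <- s | P i) F i) = \sum_(i <- s | P i) complex.Im (F i).
Proof. exact: (big_morph _ ImD). Qed.

End NormC.

(** * The complex exponential and its Taylor estimates *)

Section Cexp.
Variable R : realType.
Implicit Types z w : R[i].

Definition cexp z : R[i] :=
  (expR (complex.Re z) * cos (complex.Im z)
   +i* (expR (complex.Re z) * sin (complex.Im z)))%C.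

Lemma cexpD z w : cexp (z + w) = cexp z * cexp w.
Proof.
case: z w => [x y] [u v]; rewrite /cexp /=.
apply/eqP; rewrite eq_complex /= expRD cosD sinD; apply/andP; split; apply/eqP; ring.
Qed.

Lemma cexp0 : cexp 0 = 1.
Proof. by rewrite /cexp /= expR0 cos0 sin0 mulr1 mulr0. Qed.

Lemma nc_cexp z : nc (cexp z) = expR (complex.Re z).
Proof.
by rewrite /cexp/= !exprMn -mulrDr cos2Dsin2 mulr1 sqrtr_sqr ger0_norm ?expR_ge0.
Qed.

Lemma cexp_conj z : cexp (conjc z) = conjc (cexp z).
Proof. by case: z => x y; rewrite /cexp /= cosN sinN mulrN. Qed.

Lemma cexp_sum (I : Type) (s : seq I) (P : pred I) (F : I -> R[i]) :
  cexp (\sum_(i <- s | P i) F i) = \prod_(i <- s | P i) cexp (F i).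
Proof.
by elim/big_ind2 : _ => [|x1 x2 y1 y2 <- <-|//]; rewrite ?cexp0// cexpD.
Qed.

Lemma cexpX z m : cexp (z *+ m) = cexp z ^+ m.
Proof. by elim: m => [|m IH]; rewrite ?cexp0// mulrS cexpD IH exprS. Qed.

(** Only 1 + x <= exp(x) is used: at -x it gives (1 - x) exp(x) <= 1, and (1 - x)(1 + x + 2 x^2) = 1
    + x^2 (1 - 2 x) >= 1 for x <= 1/2. *)
Lemma expR_taylor2 (x : R) : `|x| <= 1/2 -> `|expR x - 1 - x| <= 2 * x ^+ 2.
Proof.
rewrite ler_norml => /andP[h1 h2].
have l : 0 <= expR x - 1 - x by have := expR_ge1Dx x; lra.
rewrite ger0_norm//.
have := expR_ge1Dx (- x); rewrite expRN => h3.
have e0 := expR_gt0 x.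
have h4 : (1 - x) * expR x <= 1.
  have := ler_wpM2r (ltW e0) h3; rewrite mulVf ?gt_eqF//.
have h5 : (1 - x) * (1 + x + 2 * x ^+ 2) >= 1.
  have -> : (1 - x) * (1 + x + 2 * x ^+ 2) = 1 + x ^+ 2 * (1 - 2 * x) by ring.
  by rewrite lerDl mulr_ge0 ?sqr_ge0//; lra.
have : (1 - x) * expR x <= (1 - x) * (1 + x + 2 * x ^+ 2) by apply: le_trans h5.
by rewrite ler_pM2l; lra.
Qed.

Lemma sin_mean_value (y : R) : exists2 c, `|c| <= `|y| & sin y = cos c * y.
Proof.
have pos (t : R) : 0 <= t -> exists2 c, `|c| <= `|t| & sin t = cos c * t.
  move=> t0; have [c] := @MVT_segment R sin cos 0 t t0
    (fun x _ => is_derive_sin x) (continuous_subspaceT (@continuous_sin R)).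
  rewrite in_itv /= => /andP[c0 ct]; rewrite sin0 !subr0 => e.
  by exists c => //; rewrite !ger0_norm.
have [y0|/ltW y0] := leP 0 y; first exact: pos.
have [|c c1 c2] := pos (- y); first by rewrite oppr_ge0.
exists c; first by rewrite -(normrN y).
by rewrite -[sin y]opprK -sinN c2 mulrN opprK.
Qed.

Lemma sin_le_norm (y : R) : `|sin y| <= `|y|.
Proof.
have [c _ ->] := sin_mean_value y.
by rewrite normrM ler_piMl// cos_max.
Qed.

Lemma cos_taylor2 (y : R) : `|cos y - 1| <= y ^+ 2 / 2.
Proof.
have e : y = (y / 2) *+ 2 by rewrite mulr2n; lra.
have -> : cos y - 1 = - (2 * sin (y / 2) ^+ 2).
  by rewrite {1}e cos_mulr2n cos2sin2 mulr2n; ring.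
rewrite normrN ger0_norm ?(mulr_ge0 _ (sqr_ge0 _))//.
have := sin_le_norm (y / 2).
rewrite -(ler_pXn2r (n := 2)) ?nnegrE// !real_normK ?num_real// expr_div_n.
lra.
Qed.

Lemma sin_taylor2 (y : R) : `|y| <= 1 -> `|sin y - y| <= y ^+ 2 / 2.
Proof.
move=> y1; have [c c1 ->] := sin_mean_value y.
have -> : cos c * y - y = (cos c - 1) * y by ring.
rewrite normrM; apply: le_trans (_ : (y ^+ 2 / 2) * 1 <= _); last by rewrite mulr1.
apply: ler_pM => //; apply: le_trans (cos_taylor2 c) _.
rewrite ler_pM2r ?invr_gt0// -[leLHS]real_normK ?num_real//.
by rewrite -[leRHS]real_normK ?num_real// lerXn2r ?nnegrE.
Qed.

Lemma cexp_taylor2 z : nc z <= 1/2 -> nc (cexp z - 1 - z) <= 4 * nc z ^+ 2.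
Proof.
case: z => x y h.
have hx : `|x| <= 1/2 := le_trans (nc_Re (x +i* y)%C) h.
have hy : `|y| <= 1/2 := le_trans (nc_Im (x +i* y)%C) h.
apply: le_trans (nc_le_ReIm _) _; rewrite nc_sqr /=.
have -> : expR x * cos y - 1 - x
  = (expR x - 1 - x) + expR x * (cos y - 1) by ring.
have -> : expR x * sin y + - 0 - y = (expR x - 1) * sin y + (sin y - y) by ring.
have ex := expR_taylor2 hx.
have ex1 : `|expR x - 1| <= 2 * `|x|.
  have -> : expR x - 1 = (expR x - 1 - x) + x by ring.
  apply: le_trans (ler_normD _ _) _.
  have : x ^+ 2 <= `|x| / 2.
    by rewrite -real_normK ?num_real// expr2 ler_wpM2l//; lra.
  lra.
have ex2 : expR x <= 2.
  by move: ex1; rewrite ler_norml => /andP[_]; lra.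
have cy := cos_taylor2 y.
have sy : `|sin y - y| <= y ^+ 2 / 2 by apply: sin_taylor2; lra.
have sy1 := sin_le_norm y.
have t1 : `|expR x * (cos y - 1)| <= 2 * (y ^+ 2 / 2).
  by rewrite normrM; apply: ler_pM => //; rewrite ger0_norm ?expR_ge0.
have t2 : `|(expR x - 1) * sin y| <= 2 * `|x| * `|y|.
  by rewrite normrM; apply: ler_pM.
have t3 : 2 * `|x| * `|y| <= x ^+ 2 + y ^+ 2.
  have := sqr_ge0 (`|x| - `|y|); rewrite sqrrB !real_normK ?num_real//.
  rewrite -mulr_natl; lra.
have u1 := ler_normD (expR x - 1 - x) (expR x * (cos y - 1)).
have u2 := ler_normD ((expR x - 1) * sin y) (sin y - y).
have := sqr_ge0 x; have := sqr_ge0 y; lra.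
Qed.

Lemma cexp_taylor1 z : nc z <= 1/2 -> nc (cexp z - 1) <= 3 * nc z.
Proof.
move=> h; have -> : cexp z - 1 = (cexp z - 1 - z) + z by rewrite subrK.
apply: le_trans (ncD _ _) _; have := cexp_taylor2 h; have := nc_ge0 z.
have : nc z ^+ 2 <= nc z / 2 by rewrite expr2 ler_wpM2l ?nc_ge0//; lra.
lra.
Qed.

Lemma nc_expB (z w : R[i]) m (M : R) : nc z <= M -> nc w <= M -> 0 <= M ->
  nc (z ^+ m - w ^+ m) <= m%:R * M ^+ m.-1 * nc (z - w).
Proof.
move=> zM wM M0; rewrite subrXX ncM mulrC.
apply: ler_wpM2r; first exact: nc_ge0.
apply: le_trans (nc_sum _ _ _) _.
apply: le_trans (_ : \sum_(i < m) M ^+ m.-1 <= _); last first.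
  by rewrite sumr_const card_ord mulr_natl.
apply: ler_sum => i _; rewrite ncM !ncX.
have {2}-> : m.-1 = (m.-1 - i + i)%N by rewrite subnK//; case: m i => [[]//|m] i /=; rewrite -ltnS.
by rewrite exprD; apply: ler_pM; rewrite ?exprn_ge0 ?nc_ge0// lerXn2r ?nnegrE ?nc_ge0.
Qed.

(* Lets compositions of trigonometric polynomials be approximated by such polynomials. *)
Lemma cexp_approx (B e : R) : 0 <= B -> 0 < e ->
  exists m : nat, forall z, nc z <= B ->
    nc (cexp z - (1 + z / m%:R) ^+ m) <= e.
Proof.
move=> B0 e0.
(* The first summand makes |z / m| <= 1/2; the second makes m exp(B) 4 (B / m)^2, the accumulated
   error of m factors, at most e. *)
pose A := 2 * B + 4 * B ^+ 2 * expR B / e.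
have A0 : 0 <= A.
  by rewrite addr_ge0 ?mulr_ge0 ?invr_ge0 ?exprn_ge0 ?expR_ge0 ?(ltW e0).
pose m := (Num.truncn A).+1; have mA : A < m%:R by exact: truncnS_gt.
have m0 : 0 < m%:R :> R by rewrite ltr0n.
have mB : 2 * B <= m%:R.
  apply/ltW/(le_lt_trans _ mA); rewrite lerDl.
  by rewrite ?mulr_ge0 ?invr_ge0 ?exprn_ge0 ?expR_ge0 ?(ltW e0).
exists m => z zB.
have mC : m%:R != 0 :> R[i] by rewrite pnatr_eq0.
have ncm : nc (z / m%:R) = nc z / m%:R.
  rewrite ncM ComplexField.Normc.normcV; congr (_ / _).
  have -> : m%:R = (m%:R%:C)%C :> R[i] by rewrite rmorph_nat.
  by rewrite nc_real ger0_norm.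
have zm : nc (z / m%:R) <= B / m%:R by rewrite ncm ler_pM2r ?invr_gt0.
have zm2 : nc (z / m%:R) <= 1/2.
  by apply: le_trans zm _; rewrite ler_pdivrMr//; lra.
have -> : cexp z = cexp (z / m%:R) ^+ m.
  by rewrite -cexpX -[_ *+ m]mulr_natr mulfVK.
have eB : 1 + B / m%:R <= expR (B / m%:R) := expR_ge1Dx _.
apply: le_trans (nc_expB (M := expR (B / m%:R)) _ _ _ _) _.
- rewrite nc_cexp ler_expR; apply: le_trans zm.
  exact: le_trans (ler_norm _) (nc_Re _).
- by apply: le_trans (ncD _ _) _; rewrite nc1; lra.
- exact: expR_ge0.
rewrite opprD addrA.
apply: le_trans (ler_wpM2l _ (cexp_taylor2 zm2)) _.
  by rewrite mulr_ge0 ?exprn_ge0 ?expR_ge0.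
have h1 : expR (B / m%:R) ^+ m.-1 <= expR B.
  rewrite -expRM_natl ler_expR mulrA ler_pdivrMr// mulrC ler_wpM2l//.
  by rewrite ler_nat leq_pred.
have h2 : nc (z / m%:R) ^+ 2 <= (B / m%:R) ^+ 2.
  by rewrite lerXn2r ?nnegrE ?nc_ge0// divr_ge0.
apply: le_trans (_ : m%:R * expR B * (4 * (B / m%:R) ^+ 2) <= _).
  apply: ler_pM; rewrite ?mulr_ge0 ?exprn_ge0 ?expR_ge0 ?nc_ge0//.
  - by rewrite ler_wpM2l.
  - by rewrite ler_wpM2l.
have -> : m%:R * expR B * (4 * (B / m%:R) ^+ 2) = 4 * B ^+ 2 * expR B / m%:R.
  by field; rewrite gt_eqF.
rewrite ler_pdivrMr// -ler_pdivrMl// mulrC.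
by apply/ltW/(le_lt_trans _ mA); rewrite lerDr mulr_ge0.
Qed.

End Cexp.

(** * Trigonometric polynomials on complex strips *)

Section Frequencies.
Variable n : nat.
Implicit Types k l : 'rV[int]_n.

(** Strips bound each imaginary part separately, so the growth of exp(2 pi i k.z) there is governed
    by the l^1 norm of k, whereas the weights of the statement use the max norm. *)
Definition ell1 k : nat := (\sum_(i < n) `|k 0%R i|)%N.

Lemma freq_norm_ge k i : (`|k 0%R i| <= freq_norm k)%N.
Proof. exact: (@leq_bigmax _ (fun i => `|k 0%R i|%N) i). Qed.

Lemma freq_norm_leP k N :
  reflect (forall i, `|k 0%R i| <= N)%N (freq_norm k <= N)%N.
Proof.
apply: (iffP idP) => [h i|h]; first exact: leq_trans (freq_norm_ge _ _) h.
by apply/bigmax_leqP => i _.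
Qed.

Lemma freq_norm_ell1 k : (freq_norm k <= ell1 k)%N.
Proof. by apply/freq_norm_leP => i; rewrite /ell1 (bigD1 i)//= leq_addr. Qed.

Lemma ell1_le k : (ell1 k <= n * freq_norm k)%N.
Proof.
apply: leq_trans (_ : \sum_(i < n) freq_norm k <= _)%N.
  by apply: leq_sum => i _; exact: freq_norm_ge.
by rewrite sum_nat_const card_ord.
Qed.

Lemma freq_normN k : freq_norm (- k) = freq_norm k.
Proof. by rewrite /freq_norm; apply: eq_bigr => i _; rewrite mxE abszN. Qed.

Lemma freq_normD k l : (freq_norm (k + l) <= freq_norm k + freq_norm l)%N.
Proof.
apply/freq_norm_leP => i; rewrite mxE.
have := freq_norm_ge k i; have := freq_norm_ge l i.
by move: (k 0%R i) (l 0%R i) => x y; lia.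
Qed.

Lemma freq_norm_eq0 k : (freq_norm k == 0)%N = (k == 0).
Proof.
apply/idP/eqP => [|->]; last first.
  by rewrite -leqn0; apply/freq_norm_leP => i; rewrite mxE.
rewrite -leqn0 => /freq_norm_leP h; apply/rowP => i; rewrite mxE.
by apply/eqP; rewrite -absz_eq0 -leqn0.
Qed.

Lemma freq_norm0 : freq_norm (0 : 'rV[int]_n) = 0%N.
Proof. by apply/eqP; rewrite freq_norm_eq0. Qed.

(** Shifting the coordinates by N turns the box into a finite function type, over which sums of
    products factor ([sum_box_prod]). *)
Definition box_pt N (f : {ffun 'I_n -> 'I_(N.*2.+1)}) : 'rV[int]_n :=
  \row_i ((f i : nat)%:Z - N%:Z).

Definition box N : seq 'rV[int]_n :=
  [seq box_pt f | f <- enum {: {ffun 'I_n -> 'I_(N.*2.+1)}}].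

Lemma box_pt_inj N : injective (@box_pt N).
Proof.
move=> f g /rowP fg; apply/ffunP => i; have := fg i; rewrite !mxE.
by move=> /addIr[] /ord_inj.
Qed.

Lemma box_uniq N : uniq (box N).
Proof. by rewrite map_inj_uniq ?enum_uniq//; exact: box_pt_inj. Qed.

Lemma mem_box N k : (k \in box N) = (freq_norm k <= N)%N.
Proof.
apply/mapP/freq_norm_leP => [[f _ ->] i|h].
  by rewrite mxE; have := ltn_ord (f i); move: (nat_of_ord _) => m; lia.
have h1 i : (absz (k 0 i + N%:Z)%R < N.*2.+1)%N.
  by have := h i; move: (k 0 i) => x; lia.
exists [ffun i => Ordinal (h1 i)]; first by rewrite mem_enum.
by apply/rowP => i; rewrite mxE ffunE /=; have := h i; lia.
Qed.

Lemma size_box N : size (box N) = (N.*2.+1 ^ n)%N.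
Proof. by rewrite size_map -cardE card_ffun !card_ord. Qed.

Lemma sum_box_prod (K : comNzRingType) N (g : int -> K) :
  \sum_(k <- box N) \prod_(i < n) g (k 0 i)
  = (\sum_(m < N.*2.+1) g ((m : nat)%:Z - N%:Z)) ^+ n.
Proof.
rewrite big_map big_enum /=.
transitivity (\sum_(f : {ffun 'I_n -> 'I_(N.*2.+1)})
    \prod_(i < n) g ((f i : nat)%:Z - N%:Z)).
  by apply: eq_bigr => f _; apply: eq_bigr => i _; rewrite mxE.
rewrite -(bigA_distr_bigA (fun _ (m : 'I_(N.*2.+1)) => g ((m : nat)%:Z - N%:Z))).
by rewrite prodr_const card_ord.
Qed.

Lemma box_oppr N : perm_eq (box N) (map (fun k => - k) (box N)).
Proof.
apply: uniq_perm; first exact: box_uniq.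
  by rewrite map_inj_uniq ?box_uniq//; exact: oppr_inj.
move=> k; apply/idP/mapP => [kN|[l lN ->]].
  by exists (- k); rewrite ?opprK// mem_box freq_normN -mem_box.
by rewrite mem_box freq_normN -mem_box.
Qed.

Lemma big_box_opp (V : nmodType) N (F : 'rV[int]_n -> V) :
  \sum_(k <- box N) F k = \sum_(k <- box N) F (- k).
Proof. by rewrite [LHS](perm_big _ (box_oppr N)) big_map. Qed.

Lemma big_box_widen (V : nmodType) N M (F : 'rV[int]_n -> V) : (N <= M)%N ->
  \sum_(k <- box N) F k = \sum_(k <- box M | k \in box N) F k.
Proof.
move=> NM; rewrite -[RHS]big_filter; apply: perm_big.
apply: uniq_perm; rewrite ?filter_uniq ?box_uniq// => k.
rewrite mem_filter; case kN: (k \in box N) => //=.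
by move: kN; rewrite !mem_box => /leq_trans -> .
Qed.

Lemma big_box_split (V : nmodType) N M (F : 'rV[int]_n -> V) : (N <= M)%N ->
  \sum_(k <- box M) F k
  = \sum_(k <- box N) F k + \sum_(k <- box M | k \notin box N) F k.
Proof. by move=> NM; rewrite (big_box_widen _ NM) (bigID (fun k => k \in box N)). Qed.

Lemma big_box_supp (V : nmodType) N M (F : 'rV[int]_n -> V) : (N <= M)%N ->
  (forall k, (N < freq_norm k)%N -> F k = 0) ->
  \sum_(k <- box M) F k = \sum_(k <- box N) F k.
Proof.
move=> NM h; rewrite (big_box_split _ NM) [X in _ + X]big1 ?addr0// => k.
by rewrite mem_box -ltnNge; exact: h.
Qed.

Lemma ler_sum_box (K : numDomainType) N (F G : 'rV[int]_n -> K) :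
  (forall k, (freq_norm k <= N)%N -> F k <= G k) ->
  \sum_(k <- box N) F k <= \sum_(k <- box N) G k.
Proof.
move=> FG; rewrite big_seq [leRHS]big_seq; apply: ler_sum => k.
by rewrite mem_box; exact: FG.
Qed.

End Frequencies.

(** * Exponential monomials on the complexified torus *)

Section Monomials.
Variables (R : realType) (n : nat).
Local Notation C := R[i].
Implicit Types (k l : 'rV[int]_n) (z w : 'rV[C]_n).

Definition toC (x : 'rV[R]_n) : 'rV[C]_n := map_mx (real_complex R) x.

Definition cdot k z : C := \sum_(i < n) (k 0 i)%:~R * z 0 i.

Definition i2pi : C := (0 +i* (2 * pi))%C.

Definition ek k z : C := cexp (i2pi * cdot k z).

Definition strip (s : R) z := forall i, `|complex.Im (z 0 i)| <= s.

Definition vbd (b : R) z := forall i, nc (z 0 i) <= b.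

Lemma nc_i2pi : nc i2pi = 2 * pi.
Proof. by rewrite /= expr0n add0r sqrtr_sqr ger0_norm// mulr_ge0 ?pi_ge0. Qed.

Lemma intC (m : int) : m%:~R = (m%:~R%:C)%C :> C.
Proof. by rewrite rmorph_int. Qed.

Lemma nc_int (m : int) : nc (m%:~R : C) = `|m|%N%:R.
Proof. by rewrite intC nc_real -intr_norm -abszE. Qed.

Lemma cdot_toC k x : cdot k (toC x) = (freq_dot k x)%:C%C.
Proof.
rewrite /freq_dot rmorph_sum; apply: eq_bigr => i _.
by rewrite mxE rmorphM /= rmorph_int.
Qed.

Lemma ek_toC k x : ek k (toC x) = character k x.
Proof.
rewrite /ek cdot_toC /cexp /character /= !mul0r !mulr0 subrr add0r.
by rewrite expR0 !mul1r.
Qed.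

Lemma cdotDr k z w : cdot k (z + w) = cdot k z + cdot k w.
Proof. by rewrite /cdot -big_split; apply: eq_bigr => i _; rewrite mxE mulrDr. Qed.

Lemma cdotDl k l z : cdot (k + l) z = cdot k z + cdot l z.
Proof.
by rewrite /cdot -big_split; apply: eq_bigr => i _; rewrite mxE rmorphD mulrDl.
Qed.

Lemma cdotNl k z : cdot (- k) z = - cdot k z.
Proof.
by rewrite /cdot -sumrN; apply: eq_bigr => i _; rewrite mxE rmorphN mulNr.
Qed.

Lemma cdotZr k (a : C) z : cdot k (a *: z) = a * cdot k z.
Proof.
by rewrite /cdot mulr_sumr; apply: eq_bigr => i _; rewrite mxE mulrCA.
Qed.

Lemma cdot0l z : cdot 0 z = 0.
Proof. by rewrite /cdot big1// => i _; rewrite mxE mul0r. Qed.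

Lemma ek0 z : ek 0 z = 1.
Proof. by rewrite /ek cdot0l mulr0 cexp0. Qed.

Lemma ekDl k l z : ek (k + l) z = ek k z * ek l z.
Proof. by rewrite /ek cdotDl mulrDr cexpD. Qed.

Lemma ekDr k z w : ek k (z + w) = ek k z * ek k w.
Proof. by rewrite /ek cdotDr mulrDr cexpD. Qed.

Lemma nc_cdot k z (b : R) : vbd b z -> nc (cdot k z) <= (ell1 k)%:R * b.
Proof.
move=> zb; apply: le_trans (nc_sum _ _ _) _.
rewrite /ell1 natr_sum mulr_suml; apply: ler_sum => i _.
by rewrite ncM nc_int ler_wpM2l.
Qed.

Lemma cdot_conj k z : cdot k (map_mx conjc z) = conjc (cdot k z).
Proof.
rewrite /cdot rmorph_sum; apply: eq_bigr => i _.
by rewrite mxE rmorphM /= rmorph_int.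
Qed.

Lemma ek_conj k z : ek k (map_mx conjc z) = conjc (ek (- k) z).
Proof.
rewrite /ek cdot_conj -cexp_conj cdotNl; congr cexp.
rewrite rmorphM rmorphN /= /i2pi; case: (cdot k z) => x y /=.
by apply/eqP; rewrite eq_complex /=; apply/andP; split; apply/eqP; ring.
Qed.

Lemma nc_ek k z (s : R) : strip s z ->
  nc (ek k z) <= expR (2 * pi * s * (ell1 k)%:R).
Proof.
move=> zs; rewrite nc_cexp ler_expR.
have -> : complex.Re (i2pi * cdot k z) = - (2 * pi * complex.Im (cdot k z)).
  by case: (cdot k z) => x y /=; ring.
rewrite -mulrN -mulrA ler_wpM2l ?mulr_ge0 ?pi_ge0//.
apply: le_trans (ler_norm _) _; rewrite normrN.
have -> : complex.Im (cdot k z) = \sum_i (k 0 i)%:~R * complex.Im (z 0 i).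
  rewrite /cdot Im_sum.
  apply: eq_bigr => i _; rewrite intC; case: (z 0 i) => x y /=.
  by rewrite mul0r addr0.
apply: le_trans (ler_norm_sum _ _ _) _.
rewrite /ell1 natr_sum mulr_sumr; apply: ler_sum => i _.
rewrite normrM mulrC -intr_norm -abszE.
by rewrite ler_wpM2r.
Qed.

Lemma strip_toC x (s : R) : 0 <= s -> strip s (toC x).
Proof. by move=> s0 i; rewrite mxE /= normr0. Qed.

Lemma stripD (s t : R) z w : strip s z -> strip t w -> strip (s + t) (z + w).
Proof.
move=> zs wt i; rewrite mxE; case: (z 0 i) (zs i) (w 0 i) (wt i) => x y h [u v] h' /=.
by apply: le_trans (ler_normD _ _) (lerD _ _).
Qed.

Lemma vbd_strip (s : R) z : vbd s z -> strip s z.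
Proof. by move=> zs i; apply: le_trans (nc_Im _) (zs i). Qed.

Lemma strip_le (s t : R) z : s <= t -> strip s z -> strip t z.
Proof. by move=> st zs i; apply: le_trans (zs i) st. Qed.

Lemma strip_conj (s : R) z : strip s z -> strip s (map_mx conjc z).
Proof. by move=> zs i; rewrite mxE; case: (z 0 i) (zs i) => x y; rewrite /= normrN. Qed.

End Monomials.

(** * Trigonometric polynomials: norms, Taylor estimates, reality *)

Section TrigPolynomials.
Variables (R : realType) (n : nat).
Local Notation C := R[i].
Implicit Types (k l : 'rV[int]_n) (z w h : 'rV[C]_n) (c d : 'rV[int]_n -> C).

(** The coefficients form a total function and the degree is a separate argument, so that truncating
    a series only changes N. *)
Definition pev N c z : C := \sum_(k <- box n N) c k * ek k z.

Definition trig N (f : 'rV[C]_n -> C) := exists c, forall z, f z = pev N c z.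

Lemma trig_pev N c : trig N (pev N c). Proof. by exists c. Qed.

Lemma eq_trig N f g : f =1 g -> trig N f -> trig N g.
Proof. by move=> fg [c fc]; exists c => z; rewrite -fg. Qed.

Lemma pev_widen N M c z : (N <= M)%N ->
  (forall k, (N < freq_norm k)%N -> c k = 0) -> pev M c z = pev N c z.
Proof. by move=> NM h; apply: big_box_supp => // k /h ->; rewrite mul0r. Qed.

Lemma pev_eq N c d z : (forall k, (freq_norm k <= N)%N -> c k = d k) ->
  pev N c z = pev N d z.
Proof.
by move=> cd; apply: eq_big_seq => k; rewrite mem_box => /cd ->.
Qed.

Lemma pevD N c d z : pev N (fun k => c k + d k) z = pev N c z + pev N d z.
Proof. by rewrite /pev -big_split; apply: eq_bigr => k _; rewrite mulrDl. Qed.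

Lemma pevN N c z : pev N (fun k => - c k) z = - pev N c z.
Proof. by rewrite /pev -sumrN; apply: eq_bigr => k _; rewrite mulNr. Qed.

Lemma pevB N c d z : pev N (fun k => c k - d k) z = pev N c z - pev N d z.
Proof. by rewrite pevD pevN. Qed.

Lemma pevZ N a c z : pev N (fun k => a * c k) z = a * pev N c z.
Proof. by rewrite /pev mulr_sumr; apply: eq_bigr => k _; rewrite mulrA. Qed.

Lemma pev_sum (I : Type) (s : seq I) (P : pred I) N (c : I -> 'rV[int]_n -> C) z :
  pev N (fun k => \sum_(i <- s | P i) c i k) z = \sum_(i <- s | P i) pev N (c i) z.
Proof.
rewrite /pev exchange_big; apply: eq_bigr => k _.
by rewrite mulr_suml.
Qed.

Lemma pev_delta N (a : C) l z : (freq_norm l <= N)%N ->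
  pev N (fun k => if k == l then a else 0) z = a * ek l z.
Proof.
rewrite -mem_box => lN; rewrite /pev (bigD1_seq l) ?box_uniq//= eqxx.
by rewrite big1 ?addr0// => k /negbTE ->; rewrite mul0r.
Qed.

Lemma trig_mono N (a : C) l : (freq_norm l <= N)%N -> trig N (fun z => a * ek l z).
Proof. by move=> lN; exists (fun k => if k == l then a else 0) => z; rewrite pev_delta. Qed.

Lemma trig_cst N (a : C) : trig N (fun=> a).
Proof.
apply: (@eq_trig _ (fun z => a * ek 0 z)); first by move=> z; rewrite ek0 mulr1.
by apply: trig_mono; rewrite freq_norm0.
Qed.

Lemma trigD N f g : trig N f -> trig N g -> trig N (fun z => f z + g z).
Proof. by move=> [c fc] [d gd]; eexists => z; rewrite fc gd -pevD. Qed.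

Lemma trigZ N a f : trig N f -> trig N (fun z => a * f z).
Proof. by move=> [c fc]; eexists => z; rewrite fc -pevZ. Qed.

Lemma trig_sum (I : Type) (s : seq I) (P : pred I) N (F : I -> 'rV[C]_n -> C) :
  (forall i, P i -> trig N (F i)) -> trig N (fun z => \sum_(i <- s | P i) F i z).
Proof.
move=> FN; elim: s => [|i s IH].
  by apply: eq_trig (trig_cst N 0) => z; rewrite big_nil.
have [Pi|Pi] := boolP (P i).
  by apply: eq_trig (trigD (FN i Pi) IH) => z; rewrite big_cons Pi.
by apply: eq_trig IH => z; rewrite big_cons (negbTE Pi).
Qed.

Lemma trig_widen N M f : (N <= M)%N -> trig N f -> trig M f.
Proof.
move=> NM [c fc]; apply: (@eq_trig _ (fun z => \sum_(k <- box n N | k \in box n M) c k * ek k z)).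
  move=> z; rewrite fc /pev big_mkcond; apply: eq_big_seq => k.
  by rewrite !mem_box => /leq_trans ->.
apply: trig_sum => k; rewrite mem_box; exact: trig_mono.
Qed.

Lemma trigM N M f g : trig N f -> trig M g -> trig (N + M) (fun z => f z * g z).
Proof.
move=> [c fc] [d gd].
apply: (@eq_trig _ (fun z => \sum_(k <- box n N | k \in box n N)
  \sum_(l <- box n M | l \in box n M) c k * d l * ek (k + l) z)).
  move=> z; rewrite fc gd /pev mulr_suml big_mkcond; apply: eq_big_seq => k kN.
  rewrite kN mulr_sumr big_mkcond; apply: eq_big_seq => l lM.
  by rewrite lM ekDl; ring.
apply: trig_sum => k; rewrite mem_box => kN; apply: trig_sum => l; rewrite mem_box => lM.
by apply: trig_mono; apply: leq_trans (freq_normD _ _) (leq_add _ _).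
Qed.

Definition tpoly (f : 'rV[C]_n -> C) := exists N, trig N f.

Lemma tpoly_pev N c : tpoly (pev N c). Proof. by exists N, c. Qed.

Lemma eq_tpoly f g : f =1 g -> tpoly f -> tpoly g.
Proof. by move=> fg [N fN]; exists N; apply: eq_trig fN. Qed.

Lemma tpoly_cst a : tpoly (fun=> a). Proof. by exists 0%N; apply: trig_cst. Qed.

Lemma tpolyD f g : tpoly f -> tpoly g -> tpoly (fun z => f z + g z).
Proof.
move=> [N fN] [M gM]; exists (maxn N M).
by apply: trigD; [apply: trig_widen fN|apply: trig_widen gM];
  rewrite ?leq_maxl ?leq_maxr.
Qed.

Lemma tpolyZ a f : tpoly f -> tpoly (fun z => a * f z).
Proof. by move=> [N fN]; exists N; apply: trigZ. Qed.

Lemma tpolyM f g : tpoly f -> tpoly g -> tpoly (fun z => f z * g z).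
Proof. by move=> [N fN] [M gM]; exists (N + M)%N; apply: trigM. Qed.

Lemma tpolyX f m : tpoly f -> tpoly (fun z => f z ^+ m).
Proof.
move=> ff; elim: m => [|m IH]; first by apply: eq_tpoly (tpoly_cst 1).
by apply: eq_tpoly (tpolyM ff IH) => z; rewrite exprS.
Qed.

Lemma tpoly_sum (I : Type) (s : seq I) (P : pred I) (F : I -> 'rV[C]_n -> C) :
  (forall i, P i -> tpoly (F i)) -> tpoly (fun z => \sum_(i <- s | P i) F i z).
Proof.
move=> FN; elim: s => [|i s IH].
  by apply: eq_tpoly (tpoly_cst 0) => z; rewrite big_nil.
have [Pi|Pi] := boolP (P i).
  by apply: eq_tpoly (tpolyD (FN i Pi) IH) => z; rewrite big_cons Pi.
by apply: eq_tpoly IH => z; rewrite big_cons (negbTE Pi).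
Qed.

Definition wnorm (s : R) N c : R :=
  \sum_(k <- box n N) nc (c k) * expR (2 * pi * s * (ell1 k)%:R).

(* [wnorm] bounds the polynomial on the strip, [lip] its derivative. *)
Definition lip (s : R) N c : R :=
  \sum_(k <- box n N) nc (c k) * (2 * pi * (ell1 k)%:R)
                       * expR (2 * pi * s * (ell1 k)%:R).

Lemma wnorm_ge0 s N c : 0 <= wnorm s N c.
Proof. by apply: sumr_ge0 => k _; rewrite mulr_ge0 ?nc_ge0 ?expR_ge0. Qed.

Lemma nc_pev s N c z : strip s z -> nc (pev N c z) <= wnorm s N c.
Proof.
move=> zs; apply: le_trans (nc_sum _ _ _) _; apply: ler_sum => k _.
by rewrite ncM ler_wpM2l ?nc_ge0// nc_ek.
Qed.

Lemma lip_le s t N c : s <= t -> lip s N c <= lip t N c.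
Proof.
move=> st; apply: ler_sum => k _; rewrite ler_wpM2l//.
  by rewrite !mulr_ge0 ?nc_ge0 ?pi_ge0.
by rewrite ler_expR ler_wpM2r// ler_wpM2l ?mulr_ge0 ?pi_ge0.
Qed.

Lemma lipD s N c d : lip s N (fun k => c k + d k) <= lip s N c + lip s N d.
Proof.
rewrite /lip -big_split; apply: ler_sum => k _ /=; rewrite -!mulrDl.
by rewrite !ler_wpM2r ?ncD ?expR_ge0 ?mulr_ge0 ?pi_ge0.
Qed.

Lemma lip_widen s N M c : (N <= M)%N ->
  (forall k, (N < freq_norm k)%N -> c k = 0) -> lip s M c = lip s N c.
Proof. by move=> NM h; apply: big_box_supp => // k /h ->; rewrite nc0 !mul0r. Qed.

Lemma tpoly_bounded (s : R) f : tpoly f -> exists2 B : R, 0 <= B &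
  forall z, strip s z -> nc (f z) <= B.
Proof.
move=> [N [c fc]]; exists (wnorm s N c); first exact: wnorm_ge0.
by move=> z zs; rewrite fc; exact: nc_pev.
Qed.

(* Coefficients of the derivative in the direction h. *)
Definition dcoef h c : 'rV[int]_n -> C := fun k => i2pi R * cdot k h * c k.

Lemma nc_i2pi_cdot k h (b : R) : vbd b h ->
  nc (i2pi R * cdot k h) <= 2 * pi * (ell1 k)%:R * b.
Proof.
by move=> hb; rewrite ncM nc_i2pi -!mulrA !ler_wpM2l ?pi_ge0// nc_cdot.
Qed.

Lemma pev_dcoef (s b : R) N c z h : strip s z -> vbd b h ->
  nc (pev N (dcoef h c) z) <= b * lip s N c.
Proof.
move=> zs hb; apply: le_trans (nc_sum _ _ _) _; rewrite mulr_sumr.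
apply: ler_sum => k _; rewrite !ncM -ncM.
have h1 := nc_i2pi_cdot k hb; have h2 := nc_ek k zs.
apply: le_trans (_ : (2 * pi * (ell1 k)%:R * b) * nc (c k)
   * expR (2 * pi * s * (ell1 k)%:R) <= _); last by apply: eq_ler; ring.
by apply: ler_pM; rewrite ?mulr_ge0 ?nc_ge0// ler_wpM2r ?nc_ge0.
Qed.

(** Each monomial changes by ek k z (ek k h - 1), so the strip only has to contain z; the last
    hypothesis puts every exponent in the range of [cexp_taylor1]. *)
Lemma pev_taylor1 (s b : R) N c z h : 0 <= b -> strip s z -> vbd b h ->
  (forall k, (freq_norm k <= N)%N -> 2 * pi * (ell1 k)%:R * b <= 1 / 2) ->
  nc (pev N c (z + h) - pev N c z) <= 3 * b * lip s N c.
Proof.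
move=> b0 zs hb hN; rewrite /pev -sumrB; apply: le_trans (nc_sum _ _ _) _.
rewrite mulr_sumr; apply: ler_sum_box => k kN.
rewrite ekDr -mulrBr -{2}[ek k z]mulr1 -mulrBr !ncM.
have h1 := nc_i2pi_cdot k hb; have h2 := nc_ek k zs.
have h3 := cexp_taylor1 (le_trans h1 (hN k kN)).
apply: le_trans (_ : nc (c k) * (expR (2 * pi * s * (ell1 k)%:R)
   * (3 * (2 * pi * (ell1 k)%:R * b))) <= _); last by apply: eq_ler; ring.
rewrite ler_wpM2l ?nc_ge0//; apply: ler_pM; rewrite ?nc_ge0//.
by apply: le_trans h3 _; rewrite ler_wpM2l.
Qed.

(** The quadratic remainder carries the square of the l^1 norm of k; one of the two factors is
    bounded by n N, so that [lip] controls the rest. *)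
Lemma pev_taylor2 (s b : R) N c z h : 0 <= b -> strip s z -> vbd b h ->
  (forall k, (freq_norm k <= N)%N -> 2 * pi * (ell1 k)%:R * b <= 1 / 2) ->
  nc (pev N c (z + h) - pev N c z - pev N (dcoef h c) z)
    <= 8 * pi * (n * N)%:R * b ^+ 2 * lip s N c.
Proof.
move=> b0 zs hb hN; rewrite /pev -!sumrB; apply: le_trans (nc_sum _ _ _) _.
rewrite mulr_sumr; apply: ler_sum_box => k kN.
have -> : c k * ek k (z + h) - c k * ek k z - dcoef h c k * ek k z
  = c k * (ek k z * (ek k h - 1 - i2pi R * cdot k h)).
  by rewrite ekDr /dcoef; ring.
rewrite !ncM.
have h1 := nc_i2pi_cdot k hb; have h2 := nc_ek k zs.
have h3 := cexp_taylor2 (le_trans h1 (hN k kN)).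
have h4 : (ell1 k)%:R <= (n * N)%:R :> R.
  by rewrite ler_nat; apply: leq_trans (ell1_le k) _; rewrite leq_mul.
apply: le_trans (_ : nc (c k) * (expR (2 * pi * s * (ell1 k)%:R)
   * (4 * ((2 * pi * (ell1 k)%:R * b) * (2 * pi * (n * N)%:R * b)))) <= _).
  rewrite ler_wpM2l ?nc_ge0//; apply: ler_pM; rewrite ?nc_ge0//.
  apply: le_trans h3 _; rewrite ler_wpM2l// expr2.
  apply: ler_pM; rewrite ?nc_ge0//; apply: le_trans h1 _.
  by rewrite ler_wpM2r// ler_wpM2l ?mulr_ge0 ?pi_ge0.
by apply: eq_ler; ring.
Qed.

Definition csym c := forall k, conjc (c k) = c (- k).

Lemma pev_conj N c z : csym c -> pev N c (map_mx conjc z) = conjc (pev N c z).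
Proof.
move=> cs; rewrite /pev rmorph_sum big_box_opp; apply: eq_bigr => k _ /=.
by rewrite ek_conj opprK rmorphM /= cs.
Qed.

(** Coefficients of (f(z) + conj f(conj z)) / 2, which agrees with the real part of f on real
    points. It restores reality after steps that lose it. *)
Definition symc c : 'rV[int]_n -> C := fun k => (c k + conjc (c (- k))) / 2.

Lemma symc_csym c : csym (symc c).
Proof.
move=> k; rewrite /symc (rmorphM (@conjc R)) fmorphV (rmorphD (@conjc R)) (rmorph_nat (@conjc R)).
by rewrite [X in _ + X]conjcK opprK addrC.
Qed.

Lemma pev_symc N c z :
  pev N (symc c) z = (pev N c z + conjc (pev N c (map_mx conjc z))) / 2.
Proof.
rewrite /pev rmorph_sum [X in _ + X]big_box_opp -big_split mulr_suml.
apply: eq_bigr => k _ /=; rewrite (rmorphM (@conjc R)).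
by rewrite -[X in _ + _ * X]ek_conj (_ : map_mx conjc (map_mx conjc z) = z) /symc;
  [ring|apply/rowP => i; rewrite !mxE conjcK].
Qed.

Lemma pev_symc_id N c z :
  pev N c (map_mx conjc z) = conjc (pev N c z) -> pev N (symc c) z = pev N c z.
Proof. by move=> h; rewrite pev_symc h conjcK; field. Qed.

Lemma nc_expR_sub1 (t : R) : `|expR t - 1| <= `|t| * expR `|t|.
Proof.
have [t0|/ltW t0] := leP 0 t.
  have := expR_ge1Dx (- t); rewrite expRN => h.
  have e0 := expR_gt0 t; have e1 : 1 <= expR t by have := expR_ge1Dx t; lra.
  rewrite !ger0_norm ?subr_ge0//.
  by have := ler_wpM2r (ltW e0) h; rewrite mulVf ?gt_eqF// mulrDl; lra.
have h := expR_ge1Dx t; have e1 : expR t <= 1 by rewrite expR_le1.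
rewrite !ler0_norm ?subr_le0//.
have : 1 <= expR (- t) by have := expR_ge1Dx (- t); lra.
by move=> h1; have : - t * 1 <= - t * expR (- t); [rewrite ler_wpM2l; lra|lra].
Qed.

(** Such a polynomial is real at the real part x of z, so Im f(z) = Im (f(z) - f(x)), and z - x is
    purely imaginary of size s. With [lip] at most 1 this keeps z + U(z) in the strip of width 2
    s. *)
Lemma pev_Im (s : R) N c z : 0 <= s -> csym c -> strip s z ->
  `|complex.Im (pev N c z)| <= s * lip s N c.
Proof.
move=> s0 cs zs; pose x := map_mx (fun u : C => (complex.Re u)%:C%C) z.
have xc : map_mx conjc x = x.
  by apply/rowP => i; rewrite !mxE /= oppr0.
have /(congr1 (fun u : C => complex.Im u)) : pev N c x = conjc (pev N c x) by rewrite -pev_conj// xc.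
have -> : complex.Im (conjc (pev N c x)) = - complex.Im (pev N c x).
  by case: (pev N c x).
move=> im0; have {}im0 : complex.Im (pev N c x) = 0 by lra.
have -> : complex.Im (pev N c z) = complex.Im (pev N c z - pev N c x).
  by rewrite ImD; case: (pev N c x) im0 => u v /= ->; rewrite oppr0 addr0.
apply: le_trans (nc_Im _) _; rewrite /pev -sumrB.
apply: le_trans (nc_sum _ _ _) _; rewrite mulr_sumr; apply: ler_sum => k _.
rewrite -mulrBr ncM -!mulrA [leRHS]mulrCA ler_wpM2l ?nc_ge0//.
pose y : 'rV[C]_n := \row_i (0 +i* complex.Im (z 0 i))%C.
have -> : z = x + y.
  by apply/rowP => i; rewrite !mxE /=; case: (z 0 i) => u v /=; apply/eqP; rewrite eq_complex /= addr0 add0r !eqxx.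
rewrite ekDr -{2}[ek k x]mulr1 -mulrBr ncM.
have -> : nc (ek k x) = 1.
  rewrite /ek nc_cexp.
  have -> : complex.Re (i2pi R * cdot k x) = - (2 * pi * complex.Im (cdot k x)).
    by case: (cdot k x) => u v /=; ring.
  rewrite (_ : complex.Im _ = 0) ?mulr0 ?oppr0 ?expR0// /cdot Im_sum big1// => i _.
  by rewrite mxE intC /= mulr0 mul0r addr0.
rewrite mul1r; pose t := \sum_i (k 0 i)%:~R * complex.Im (z 0 i).
have -> : ek k y = ((expR (- (2 * pi * t)))%:C)%C.
  rewrite /ek (_ : cdot k y = (0 +i* t)%C); last first.
    rewrite /cdot; apply/eqP; rewrite eq_complex Re_sum Im_sum /=; apply/andP; split.
      by apply/eqP; rewrite big1// => i _; rewrite mxE intC /= mulr0 mul0r subr0.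
    by apply/eqP/eq_bigr => i _; rewrite mxE intC /= mul0r addr0.
  by rewrite /cexp /= !mul0r !mulr0 addr0 sub0r cos0 sin0 mulr1 mulr0.
rewrite -(rmorph1 (real_complex R)) -rmorphB nc_real.
have t1 : `|2 * pi * t| <= 2 * pi * s * (ell1 k)%:R.
  rewrite normrM ger0_norm ?mulr_ge0 ?pi_ge0// -[leRHS]mulrA.
  rewrite ler_wpM2l ?mulr_ge0 ?pi_ge0//.
  apply: le_trans (ler_norm_sum _ _ _) _.
  rewrite /ell1 natr_sum mulr_sumr; apply: ler_sum => i _.
  by rewrite normrM mulrC -intr_norm -abszE ler_wpM2r.
apply: le_trans (nc_expR_sub1 _) _; rewrite normrN.
apply: le_trans (_ : (2 * pi * s * (ell1 k)%:R) * expR (2 * pi * s * (ell1 k)%:R) <= _).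
  by apply: ler_pM; rewrite ?expR_ge0// ler_expR.
by rewrite -!mulrA; apply: eq_ler; ring.
Qed.

End TrigPolynomials.

(** * Cauchy estimates, tails and polynomial approximation *)

Section CoefficientBounds.
Variables (R : realType) (n : nat).
Local Notation C := R[i].
Implicit Types (k l : 'rV[int]_n) (z w h : 'rV[C]_n) (c d : 'rV[int]_n -> C).

Lemma cexp_i2pi_nat (m : nat) : cexp (i2pi R * m%:R) = 1.
Proof.
rewrite mulr_natr cexpX (_ : cexp _ = 1) ?expr1n// /cexp /= expR0 !mul1r.
by rewrite mulrC mulr_natr cos2pi sin2pi.
Qed.

Lemma cexp_i2pi_int (m : int) : cexp (i2pi R * m%:~R) = 1.
Proof.
case: m => m; first by rewrite -pmulrn cexp_i2pi_nat.
rewrite NegzE mulrNz mulrN; have := cexp_i2pi_nat m.+1; rewrite pmulrn => h.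
transitivity (cexp (- (i2pi R * m.+1%:~R)) * cexp (i2pi R * m.+1%:~R)).
  by rewrite h mulr1.
by rewrite -cexpD addNr cexp0.
Qed.

Lemma cexp_i2pi_neq1 (t : R) : 0 < `|t| < 1 -> cexp (i2pi R * (t%:C)%C) != 1.
Proof.
move=> t01; apply/negP => /eqP; rewrite /cexp /= !mul0r mulr0 subrr add0r expR0 !mul1r.
move=> [ct _].
have : sin (pi * t) ^+ 2 = 0.
  have e : 2 * pi * t = (pi * t) *+ 2 by rewrite mulr2n; ring.
  by move: ct; rewrite e cos_mulr2n cos2sin2 mulr2n; lra.
move=> /eqP; rewrite sqrf_eq0 => /eqP st.
have pp := @pi_gt0 R.
have : 0 < sin (pi * `|t|).
  case/andP: t01 => t0 t1; apply: sin_gt0_pi.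
  by rewrite mulr_gt0//= -[ltRHS]mulr1 ltr_pM2l.
have [t0|t0] := leP 0 t; first by rewrite ger0_norm// st ltxx.
by rewrite ltr0_norm// mulrN sinN st oppr0 ltxx.
Qed.

Lemma grid_sum M (l : int) : (0 < M)%N -> (`|l| < M)%N ->
  \sum_(t < M) cexp (i2pi R * (l%:~R * (t%:R / M%:R))) = (if l == 0 then M%:R else 0).
Proof.
move=> M0 lM; have MC : M%:R != 0 :> C by rewrite pnatr_eq0 -lt0n.
have [->|l0] := eqVneq l 0.
  rewrite (eq_bigr (fun=> 1)) => [|t _]; last by rewrite mul0r mulr0 cexp0.
  by rewrite sumr_const card_ord.
pose q := cexp (i2pi R * (l%:~R / M%:R)).
have q1 : q != 1.
  rewrite /q (_ : l%:~R / M%:R = (l%:~R / M%:R)%:C%C); last first.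
    by rewrite rmorphM /= fmorphV rmorph_int rmorph_nat.
  apply: cexp_i2pi_neq1; have MR : 0 < M%:R :> R by rewrite ltr0n.
  rewrite normrM -intr_norm -abszE normfV normr_nat.
  by rewrite ltr_pdivrMr// mul1r ltr_nat lM divr_gt0// ltr0n absz_gt0.
rewrite (eq_bigr (fun t : 'I_M => q ^+ t)) => [|t _]; last first.
  by rewrite /q -cexpX; congr cexp; rewrite -mulr_natr; ring.
have := subrX1 q M; rewrite (_ : q ^+ M = 1); last first.
  by rewrite /q -cexpX -[_ *+ M]mulr_natr -mulrA mulfVK ?cexp_i2pi_int.
by rewrite subrr => /esym/eqP; rewrite mulf_eq0 subr_eq0 (negbTE q1) => /eqP.
Qed.

Definition grid_pt M (f : {ffun 'I_n -> 'I_M}) : 'rV[C]_n :=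
  \row_i ((f i)%:R / M%:R).

(* Means over the finite grid (Z/M)^n play the role of Fourier integrals. *)
Lemma grid_orth M l : (0 < M)%N -> (freq_norm l < M)%N ->
  \sum_(f : {ffun 'I_n -> 'I_M}) ek l (grid_pt f)
  = (if l == 0 then (M ^ n)%N%:R else 0).
Proof.
move=> M0 lM.
transitivity (\sum_(f : {ffun 'I_n -> 'I_M}) \prod_(i < n)
    cexp (i2pi R * ((l 0 i)%:~R * ((f i)%:R / M%:R)))).
  apply: eq_bigr => f _; rewrite /ek /cdot mulr_sumr cexp_sum.
  by apply: eq_bigr => i _; rewrite mxE.
rewrite -(bigA_distr_bigA (fun i (t : 'I_M) =>
    cexp (i2pi R * ((l 0 i)%:~R * (t%:R / M%:R))))).
have hl i : (`|l 0%R i| < M)%N := leq_ltn_trans (freq_norm_ge l i) lM.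
have [->|l0] := eqVneq l 0.
  rewrite (eq_bigr (fun=> M%:R)) => [|i _]; last by rewrite grid_sum ?mxE.
  by rewrite prodr_const card_ord natrX.
have [i li] : exists i, l 0 i != 0.
  apply/existsP; apply: contraR l0 => /existsPn h; apply/eqP/rowP => i.
  by rewrite mxE; apply/eqP; have := h i; rewrite negbK.
by rewrite (bigD1 i)//= grid_sum// (negbTE li) mul0r.
Qed.

(** Cauchy estimate: c_k is the mean of f(z) e_{-k}(z) over a real grid translated by the imaginary
    vector with components -s sgn(k_i), where |e_{-k}| equals exp(-2 pi s |k|_1). *)
Lemma coef_bound (s B : R) N c k : 0 <= s ->
  (forall z, strip s z -> nc (pev N c z) <= B) -> (freq_norm k <= N)%N ->
  nc (c k) * expR (2 * pi * s * (ell1 k)%:R) <= B.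
Proof.
(* M exceeds 2 N, hence every |m - k| with m and k in the box: no aliasing on the grid. *)
move=> s0 hB kN; pose M := N.*2.+1.
pose y : 'rV[C]_n := \row_i (0 +i* (- s * Num.sg (k 0 i)%:~R))%C.
have M0 : (0 < M)%N by [].
pose zf (f : {ffun 'I_n -> 'I_M}) := grid_pt f + y.
have ysg i : `|s * Num.sg (k 0 i)%:~R| <= s.
  rewrite normrM ger0_norm// -[leRHS]mulr1 ler_wpM2l// normr_sg.
  by case: (_ != _).
have zs f : strip s (zf f).
  move=> i; rewrite !mxE ImD /=.
  rewrite (_ : complex.Im _ = 0) ?add0r ?mulNr ?normrN//.
  by rewrite -[_ / _](_ : ((f i)%:R / M%:R)%:C%C = _)// rmorphM fmorphV !rmorph_nat.
have key : c k * (M ^ n)%N%:R = \sum_f pev N c (zf f) * ek (- k) (zf f).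
  transitivity (\sum_(f : {ffun 'I_n -> 'I_M}) \sum_(m <- box n N) c m * ek (m - k) y * ek (m - k) (grid_pt f)).
    rewrite exchange_big /=; under [RHS]eq_bigr do rewrite -mulr_sumr.
    rewrite (bigD1_seq k) ?mem_box ?box_uniq//= [X in _ = _ + X]big1_seq ?addr0.
      by rewrite grid_orth// subrr ?freq_norm0// eqxx ek0 mulr1.
    move=> m /andP[mk]; rewrite mem_box => mN; rewrite grid_orth//.
      by rewrite subr_eq0 (negbTE mk) mulr0.
    apply: leq_ltn_trans (freq_normD _ _) _; rewrite freq_normN ltnS -addnn.
    exact: leq_add.
  apply: eq_bigr => f _; rewrite /pev mulr_suml; apply: eq_bigr => m _.
  by rewrite -!mulrA -ekDl /zf ekDr [X in _ * X]mulrC.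
have yk : nc (ek (- k) y) = expR (- (2 * pi * s * (ell1 k)%:R)).
  rewrite /ek nc_cexp; congr expR.
  rewrite (_ : cdot (- k) y = (0 +i* (s * (ell1 k)%:R))%C) /=; first by ring.
  rewrite cdotNl /cdot; apply/eqP; rewrite eq_complex; apply/andP; split; apply/eqP.
    transitivity (- complex.Re (\sum_i (k 0 i)%:~R * y 0 i)); first by case: (\sum_i _).
    by rewrite Re_sum big1 ?oppr0// => i _; rewrite mxE intC /= mulr0 mul0r subr0.
  transitivity (- complex.Im (\sum_i (k 0 i)%:~R * y 0 i)); first by case: (\sum_i _).
  rewrite Im_sum /ell1 natr_sum mulr_sumr -sumrN; apply: eq_bigr => i _.
  rewrite mxE intC /= mul0r addr0 mulNr mulrN opprK.
  rewrite mulrCA; congr (_ * _).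
  by rewrite mulrC -normrEsg -intr_norm -abszE.
have nf f : nc (pev N c (zf f) * ek (- k) (zf f))
   <= B * expR (- (2 * pi * s * (ell1 k)%:R)).
  rewrite ncM; apply: ler_pM; rewrite ?nc_ge0// ?hB//.
  rewrite /zf ekDr ncM yk -[leRHS]mul1r ler_wpM2r ?expR_ge0//.
  apply: le_trans (@nc_ek _ _ _ _ 0 _) _.
    move=> i; rewrite mxE (_ : complex.Im _ = 0) ?normr0//.
    by rewrite -[_ / _](_ : ((f i)%:R / M%:R)%:C%C = _)// rmorphM fmorphV !rmorph_nat.
  by rewrite mulr0 mul0r expR0.
have Mn : 0 < (M ^ n)%N%:R :> R by rewrite ltr0n expn_gt0.
have : nc (c k) * (M ^ n)%N%:R <= B * expR (- (2 * pi * s * (ell1 k)%:R)) * (M ^ n)%N%:R.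
  rewrite -[X in _ * X <= _](_ : nc (M ^ n)%N%:R = _); last first.
    by rewrite -(rmorph_nat (real_complex R)) nc_real normr_nat.
  rewrite -ncM key; apply: le_trans (nc_sum _ _ _) _.
  apply: le_trans (ler_sum _ (fun f _ => nf f)) _.
  apply: eq_ler; rewrite sumr_const.
  by rewrite [RHS]mulr_natr; congr (_ *+ _); rewrite card_ffun !card_ord.
by rewrite ler_pM2r// expRN -ler_pdivrMr ?invrK// invr_gt0 expR_gt0.
Qed.

Lemma coef_bound0 (s B : R) N c k : 0 <= s ->
  (forall z, strip s z -> nc (pev N c z) <= B) -> (freq_norm k <= N)%N ->
  nc (c k) <= B.
Proof.
move=> s0 hB kN; apply: le_trans (coef_bound s0 hB kN).
rewrite -[leLHS]mulr1 ler_wpM2l ?nc_ge0//.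
rewrite -[leLHS]expR0 ler_expR !mulr_ge0 ?pi_ge0//.
Qed.

(** The sup norm on the strip bounds each weighted coefficient, so the price of passing to the
    weighted sum of a truncation is the number of its frequencies, polynomial in K. *)
Lemma wnorm_le (s B : R) N K c : 0 <= s ->
  (forall z, strip s z -> nc (pev N c z) <= B) -> (K <= N)%N ->
  wnorm s K c <= (K.*2.+1 ^ n)%:R * B.
Proof.
move=> s0 hB KN; apply: le_trans (_ : \sum_(k <- box n K) B <= _).
  by apply: ler_sum_box => k kK; apply: coef_bound hB (leq_trans kK KN).
by rewrite big_const_seq count_predT size_box iter_addr_0 mulr_natl.
Qed.

Lemma sum_centered (V : zmodType) (g : int -> V) M :
  \sum_(m < M.*2.+1) g ((m : nat)%:Z - M%:Z)
  = g 0 + \sum_(j < M) (g j.+1%:Z + g (- j.+1%:Z)).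
Proof.
elim: M => [|M IH]; first by rewrite big_ord_recl !big_ord0 subr0 addr0.
rewrite doubleS -(big_mkord xpredT (fun m => g (m%:Z - M.+1%:Z))).
rewrite big_nat_recr// big_nat_recl// big_mkord [in RHS]big_ord_recr /= addrA -IH.
rewrite sub0r (_ : (M.*2.+2)%:Z - M.+1%:Z = M.+1%:Z); last by lia.
rewrite [LHS]addrAC [RHS]addrC (addrC (g (- _)) (g _)).
congr (_ + _); apply: eq_bigr => i _; congr g; lia.
Qed.

Lemma geometric_le (q : R) M : 0 <= q -> q < 1 ->
  \sum_(j < M) q ^+ j.+1 <= q / (1 - q).
Proof.
move=> q0 q1; have q2 : 0 < 1 - q by lra.
rewrite ler_pdivlMr// mulr_suml.
have -> : \sum_(j < M) q ^+ j.+1 * (1 - q) = q - q ^+ M.+1.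
  elim: M => [|M IH]; first by rewrite big_ord0 expr1 subrr.
  by rewrite big_ord_recr /= IH !exprS; ring.
by rewrite lerBlDr lerDl exprn_ge0.
Qed.

(** The sum factors into n one-dimensional sums 1 + 2 (q + q^2 + ...) with q = exp(-d), and q / (1 -
    q) <= 1 / d amounts to exp(d) >= 1 + d. *)
Lemma sum_expR_ell1 (d : R) N : 0 < d ->
  \sum_(k <- box n N) expR (- (d * (ell1 k)%:R)) <= (1 + 2 / d) ^+ n.
Proof.
move=> d0; pose g (m : int) : R := expR (- d) ^+ `|m|%N.
rewrite (eq_bigr (fun k => \prod_(i < n) g (k 0 i))) => [|k _]; last first.
  by rewrite /g -expr_sum -expRM_natl mulrN [in RHS]mulrC.
rewrite sum_box_prod lerXn2r ?nnegrE//.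
- by apply: sumr_ge0 => m _; rewrite exprn_ge0 ?expR_ge0.
- by rewrite addr_ge0// divr_ge0// ltW.
rewrite sum_centered /g absz0 expr0 lerD2l big_split /=.
have q1 : expR (- d) < 1 by rewrite expR_lt1 oppr_lt0.
suff h : \sum_(i < N) expR (- d) ^+ i.+1 <= 1 / d.
  by apply: le_trans (lerD h h) _; rewrite -mulrDl.
apply: le_trans (geometric_le _ (expR_ge0 _) q1) _.
rewrite ler_pdivrMr ?subr_gt0// -(ler_pM2l (expR_gt0 d)) expRxMexpNx_1.
have -> : expR d * (1 / d * (1 - expR (- d))) = d^-1 * (expR d - 1).
  by rewrite mul1r mulrCA mulrBr mulr1 expRxMexpNx_1.
by rewrite -ler_pdivrMl ?invr_gt0// invrK mulr1; have := expR_ge1Dx d; lra.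
Qed.

(** A loss d of strip gains exp(-2 pi d |k|_1). Beyond degree K one half of the exponent gives
    exp(-pi d K), and the other half makes the sum over all frequencies finite. *)
Definition tail_factor (d : R) K : R :=
  expR (- (pi * d * K%:R)) * (1 + 2 / (pi * d)) ^+ n.

Lemma tail_bound (s d B : R) N K c z : 0 < d -> 0 <= s ->
  (forall z, strip (s + d) z -> nc (pev N c z) <= B) -> strip s z ->
  nc (\sum_(k <- box n N | k \notin box n K) c k * ek k z) <= B * tail_factor d K.
Proof.
move=> d0 s0 hB zs; apply: le_trans (nc_sum _ _ _) _.
have pd : 0 < pi * d by rewrite mulr_gt0 ?pi_gt0.
have B0 : 0 <= B.
  by apply: le_trans (nc_ge0 _) (hB (toC 0) _); apply: strip_toC; rewrite addr_ge0// ltW.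
apply: le_trans (_ : \sum_(k <- box n N)
   B * (expR (- (pi * d * K%:R)) * expR (- (pi * d * (ell1 k)%:R))) <= _); last first.
  rewrite -mulr_sumr -mulr_sumr ler_wpM2l// ler_wpM2l ?expR_ge0//.
  exact: sum_expR_ell1.
rewrite big_mkcond; apply: ler_sum_box => k kN; case: ifPn => [|_]; last first.
  by rewrite !mulr_ge0 ?expR_ge0.
rewrite mem_box -ltnNge => Kk; rewrite ncM.
apply: le_trans (ler_wpM2l (nc_ge0 _) (nc_ek _ zs)) _.
have h := coef_bound (addr_ge0 s0 (ltW d0)) hB kN.
apply: le_trans (_ : (nc (c k) * expR (2 * pi * (s + d) * (ell1 k)%:R)) *
   (expR (- (pi * d * (ell1 k)%:R)) * expR (- (pi * d * (ell1 k)%:R))) <= _).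
  rewrite -[leRHS]mulrA ler_wpM2l ?nc_ge0// -!expRD ler_expR.
  by apply: eq_ler; ring.
apply: ler_pM; rewrite ?mulr_ge0 ?nc_ge0 ?expR_ge0// ler_wpM2r ?expR_ge0//.
rewrite ler_expR lerN2 ler_wpM2l ?(ltW pd)// ler_nat.
by apply: leq_trans (ltnW Kk) _; exact: freq_norm_ell1.
Qed.

(* The defect F(z + U(z)) - lambda - d_omega U(z) is not a trigonometric polynomial, only a
   uniform limit of such on strips. *)
Definition tapprox (s : R) (f : 'rV[C]_n -> C) := forall e : R, 0 < e ->
  exists2 p, tpoly p & forall z, strip s z -> nc (f z - p z) <= e.

Lemma eq_approx s f g : f =1 g -> tapprox s f -> tapprox s g.
Proof. by move=> fg h e /h[p pp pe]; exists p => // z /pe; rewrite fg. Qed.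

Lemma approx_tpoly s f : tpoly f -> tapprox s f.
Proof. by move=> pf e e0; exists f => // z _; rewrite subrr nc0 ltW. Qed.

Lemma approxD s f g : tapprox s f -> tapprox s g -> tapprox s (fun z => f z + g z).
Proof.
move=> hf hg e e0; have e2 : 0 < e / 2 by rewrite divr_gt0.
have [p pp pe] := hf _ e2; have [q qq qe] := hg _ e2.
exists (fun z => p z + q z); first exact: tpolyD.
move=> z zs; rewrite opprD addrACA; apply: le_trans (ncD _ _) _.
have := pe z zs; have := qe z zs; lra.
Qed.

Lemma approx_sum (I : Type) s (r : seq I) (F : I -> 'rV[C]_n -> C) :
  (forall i, tapprox s (F i)) -> tapprox s (fun z => \sum_(i <- r) F i z).
Proof.
move=> FN; elim: r => [|i r IH].
  apply: eq_approx (approx_tpoly _ (tpoly_cst _ 0)) => z; by rewrite big_nil.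
by apply: eq_approx (approxD (FN i) IH) => z; rewrite big_cons.
Qed.

Lemma approx_mull s p f : tpoly p -> tapprox s f -> tapprox s (fun z => p z * f z).
Proof.
move=> pp hf e e0; have [B B0 hB] := tpoly_bounded s pp.
have B1 : 0 < B + 1 by lra.
have [q qq qe] := hf (e / (B + 1)) (divr_gt0 e0 B1).
exists (fun z => p z * q z); first exact: tpolyM.
move=> z zs; rewrite -mulrBr ncM.
apply: le_trans (_ : (B + 1) * (e / (B + 1)) <= _); last by rewrite mulrCA divff ?mulr1// gt_eqF.
by apply: ler_pM; rewrite ?nc_ge0//; [apply: le_trans (hB _ zs) _; lra|exact: qe].
Qed.

Lemma approx_cexp s f : tpoly f -> tapprox s (fun z => cexp (f z)).
Proof.
move=> pf e e0; have [B B0 hB] := tpoly_bounded s pf.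
have [m hm] := cexp_approx B0 e0.
exists (fun z => (1 + f z / m%:R) ^+ m); last by move=> z zs; apply/hm/hB.
apply: tpolyX; apply: tpolyD; first exact: tpoly_cst.
by apply: eq_tpoly (tpolyZ m%:R^-1 pf) => z; rewrite mulrC.
Qed.

Lemma approx_comp s N c (u : 'I_n -> 'rV[C]_n -> C) : (forall j, tpoly (u j)) ->
  tapprox s (fun z => pev N c (z + \row_j u j z)).
Proof.
move=> pu; apply: approx_sum => k.
apply: (@eq_approx _ (fun z => (c k * ek k z) * cexp (i2pi R * cdot k (\row_j u j z)))).
  by move=> z; rewrite ekDr mulrA.
apply: approx_mull.
  by exists (freq_norm k); apply: trig_mono.
apply: approx_cexp; apply: tpolyZ; apply: tpoly_sum => i _.
by apply: eq_tpoly (tpolyZ (k 0 i)%:~R (pu i)) => z; rewrite mxE.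
Qed.

End CoefficientBounds.

(** * The linearized equation *)

Section LinearStep.
Variables (R : realType) (n : nat).
Local Notation C := R[i].
Implicit Types (k l : 'rV[int]_n) (z w h : 'rV[C]_n) (c d : 'rV[int]_n -> C).

(** Zero mean is the solvability condition of the cohomological equation d_omega z = g. *)
Definition zmean (f : 'rV[C]_n -> C) := exists N c, c 0 = 0 /\ f =1 pev N c.

Lemma zmeanD f g : zmean f -> zmean g -> zmean (fun z => f z + g z).
Proof.
have trunc N M c : (N <= M)%N -> c 0 = 0 -> exists d, d 0 = 0 /\ pev N c =1 pev M d.
  move=> NM c0; exists (fun k => if (freq_norm k <= N)%N then c k else 0).
  split=> [|z]; first by rewrite freq_norm0 leq0n.
  rewrite [RHS](pev_widen _ NM) => [|k]; last by rewrite ltnNge => /negbTE ->.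
  by apply: pev_eq => k ->.
move=> [N [c [c0 fc]]] [M [d [d0 gd]]].
have [c' [c0' hc]] := trunc N (maxn N M) c (leq_maxl _ _) c0.
have [d' [d0' hd]] := trunc M (maxn N M) d (leq_maxr _ _) d0.
exists (maxn N M), (fun k => c' k + d' k); split=> [|z]; first by rewrite c0' d0' addr0.
by rewrite pevD -hc -hd fc gd.
Qed.

Lemma zmean_tpoly f : zmean f -> tpoly f.
Proof. by move=> [N [c [_ fc]]]; exists N, c. Qed.

Lemma tpoly_mean (s B : R) f : 0 <= s -> tpoly f ->
  (forall z, strip s z -> nc (f z) <= B) ->
  exists m, nc m <= B /\ zmean (fun z => f z - m).
Proof.
move=> s0 [N [c fc]] hB; exists (c 0); split.
  apply: (coef_bound0 s0 (N := N)); last by rewrite freq_norm0.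
  by move=> z zs; rewrite -fc; exact: hB.
exists N, (fun k => c k - (if k == 0 then c 0 else 0)); split.
  by rewrite eqxx subrr.
by move=> z; rewrite pevB pev_delta ?freq_norm0// ek0 mulr1 fc.
Qed.

Lemma pev_dcoefD N c z h w :
  pev N (dcoef (h + w) c) z = pev N (dcoef h c) z + pev N (dcoef w c) z.
Proof. by rewrite -pevD; apply: pev_eq => k _; rewrite /dcoef cdotDr; ring. Qed.

(** The direction varies with z: the value is the sum over j of h_j(z) times the j-th partial
    derivative, a sum of products of polynomials. *)
Lemma trig_dcoef N M c (h : 'I_n -> 'rV[C]_n -> C) : (forall j, trig M (h j)) ->
  trig (N + M) (fun z => pev N (dcoef (\row_j h j z) c) z).
Proof.
move=> hM.
apply: (@eq_trig _ _ _ (fun z => \sum_(j < n)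
   (pev N (fun k => i2pi R * (k 0 j)%:~R * c k) z * h j z))).
  move=> z; transitivity (\sum_(j < n) pev N (fun k => h j z * (i2pi R * (k 0 j)%:~R * c k)) z).
    by apply: eq_bigr => j _; rewrite pevZ mulrC.
  rewrite -pev_sum; apply: pev_eq => k _; rewrite /dcoef /cdot mulr_sumr mulr_suml.
  by apply: eq_bigr => j _; rewrite mxE; ring.
by apply: trig_sum => j _; apply: trigM => //; exact: trig_pev.
Qed.

Lemma tpoly_family (h : 'I_n -> 'rV[C]_n -> C) : (forall j, tpoly (h j)) ->
  exists M, forall j, trig M (h j).
Proof.
move=> /choice[M hM]; exists (\max_j M j)%N => j.
by apply: trig_widen (hM j); apply: leq_bigmax.
Qed.

Lemma tpoly_dcoef N c (h : 'I_n -> 'rV[C]_n -> C) : (forall j, tpoly (h j)) ->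
  tpoly (fun z => pev N (dcoef (\row_j h j z) c) z).
Proof. by move=> /tpoly_family[M hM]; eexists; exact: trig_dcoef hM. Qed.

Lemma pev_dcoef_conj K h z c : csym c ->
  pev K (dcoef (map_mx (@conjc R) h) c) (map_mx (@conjc R) z)
  = conjc (pev K (dcoef h c) z).
Proof.
move=> cs; rewrite /pev rmorph_sum [LHS]big_box_opp; apply: eq_bigr => k _ /=.
rewrite ek_conj opprK [RHS]conjc_mul; congr (_ * _).
rewrite /dcoef cdot_conj cdotNl !conjc_mul cs; congr (_ * _).
rewrite conjc_opp mulrN -mulNr; congr (_ * _).
by rewrite /i2pi; apply/eqP; rewrite eq_complex /= oppr0 !eqxx.
Qed.

(* Neumann iteration for (I + DU) g + mu = f with g of zero mean *)
Lemma linear_iter (s B : R) N (c : 'I_n -> 'rV[int]_n -> C)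
    (f : 'I_n -> 'rV[C]_n -> C) m :
  0 <= s -> 0 <= B -> (forall i, lip s N (c i) <= 1 / 4) ->
  (forall i, tpoly (f i)) -> (forall i z, strip s z -> nc (f i z) <= B) ->
  exists (g : 'I_n -> 'rV[C]_n -> C) (mu : 'I_n -> C),
  [/\ forall i, zmean (g i),
      forall i z, strip s z -> nc (g i z) <= 4 * B * (1 - (1 / 2) ^+ m),
      forall i, nc (mu i) <= 2 * B * (1 - (1 / 2) ^+ m),
      forall i, tpoly (fun z => f i z - mu i - g i z
                          - pev N (dcoef (\row_j g j z) (c i)) z)
    & forall i z, strip s z ->
        nc (f i z - mu i - g i z - pev N (dcoef (\row_j g j z) (c i)) z)
          <= B * (1 / 2) ^+ m].
Proof.
move=> s0 B0 hlip hf fB; elim: m => [|m [g [mu [g0 gB muB rp rB]]]].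
  exists (fun _ _ => 0), (fun=> 0).
  have e i z : f i z = f i z - 0 - 0 - pev N (dcoef (\row__ 0) (c i)) z.
    rewrite !subr0 /pev big1 ?subr0// => k _; rewrite /dcoef.
    by rewrite (_ : cdot _ _ = 0) ?mulr0 ?mul0r// /cdot big1// => j _; rewrite mxE mulr0.
  split=> [i|i z _|i|i|i z zs].
  - by exists 0%N, (fun=> 0); split=> // z; rewrite /pev big1// => k _; rewrite mul0r.
  - by rewrite nc0 expr0 subrr mulr0.
  - by rewrite nc0 expr0 subrr mulr0.
  - by apply: eq_tpoly (hf i) => z; exact: e.
  - by rewrite -e expr0 mulr1 fB.
(* The mean nu of the remainder r is added to mu and d = r - nu to g. The new remainder is -DU d;
   since |d| <= 2 q and [lip] is at most 1/4, it is at most q / 2. *)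
set r := fun i z => f i z - mu i - g i z - pev N (dcoef (\row_j g j z) (c i)) z.
have /choice[nu hnu] i : exists m', nc m' <= B * (1 / 2) ^+ m /\ zmean (fun z => r i z - m').
  by apply: tpoly_mean s0 (rp i) _ => z zs; exact: rB.
pose d i z := r i z - nu i.
pose q := B * (1 / 2) ^+ m.
have dB i z : strip s z -> nc (d i z) <= 2 * q.
  move=> zs; apply: le_trans (ncB _ _) _; have := rB i z zs; have := (hnu i).1.
  rewrite -/(r i z) -/q; lra.
have rowD z : \row_j (g j z + d j z) = \row_j g j z + \row_j d j z.
  by apply/rowP => j; rewrite !mxE.
have e i z : f i z - (mu i + nu i) - (g i z + d i z)
    - pev N (dcoef (\row_j (g j z + d j z)) (c i)) z
  = - pev N (dcoef (\row_j d j z) (c i)) z.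
  rewrite rowD pev_dcoefD /d /r; ring.
exists (fun i z => g i z + d i z), (fun i => mu i + nu i).
have eq1 : (1 / 2 : R) ^+ m.+1 = (1 / 2) ^+ m / 2 by rewrite exprS; ring.
split=> [i|i z zs|i|i|i z zs].
- exact: zmeanD (g0 i) (hnu i).2.
- apply: le_trans (ncD _ _) _; have := gB i z zs; have := dB i z zs; rewrite eq1 /q; lra.
- apply: le_trans (ncD _ _) _; have := muB i; have := (hnu i).1; rewrite eq1; lra.
- apply: (@eq_tpoly _ _ (fun z => -1 * pev N (dcoef (\row_j d j z) (c i)) z)).
    by move=> z; rewrite e mulN1r.
  by apply/tpolyZ/tpoly_dcoef => j; apply: zmean_tpoly (hnu j).2.
- rewrite e ncN; apply: le_trans (pev_dcoef (b := 2 * q) N (c i) zs _) _.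
    by move=> j; rewrite mxE dB.
  apply: le_trans (_ : 2 * q * (1 / 4) <= _); last by rewrite eq1 /q; lra.
  by rewrite ler_wpM2l// !mulr_ge0// exprn_ge0.
Qed.

Lemma half_pow_le (B e : R) : 0 < e -> exists m, B * (1 / 2) ^+ m <= e.
Proof.
move=> e0; have [B0|B0] := leP B 0.
  by exists 0%N; rewrite expr0 mulr1 (le_trans B0)// ltW.
exists (Num.truncn (B / e)).+1; rewrite div1r exprVn ler_pdivrMr ?exprn_gt0//.
rewrite -ler_pdivrMl// mulrC; apply: le_trans (ltW (truncnS_gt _)) _.
by rewrite -natrX ler_nat ltnW// ltn_expl.
Qed.

(** Here f is an arbitrary polynomial approximation of a real defect. As U is real, averaging the
    solution of [linear_iter] with its conjugate solves the equation for the symmetrized f, with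
    real mu and real g. *)
Lemma linear_solve (s B e : R) N M0 (c : 'I_n -> 'rV[int]_n -> C)
    (f : 'I_n -> 'rV[C]_n -> C) :
  0 <= s -> 0 <= B -> 0 < e -> (forall i, lip s N (c i) <= 1 / 4) ->
  (forall i, csym (c i)) -> (forall i, tpoly (f i)) ->
  (forall i z, strip s z -> nc (f i z) <= B) ->
  exists (M : nat) (g : 'I_n -> 'rV[int]_n -> C) (mu : 'I_n -> R),
  [/\ (M0 <= M)%N, forall i, csym (g i) /\ g i 0 = 0,
      forall i z, strip s z -> nc (pev M (g i) z) <= 4 * B,
      forall i, `|mu i| <= 2 * B
    & forall i z, strip s z ->
        nc ((f i z + conjc (f i (map_mx conjc z))) / 2 - (mu i)%:C%C - pev M (g i) z
            - pev N (dcoef (\row_j pev M (g j) z) (c i)) z) <= e].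
Proof.
move=> s0 B0 e0 hlip hs hf fB; have [m hm] := half_pow_le B e0.
have [g [mu [g0 gB muB _ rB]]] := linear_iter m s0 B0 hlip hf fB.
have /choice[M /choice[d hd]] : forall i, exists N c, c 0 = 0 /\ g i =1 pev N c by exact: g0.
pose K := maxn M0 (\max_i M i)%N.
have MK i : (M i <= K)%N by rewrite leq_max orbC leq_bigmax.
pose d1 i k := if (freq_norm k <= M i)%N then d i k else 0.
have d1E i z : pev K (d1 i) z = g i z.
  rewrite (hd i).2 (pev_widen (N := M i)) ?MK// => [|k].
    by apply: pev_eq => k; rewrite /d1 => ->.
  by rewrite /d1 ltnNge => /negbTE ->.
pose cj (z : 'rV[C]_n) := map_mx (@conjc R) z.
have sE i z : pev K (symc (d1 i)) z = (g i z + conjc (g i (cj z))) / 2.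
  by rewrite pev_symc !d1E.
have p1 : 0 <= (1 / 2 : R) ^+ m by rewrite exprn_ge0.
have gB' i z : strip s z -> nc (g i z) <= 4 * B.
  by move=> zs; apply: le_trans (gB i z zs) _; rewrite ler_piMr ?mulr_ge0//; lra.
have half (x y : C) (b : R) : nc x <= b -> nc y <= b -> nc ((x + y) / 2) <= b.
  move=> xb yb; rewrite ncM ComplexField.Normc.normcV.
  have -> : nc (2 : C) = 2 by rewrite -(rmorph_nat (real_complex R)) nc_real normr_nat.
  by have := ncD x y; rewrite ler_pdivrMr//; lra.
exists K, (fun i => symc (d1 i)), (fun i => complex.Re (mu i)); split=> [|i|i z zs|i|i z zs].
- exact: leq_maxl.
- split; first exact: symc_csym.
  rewrite /symc oppr0 /d1 freq_norm0 leq0n (hd i).1.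
  by rewrite rmorph0 addr0 mul0r.
- rewrite sE; apply: half; first exact: gB'.
  by rewrite nc_conj gB'//; exact: strip_conj.
- apply: le_trans (nc_Re _) _; apply: le_trans (muB i) _.
  by rewrite ler_piMr ?mulr_ge0//; lra.
- pose q i z := f i z - mu i - g i z - pev N (dcoef (\row_j g j z) (c i)) z.
  have cjK : cj (cj z) = z by apply/rowP => j; rewrite !mxE conjcK.
  suff -> : (f i z + conjc (f i (map_mx conjc z))) / 2 - (complex.Re (mu i))%:C%C
      - pev K (symc (d1 i)) z
      - pev N (dcoef (\row_j pev K (symc (d1 j)) z) (c i)) z
    = (q i z + conjc (q i (cj z))) / 2.
    apply: half; first exact: le_trans (rB i z zs) hm.
    by rewrite nc_conj; apply: le_trans (rB i _ (strip_conj zs)) hm.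
  have muE : (complex.Re (mu i))%:C%C = (mu i + conjc (mu i)) / 2 by rewrite ReJ_add.
  have DE : pev N (dcoef (\row_j pev K (symc (d1 j)) z) (c i)) z
     = (pev N (dcoef (\row_j g j z) (c i)) z
        + conjc (pev N (dcoef (\row_j g j (cj z)) (c i)) (cj z))) / 2.
    have -> : \row_j pev K (symc (d1 j)) z
       = (1 / 2) *: (\row_j g j z) + (1 / 2) *: cj (\row_j g j (cj z)).
      by apply/rowP => j; rewrite !mxE sE; field.
    have scal (a : C) h : pev N (dcoef (a *: h) (c i)) z = a * pev N (dcoef h (c i)) z.
      by rewrite -pevZ; apply: pev_eq => k _; rewrite /dcoef cdotZr; ring.
    have mid h h' : pev N (dcoef ((1 / 2) *: h + (1 / 2) *: h') (c i)) z
        = (pev N (dcoef h (c i)) z + pev N (dcoef h' (c i)) z) / 2.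
      by rewrite pev_dcoefD !scal; field.
    rewrite mid; congr ((_ + _) / _).
    rewrite -pev_dcoef_conj//.
    by have -> : map_mx (@conjc R) (cj z) = z by exact: cjK.
  by rewrite muE sE DE /q !conjc_sub; field.
Qed.

End LinearStep.

(** * The Newton step *)

Section NewtonStep.
Variables (R : realType) (n : nat).
Local Notation C := R[i].
Implicit Types (k l : 'rV[int]_n) (z w h v : 'rV[C]_n) (c d : 'rV[int]_n -> C).

(* [g] is the derivative of [f] in the direction [v] *)
Definition trig2 v N (f g : 'rV[C]_n -> C) :=
  exists c, forall z, f z = pev N c z /\ g z = pev N (dcoef v c) z.

Lemma eq_trig2 v N f g f' g' : f =1 f' -> g =1 g' -> trig2 v N f g -> trig2 v N f' g'.
Proof. by move=> ff gg [c h]; exists c => z; rewrite -ff -gg. Qed.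

Lemma trig2_pev v N c : trig2 v N (pev N c) (pev N (dcoef v c)).
Proof. by exists c. Qed.

Lemma trig2D v N f g f' g' : trig2 v N f g -> trig2 v N f' g' ->
  trig2 v N (fun z => f z + f' z) (fun z => g z + g' z).
Proof.
move=> [c h] [d h']; exists (fun k => c k + d k) => z.
rewrite pevD (h z).1 (h z).2 (h' z).1 (h' z).2; split=> //.
by rewrite -pevD; apply: pev_eq => k _; rewrite /dcoef mulrDr.
Qed.

Lemma trig2_0 v N : trig2 v N (fun=> 0) (fun=> 0).
Proof.
by exists (fun=> 0) => z; rewrite /pev !big1// => k _; rewrite /dcoef ?mulr0 mul0r.
Qed.

Lemma trig2_sum (I : Type) (s : seq I) (P : pred I) v N (f g : I -> 'rV[C]_n -> C) :
  (forall i, P i -> trig2 v N (f i) (g i)) ->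
  trig2 v N (fun z => \sum_(i <- s | P i) f i z) (fun z => \sum_(i <- s | P i) g i z).
Proof.
move=> h; elim: s => [|i s IH].
  by apply: eq_trig2 (trig2_0 v N) => z; rewrite big_nil.
have [Pi|Pi] := boolP (P i).
  by apply: eq_trig2 (trig2D (h i Pi) IH) => z; rewrite big_cons Pi.
by apply: eq_trig2 IH => z; rewrite big_cons (negbTE Pi).
Qed.

Lemma trig2_mono v N (a : C) l : (freq_norm l <= N)%N ->
  trig2 v N (fun z => a * ek l z) (fun z => i2pi R * cdot l v * a * ek l z).
Proof.
move=> lN; exists (fun k => if k == l then a else 0) => z.
rewrite pev_delta//; split=> //; rewrite -(pev_delta _ z lN).
by apply: pev_eq => k _; rewrite /dcoef; case: eqP => [->//|_]; rewrite mulr0.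
Qed.

Lemma trig2_widen v N M f g : (N <= M)%N -> trig2 v N f g -> trig2 v M f g.
Proof.
move=> NM [c h]; exists (fun k => if (freq_norm k <= N)%N then c k else 0) => z.
rewrite (h z).1 (h z).2 !(pev_widen _ NM).
- by split; apply: pev_eq => k kN; rewrite /dcoef kN.
- by move=> k; rewrite ltnNge /dcoef => /negbTE ->; rewrite ?mulr0.
- by move=> k; rewrite ltnNge /dcoef => /negbTE ->; rewrite ?mulr0.
Qed.

Lemma trig2M v N M f g f' g' : trig2 v N f g -> trig2 v M f' g' ->
  trig2 v (N + M) (fun z => f z * f' z) (fun z => g z * f' z + f z * g' z).
Proof.
move=> [c hc] [d hd].
pose T := (fun k l (z : 'rV[C]_n) => c k * d l * ek (k + l) z).
pose T' := (fun k l (z : 'rV[C]_n) => i2pi R * cdot (k + l) v * (c k * d l) * ek (k + l) z).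
apply: (@eq_trig2 _ _
  (fun z => \sum_(k <- box n N | k \in box n N) \sum_(l <- box n M | l \in box n M) T k l z)
  (fun z => \sum_(k <- box n N | k \in box n N) \sum_(l <- box n M | l \in box n M) T' k l z)).
- move=> z; rewrite (hc z).1 (hd z).1 /pev mulr_suml big_mkcond; apply: eq_big_seq => k kN.
  rewrite kN mulr_sumr big_mkcond; apply: eq_big_seq => l lM.
  by rewrite lM /T ekDl; ring.
- move=> z; rewrite (hc z).1 (hd z).1 (hc z).2 (hd z).2 /pev !mulr_suml -big_split.
  rewrite big_mkcond; apply: eq_big_seq => k kN /=.
  rewrite kN !mulr_sumr -big_split big_mkcond; apply: eq_big_seq => l lM /=.
  by rewrite lM /T' /dcoef ekDl cdotDl; ring.
apply: trig2_sum => k; rewrite mem_box => kN; apply: trig2_sum => l; rewrite mem_box => lM.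
by apply: trig2_mono; apply: leq_trans (freq_normD _ _) (leq_add _ _).
Qed.

(** Products of polynomials are known through their values only. The derivative is carried along
    with the values so that one coefficient function represents both; it is then cut at N and
    symmetrized. *)
Lemma trig2_real (om : 'rV[R]_n) N f g : trig2 (toC om) N f g ->
  (forall z, f (map_mx conjc z) = conjc (f z)) ->
  (forall z, g (map_mx conjc z) = conjc (g z)) ->
  exists c, [/\ csym c, forall k, (N < freq_norm k)%N -> c k = 0,
    f =1 pev N c & g =1 pev N (dcoef (toC om) c)].
Proof.
move=> [c0 h0] fr gr.
pose c k := if (freq_norm k <= N)%N then c0 k else 0.
have h z : f z = pev N c z /\ g z = pev N (dcoef (toC om) c) z.
  by rewrite (h0 z).1 (h0 z).2; split; apply: pev_eq => k kN; rewrite /dcoef /c kN.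
exists (symc c); split=> [|k kN|z|z]; first exact: symc_csym.
- move: kN; rewrite ltnNge => /negbTE kN.
  by rewrite /symc /c freq_normN kN conjc0 addr0 mul0r.
- by rewrite pev_symc_id ?(h z).1// -!(h _).1.
- rewrite (h z).2 -[LHS]pev_symc_id; last by rewrite -!(h _).2.
  apply: pev_eq => k _; rewrite /symc /dcoef.
  rewrite cdotNl cdot_toC conjc_mul mulrA mulrDr; congr (_ / _).
  congr (_ + _); rewrite mulrN conjc_opp conjc_mul conjc_real.
  rewrite -mulNr; congr (_ * _ * _).
  by rewrite /i2pi; apply/eqP; rewrite eq_complex /= oppr0 opprK !eqxx.
Qed.

Variable om : 'rV[R]_n.

(* Defect of the conjugacy equation for the truncations F_NF and U_N. *)
Definition err NF N (F U : 'I_n -> 'rV[int]_n -> C) (lam : 'I_n -> R) i z : C :=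
  pev NF (F i) (z + \row_j pev N (U j) z) - (lam i)%:C%C
    - pev N (dcoef (toC om) (U i)) z.

Lemma csym_dcoef c : csym c -> csym (dcoef (toC om) c).
Proof.
move=> cs k; rewrite /dcoef cdotNl cdot_toC !conjc_mul conjc_real cs.
rewrite mulrN -mulNr; congr (_ * _ * _).
by rewrite /i2pi; apply/eqP; rewrite eq_complex /= oppr0 !eqxx.
Qed.

Lemma row_conj N (U : 'I_n -> 'rV[int]_n -> C) z : (forall i, csym (U i)) ->
  \row_j pev N (U j) (map_mx conjc z) = map_mx (@conjc R) (\row_j pev N (U j) z).
Proof. by move=> hU; apply/rowP => j; rewrite !mxE pev_conj. Qed.

Lemma err_conj NF N F U lam i z : (forall i, csym (F i)) -> (forall i, csym (U i)) ->
  err NF N F U lam i (map_mx conjc z) = conjc (err NF N F U lam i z).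
Proof.
move=> hF hU; rewrite /err !conjc_sub -!pev_conj//; last exact: csym_dcoef.
by rewrite row_conj// -map_mxD conjc_real.
Qed.

Lemma err_approx (s : R) NF N F U lam i : tapprox s (err NF N F U lam i).
Proof.
have h1 : tapprox s (fun z => pev NF (F i) (z + \row_j pev N (U j) z)).
  by apply: approx_comp => j; exact: tpoly_pev.
apply: (@eq_approx _ _ _ (fun z => pev NF (F i) (z + \row_j pev N (U j) z)
   + (- (lam i)%:C%C + -1 * pev N (dcoef (toC om) (U i)) z))).
  by move=> z; rewrite /err; ring.
apply: approxD => //; apply: approx_tpoly; apply: tpolyD; first exact: tpoly_cst.
by apply: tpolyZ; exact: tpoly_pev.
Qed.

Lemma nc_i2pi_omega k : nc (i2pi R * cdot k (toC om)) = `|2 * pi * freq_dot k om|.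
Proof.
rewrite ncM nc_i2pi cdot_toC nc_real normrM; congr (_ * _).
by rewrite ger0_norm// mulr_ge0 ?pi_ge0.
Qed.

Lemma lip_le_wnorm (s : R) K c : lip s K c <= 2 * pi * (n * K)%:R * wnorm s K c.
Proof.
rewrite /lip /wnorm mulr_sumr; apply: ler_sum_box => k kK.
rewrite -mulrA mulrCA mulrC [leRHS]mulrC ler_wpM2l//.
  by rewrite mulr_ge0 ?nc_ge0 ?expR_ge0.
rewrite ler_wpM2l ?mulr_ge0 ?pi_ge0// ler_nat.
by apply: leq_trans (ell1_le k) _; rewrite leq_mul.
Qed.

Lemma lip_dcoef (s : R) K c v (b : R) : 0 <= b -> vbd b v ->
  lip s K (dcoef v c) <= 2 * pi * (n * K)%:R * b * lip s K c.
Proof.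
move=> b0 vb; rewrite /lip mulr_sumr; apply: ler_sum_box => k kK.
rewrite !mulrA !ler_wpM2r ?expR_ge0 ?pi_ge0// /dcoef ncM ler_wpM2r ?nc_ge0//.
apply: le_trans (nc_i2pi_cdot k vb) _; rewrite ler_wpM2r// ler_wpM2l ?mulr_ge0 ?pi_ge0//.
by rewrite ler_nat; apply: leq_trans (ell1_le k) _; rewrite leq_mul.
Qed.

(** Bound for the solution h of d_omega h = g truncated at K: the number of frequencies, times the
    bound [8 * eps] for g, times the bound [Gam] for the inverse divisors. *)
Definition newton_size (Gam eps : R) K : R := 8 * (K.*2.+1 ^ n)%:R * Gam * eps.

(** In order: Taylor error inside F; second-order Taylor error of d_omega U; variation of the low
    modes of the defect under h; tails beyond K (4 from the defect, 8 from g, 2 from DU applied to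
    the tail of g); errors of polynomial approximation and residue of the linear equation. *)
Definition newton_error (Om Gam d eps : R) K : R :=
  let zeta := newton_size Gam eps K in
  6 * pi * (n * K)%:R * zeta ^+ 2 + 4 * (pi * (n * K)%:R) ^+ 2 * Om * zeta ^+ 2
  + 12 * pi * (n * K)%:R * (K.*2.+1 ^ n)%:R * zeta * eps
  + 14 * eps * tail_factor n d K + 4 * eps ^+ 2.

(** Let d_omega h be the truncation of g at K and w = (I + DU) h. The new defect at z is compared
    with the old one e at z + h: F(z + U + w) equals e(z + h) + lambda + d_omega U(z + h) up to A,
    and the increment of d_omega U cancels D(d_omega U) h up to B. There remain e(z + h) - e(z), the
    residue r of the linear equation, and I + DU applied to the tail of g. One loss d of strip makes
    room for z + h, the other is spent on tails. *)
Lemma newton_step (s d eps Gam Om : R) K (F U : 'I_n -> 'rV[int]_n -> C)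
    (lam : 'I_n -> R) :
  let zeta := newton_size Gam eps K in
  0 < d -> 0 <= s - 2 * d -> 0 < eps -> 0 <= Gam ->
  (forall k, k != 0 -> (freq_norm k <= K)%N ->
     freq_dot k om != 0 /\ `|2 * pi * freq_dot k om|^-1 <= Gam) ->
  (forall i, `|om 0 i| <= Om) -> 0 <= Om ->
  (forall i, csym (F i)) -> (forall i, csym (U i)) ->
  (forall i k, (K < freq_norm k)%N -> U i k = 0) ->
  (forall i, lip s K (U i) <= 1 / 4) -> (forall i, lip (2 * s) K (F i) <= 1) ->
  (forall i z, strip s z -> nc (err K K F U lam i z) <= eps) ->
  zeta <= d -> 2 * pi * (n * K)%:R * zeta <= 1 / 4 ->
  exists (W : 'I_n -> 'rV[int]_n -> C) (mu : 'I_n -> R),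
  [/\ forall i, csym (W i) /\ (forall k, (K + K < freq_norm k)%N -> W i k = 0),
      forall i z, strip s z -> nc (pev (K + K) (W i) z) <= 2 * zeta,
      forall i, `|mu i| <= 4 * eps
    & forall i z, strip (s - 2 * d) z ->
        nc (err K (K + K) F (fun i k => U i k + W i k) (fun i => lam i + mu i) i z)
          <= newton_error Om Gam d eps K].
Proof.
move=> zeta d0 sd eps0 Gam0 hGam hOm Om0 hF hU Usupp lipU lipF herr zd zK.
have s0 : 0 <= s by lra.
have zeta0 : 0 <= zeta by rewrite !mulr_ge0// ltW.
have eps2 : 0 < eps ^+ 2 by rewrite exprn_gt0.
pose V : R := (K.*2.+1 ^ n)%:R.
(* The bound by eps keeps the approximation f of the defect below 2 eps; the bound by eps^2 makes
   its error quadratic. *)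
pose ep := Num.min eps (eps ^+ 2).
have ep0 : 0 < ep by rewrite lt_min eps0 eps2.
have ep1 : ep <= eps by rewrite ge_min lexx.
have ep2 : ep <= eps ^+ 2 by rewrite ge_min lexx orbT.
have ellK k : (freq_norm k <= K)%N -> (ell1 k)%:R <= (n * K)%:R :> R.
  by move=> kK; rewrite ler_nat; apply: leq_trans (ell1_le k) _; rewrite leq_mul.
have /choice[f hf] i : exists f : 'rV[C]_n -> C, tpoly f /\
    forall z, strip s z -> nc (err K K F U lam i z - f z) <= ep.
  by have [p p1 p2] := err_approx s K K F U lam i ep0; exists p.
have fB i z : strip s z -> nc (f i z) <= 2 * eps.
  move=> zs; rewrite (_ : f i z = err K K F U lam i z - (err K K F U lam i z - f i z)).
    by apply: le_trans (ncB _ _) _; have := herr i z zs; have := (hf i).2 z zs; lra.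
  by rewrite opprB addrC subrK.
have eps20 : 0 <= 2 * eps by rewrite mulr_ge0// ltW.
have [M [g [mu [KM hg gB muB rB]]]] :=
  linear_solve K s0 eps20 ep0 lipU hU (fun i => (hf i).1) fB.
have gB8 i z : strip s z -> nc (pev M (g i) z) <= 8 * eps.
  by move=> /(gB i) h; apply: le_trans h _; lra.
pose dn k : C := i2pi R * cdot k (toC om).
have dn0 k : k != 0 -> (freq_norm k <= K)%N -> dn k != 0 /\ nc (dn k)^-1 <= Gam.
  move=> k0 kK; have [h1 h2] := hGam k k0 kK; split.
    apply/eqP => /(congr1 (fun u : C => nc u)); rewrite nc0 /dn nc_i2pi_omega => /eqP.
    by rewrite normr_eq0 mulf_eq0 (negbTE h1) orbF gt_eqF// mulr_gt0// pi_gt0.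
  by rewrite ComplexField.Normc.normcV /dn nc_i2pi_omega.
(* At k = 0 both g_k and the divisor vanish, and the quotient is 0. *)
pose Zc i k : C := if (freq_norm k <= K)%N then g i k / dn k else 0.
have ZcB i k : (freq_norm k <= K)%N ->
    nc (Zc i k) * expR (2 * pi * s * (ell1 k)%:R) <= 8 * eps * Gam.
  move=> kK; rewrite /Zc kK; have [->|k0] := eqVneq k 0.
    by rewrite (hg i).2 mul0r nc0 mul0r !mulr_ge0// ltW.
  rewrite ncM mulrAC; apply: ler_pM; rewrite ?mulr_ge0 ?nc_ge0 ?expR_ge0//.
    by apply: coef_bound (gB8 i) _ => //; exact: leq_trans kK KM.
  exact: (dn0 k k0 kK).2.
have ZB i z : strip s z -> nc (pev K (Zc i) z) <= zeta.
  move=> zs; apply: le_trans (nc_pev _ _ zs) _.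
  apply: le_trans (ler_sum_box (ZcB i)) _.
  rewrite big_const_seq count_predT size_box iter_addr_0 -[leLHS]mulr_natr.
  by apply: eq_ler; rewrite /zeta /newton_size; ring.
have Zsym i : csym (Zc i).
  move=> k; rewrite /Zc freq_normN; case: ifP => _; last by rewrite rmorph0.
  rewrite conjc_mul (hg i).1 conjc_inv; congr (_ / _).
  rewrite /dn cdotNl cdot_toC conjc_mul conjc_real mulrN -mulNr; congr (_ * _).
  by rewrite /i2pi; apply/eqP; rewrite eq_complex /= oppr0 !eqxx.
pose h z : 'rV[C]_n := \row_j pev K (Zc j) z.
have hB z : strip s z -> vbd zeta (h z) by move=> zs j; rewrite mxE ZB.
pose Dh z : 'rV[C]_n := \row_j pev K (dcoef (toC om) (Zc j)) z.
have DhE i z : pev K (dcoef (toC om) (Zc i)) z = pev K (g i) z.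
  apply: pev_eq => k kK; rewrite /dcoef /Zc kK -/(dn k).
  have [->|k0] := eqVneq k 0; first by rewrite (hg i).2 mul0r mulr0.
  by rewrite mulrC divfK//; exact: (dn0 k k0 kK).1.
pose dj i j k : C := i2pi R * (k 0 j)%:~R * U i k.
have DUE i z v : pev K (dcoef v (U i)) z = \sum_j pev K (dj i j) z * v 0 j.
  transitivity (\sum_(j < n) pev K (fun k => v 0 j * dj i j k) z).
    rewrite -pev_sum; apply: pev_eq => k _; rewrite /dcoef /cdot mulr_sumr mulr_suml.
    by apply: eq_bigr => j _; rewrite /dj; ring.
  by apply: eq_bigr => j _; rewrite pevZ mulrC.
have DDUE i z v : pev K (dcoef v (dcoef (toC om) (U i))) z
    = \sum_j pev K (dcoef (toC om) (dj i j)) z * v 0 j.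
  transitivity (\sum_(j < n) pev K (fun k => v 0 j * dcoef (toC om) (dj i j) k) z).
    rewrite -pev_sum; apply: pev_eq => k _; rewrite /dcoef {1}/cdot mulr_sumr mulr_suml.
    by apply: eq_bigr => j _; rewrite /dj; ring.
  by apply: eq_bigr => j _; rewrite pevZ mulrC.
(* The correction w = (I + DU) h and, by the product rule, its derivative along omega; the degree
   becomes 2 K. *)
pose wf i z := pev K (Zc i) z + pev K (dcoef (h z) (U i)) z.
pose wf' i z := pev K (dcoef (toC om) (Zc i)) z
  + (pev K (dcoef (h z) (dcoef (toC om) (U i))) z + pev K (dcoef (Dh z) (U i)) z).
have wt i : trig2 (toC om) (K + K) (wf i) (wf' i).
  apply: trig2D; first by apply: trig2_widen (trig2_pev _ _ _); exact: leq_addr.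
  apply: (@eq_trig2 _ _ (fun z => \sum_j pev K (dj i j) z * pev K (Zc j) z)
   (fun z => \sum_j (pev K (dcoef (toC om) (dj i j)) z * pev K (Zc j) z
                     + pev K (dj i j) z * pev K (dcoef (toC om) (Zc j)) z))).
  - by move=> z; rewrite DUE; apply: eq_bigr => j _; rewrite mxE.
  - move=> z; rewrite DUE DDUE -big_split; apply: eq_bigr => j _.
    by rewrite !mxE.
  - by apply: trig2_sum => j _; apply: trig2M; exact: trig2_pev.
have hconj z : h (map_mx (@conjc R) z) = map_mx (@conjc R) (h z) by exact: row_conj.
have Dhconj z : Dh (map_mx (@conjc R) z) = map_mx (@conjc R) (Dh z).
  by apply: row_conj => i; exact: csym_dcoef.
have /choice[W hW] i : exists c, [/\ csym c, forall k, (K + K < freq_norm k)%N -> c k = 0,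
    wf i =1 pev (K + K) c & wf' i =1 pev (K + K) (dcoef (toC om) c)].
  apply: trig2_real => // z.
    by rewrite /wf hconj pev_dcoef_conj// pev_conj// conjc_add.
  rewrite /wf' hconj Dhconj (@pev_conj _ _ _ _ _ (csym_dcoef (Zsym i))).
  rewrite (@pev_dcoef_conj _ _ _ _ _ _ (csym_dcoef (hU i))).
  by rewrite (@pev_dcoef_conj _ _ _ _ _ _ (hU i)) !conjc_add.
have wB i z : strip s z -> nc (wf i z) <= 2 * zeta.
  move=> zs; apply: le_trans (ncD _ _) _.
  have h1 := ZB i z zs; have h2 := pev_dcoef K (U i) zs (hB z zs).
  have : zeta * lip s K (U i) <= zeta * (1 / 4) by rewrite ler_wpM2l.
  lra.
exists W, mu; split=> [i|i z zs|i|i z zs]; first by have [] := hW i.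
- by have [_ _ <- _] := hW i; exact: wB.
- by apply: le_trans (muB i) _; lra.
have zs1 : strip s z by apply: strip_le zs; lra.
have zhs : strip (s - d) (z + h z).
  by apply: (strip_le _ (stripD zs (vbd_strip (hB z zs1)))); lra.
have zhs1 : strip s (z + h z) by apply: strip_le zhs; lra.
have zs2 : strip (s - d) z by apply: strip_le zs; lra.
pose u z : 'rV[C]_n := \row_j pev K (U j) z.
have KK : (K <= K + K)%N by exact: leq_addr.
have uE z' : \row_j pev (K + K) (fun k => U j k + W j k) z' = u z' + \row_j wf j z'.
  apply/rowP => j; rewrite !mxE pevD (pev_widen _ KK (Usupp j)).
  by have [_ _ <- _] := hW j.
have DuE : pev (K + K) (dcoef (toC om) (fun k => U i k + W i k)) z
   = pev K (dcoef (toC om) (U i)) z + wf' i z.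
  have [_ _ _ ->] := hW i.
  rewrite -(pev_widen z KK) => [|k kK]; last by rewrite /dcoef Usupp// mulr0.
  by rewrite -pevD; apply: pev_eq => k _; rewrite /dcoef mulrDr.
pose e z := err K K F U lam i z.
pose t j := \sum_(k <- box n M | k \notin box n K) g j k * ek k z.
have tE j : pev M (g j) z = pev K (g j) z + t j by exact: big_box_split.
(* A measures the replacement of U + DU h by U(z + h) in the argument of F, B the linearization of
   d_omega U at z; both are quadratic in h. *)
pose A := pev K (F i) (z + (u z + \row_j wf j z))
          - pev K (F i) (z + h z + u (z + h z)).
pose B := pev K (dcoef (toC om) (U i)) (z + h z) - pev K (dcoef (toC om) (U i)) z
   - pev K (dcoef (h z) (dcoef (toC om) (U i))) z.
pose r := e z - (mu i)%:C%C - pev M (g i) z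
            - pev K (dcoef (\row_j pev M (g j) z) (U i)) z.
have -> : err K (K + K) F (fun i k => U i k + W i k) (fun i => lam i + mu i) i z
   = A + B + (e (z + h z) - e z) + r + t i + pev K (dcoef (\row_j t j) (U i)) z.
  have rowE : \row_j pev M (g j) z = Dh z + \row_j t j.
    by apply/rowP => j; rewrite !mxE tE DhE.
  rewrite /err uE DuE /A /B /r rowE pev_dcoefD tE -DhE /wf' /e /err (rmorphD (real_complex R)).
  by rewrite -/(u z) -/(u (z + h z)) /=; ring.
have nK0 : 0 <= pi * (n * K)%:R :> R by rewrite mulr_ge0 ?pi_ge0.
have lz k : (freq_norm k <= K)%N -> 2 * pi * (ell1 k)%:R * zeta <= 1 / 2.
  move=> kK; apply: le_trans (_ : 2 * pi * (n * K)%:R * zeta <= _); last by lra.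
  by rewrite ler_wpM2r// ler_wpM2l ?mulr_ge0 ?pi_ge0 ?ellK.
have tay j : nc (pev K (U j) (z + h z) - pev K (U j) z - pev K (dcoef (h z) (U j)) z)
    <= 2 * pi * (n * K)%:R * zeta ^+ 2.
  apply: le_trans (pev_taylor2 (U j) zeta0 zs1 (hB z zs1) lz) _.
  apply: le_trans (ler_wpM2l _ (lipU j)) _; last by apply: eq_ler; field.
  by rewrite -!mulrA mulr_ge0// mulr_ge0 ?pi_ge0// mulr_ge0// sqr_ge0.
have hA : nc A <= 6 * pi * (n * K)%:R * zeta ^+ 2.
  pose dl := z + (u z + \row_j wf j z) - (z + h z + u (z + h z)).
  have dlB : vbd (2 * pi * (n * K)%:R * zeta ^+ 2) dl.
    move=> j; have -> : dl 0 j = - (pev K (U j) (z + h z) - pev K (U j) z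
        - pev K (dcoef (h z) (U j)) z).
      by rewrite !mxE /wf; ring.
    by rewrite ncN.
  have b0 : 0 <= 2 * pi * (n * K)%:R * zeta ^+ 2.
    by rewrite mulr_ge0 ?sqr_ge0// -mulrA mulr_ge0.
  have bz : 2 * pi * (n * K)%:R * zeta ^+ 2 <= zeta.
    rewrite expr2 mulrA -[leRHS]mul1r ler_wpM2r//; lra.
  have st2 : strip (2 * s) (z + h z + u (z + h z)).
    have -> : 2 * s = s + s by ring.
    apply: stripD => // j; rewrite mxE; apply: le_trans (pev_Im K s0 (hU j) zhs1) _.
    by rewrite -[leRHS]mulr1 ler_wpM2l//; apply: le_trans (lipU j) _; lra.
  have lb k : (freq_norm k <= K)%N ->
      2 * pi * (ell1 k)%:R * (2 * pi * (n * K)%:R * zeta ^+ 2) <= 1 / 2.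
    move=> kK; apply: le_trans (lz k kK).
    by rewrite ler_wpM2l ?mulr_ge0 ?pi_ge0.
  have := pev_taylor1 (F i) b0 st2 dlB lb.
  have -> : z + h z + u (z + h z) + dl = z + (u z + \row_j wf j z).
    by rewrite /dl addrC subrK.
  rewrite -/A => h5; apply: le_trans h5 _.
  apply: le_trans (ler_wpM2l _ (lipF i)) _; first by rewrite mulr_ge0.
  by apply: eq_ler; ring.
have omB : vbd Om (toC om) by move=> j; rewrite mxE nc_real.
have hBB : nc B <= 4 * (pi * (n * K)%:R) ^+ 2 * Om * zeta ^+ 2.
  apply: le_trans (pev_taylor2 _ zeta0 zs1 (hB z zs1) lz) _.
  apply: le_trans (ler_wpM2l _ (lip_dcoef s K (U i) Om0 omB)) _.
    by rewrite -!mulrA mulr_ge0// mulr_ge0 ?pi_ge0// mulr_ge0// sqr_ge0.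
  apply: le_trans (_ : 8 * pi * (n * K)%:R * zeta ^+ 2 * (2 * pi * (n * K)%:R * Om * (1 / 4)) <= _).
    rewrite ler_wpM2l//.
      by rewrite -!mulrA mulr_ge0// mulr_ge0 ?pi_ge0// mulr_ge0// sqr_ge0.
    by rewrite ler_wpM2l// -2!mulrA !mulr_ge0 ?pi_ge0.
  by apply: eq_ler; field.
pose T := tail_factor n d K.
have sdd : s - d + d = s by ring.
have sd0 : 0 <= s - d by lra.
(* The defect has modes beyond K, for which k.h is not controlled. Its polynomial approximation is
   cut at K: Taylor below, decay of the tails above. *)
have hE : nc (e (z + h z) - e z)
   <= 12 * pi * (n * K)%:R * V * zeta * eps + 4 * eps * T + 2 * eps ^+ 2.
  have [N [c hc]] := (hf i).1.
  have [N' [KN [c' hc']]] : exists N', (K <= N')%N /\ trig N' (f i).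
    exists (maxn K N); split; first exact: leq_maxl.
    by apply: trig_widen (leq_maxr K N) _; exists c.
  have lowE y : f i y = pev K c' y + \sum_(k <- box n N' | k \notin box n K) c' k * ek k y.
    by rewrite hc'; exact: big_box_split.
  have fB' y : strip (s - d + d) y -> nc (pev N' c' y) <= 2 * eps.
    by rewrite sdd -hc'; exact: fB.
  have t1 := tail_bound K d0 sd0 fB' zhs; have t2 := tail_bound K d0 sd0 fB' zs2.
  have fB'' y : strip s y -> nc (pev N' c' y) <= 2 * eps by rewrite -hc'; exact: fB.
  have lw := wnorm_le s0 fB'' KN.
  have l1 : nc (pev K c' (z + h z) - pev K c' z) <= 12 * pi * (n * K)%:R * V * zeta * eps.
    apply: le_trans (pev_taylor1 c' zeta0 zs1 (hB z zs1) lz) _.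
    apply: le_trans (_ : 3 * zeta * (2 * pi * (n * K)%:R * (V * (2 * eps))) <= _).
      apply: ler_wpM2l; first by rewrite mulr_ge0.
      apply: le_trans (lip_le_wnorm s K c') _.
      by rewrite ler_wpM2l// -mulrA mulr_ge0.
    by apply: eq_ler; ring.
  have -> : e (z + h z) - e z = (e (z + h z) - f i (z + h z)) - (e z - f i z)
     + (pev K c' (z + h z) - pev K c' z)
     + (\sum_(k <- box n N' | k \notin box n K) c' k * ek k (z + h z)
        - \sum_(k <- box n N' | k \notin box n K) c' k * ek k z).
    by rewrite !lowE; ring.
  have e1 := (hf i).2 _ zhs1; have e2 := (hf i).2 _ zs1.
  apply: le_trans (ncD _ _) _; apply: le_trans (lerD (ncD _ _) (ncB _ _)) _.
  have := ncB (e (z + h z) - f i (z + h z)) (e z - f i z).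
  move: l1 t1 t2 e1 e2; rewrite -/T -/(e z) -/(e (z + h z)); lra.
have hr : nc r <= 2 * eps ^+ 2.
  have := rB i z zs1.
  set q := (f i z + conjc (f i (map_mx conjc z))) / 2.
  have -> : r = (e z - q) + (q - (mu i)%:C%C - pev M (g i) z
            - pev K (dcoef (\row_j pev M (g j) z) (U i)) z) by rewrite /r; ring.
  move=> h1; apply: le_trans (ncD _ _) _.
  suff h2 : nc (e z - q) <= ep by lra.
  have -> : e z - q = ((e z - f i z) + conjc (e (map_mx conjc z) - f i (map_mx conjc z))) / 2.
    have ec : e (map_mx conjc z) = conjc (e z) by exact: err_conj.
    by rewrite ec conjc_sub conjcK /q; field.
  rewrite ncM ComplexField.Normc.normcV.
  have -> : nc (2 : C) = 2 by rewrite -(rmorph_nat (real_complex R)) nc_real normr_nat.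
  rewrite ler_pdivrMr//; apply: le_trans (ncD _ _) _; rewrite nc_conj.
  by have := (hf i).2 _ zs1; have := (hf i).2 _ (strip_conj zs1); rewrite -/(e _) -/(e _); lra.
have ht j : nc (t j) <= 8 * eps * T.
  by apply: tail_bound d0 sd0 _ zs2 => y; rewrite sdd; exact: gB8.
have T0 : 0 <= 8 * eps * T := le_trans (nc_ge0 _) (ht i).
have htD : nc (pev K (dcoef (\row_j t j) (U i)) z) <= 2 * eps * T.
  apply: le_trans (pev_dcoef (b := 8 * eps * T) K (U i) zs1 _) _.
    by move=> j; rewrite mxE.
  by apply: le_trans (ler_wpM2l T0 (lipU i)) _; lra.
have n1 := ncD (A + B + (e (z + h z) - e z) + r + t i) (pev K (dcoef (\row_j t j) (U i)) z).
have n2 := ncD (A + B + (e (z + h z) - e z) + r) (t i).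
have n3 := ncD (A + B + (e (z + h z) - e z)) r.
have n4 := ncD (A + B) (e (z + h z) - e z).
have n5 := ncD A B.
rewrite /newton_error -/zeta -/T -/V; have := ht i; lra.
Qed.

End NewtonStep.

Ltac nlia := clear; lia.
Ltac clra := clear; lra.

(** * The iteration *)

Section Numeric.
Variable R : realType.

(** Monotonicity of t^a / t, without quotients. It compares a strip of width rho K^a / K with the
    weight exp(rho |k|^a) for all |k| <= K. *)
Lemma powR_ratio (a x y : R) : 0 < a < 1 -> 0 <= x -> x <= y ->
  y `^ a * x <= x `^ a * y.
Proof.
move=> /andP[a0 a1]; rewrite le_eqVlt => /predU1P[<- y0|x0 xy].
  by rewrite mulr0 mulr_ge0 ?powR_ge0.
have yx : 1 <= y / x by rewrite ler_pdivlMr// mul1r.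
have -> : y = x * (y / x) by rewrite mulrCA divff ?mulr1// gt_eqF.
rewrite powRM ?(ltW x0)//; last by apply: le_trans yx.
have h := ler1_powR yx (ltW a1).
by rewrite -mulrA ler_wpM2l ?powR_ge0// mulrC ler_wpM2l// ltW.
Qed.

(** One term of the exponential series is kept, of index m + 1 with a (m + 1) >= N + 1; the extra
    power of K absorbs the constants, among them 5^N from 4 K + 1 <= 5 K. *)
Lemma exp_dominates (a A : R) N : 0 < a -> exists2 Q : nat, (0 < Q)%N &
  forall K : nat, (Q <= K)%N -> A * (4 * K + 1)%N%:R ^+ N <= expR (K%:R `^ a).
Proof.
move=> a0; wlog A0 : A / 0 <= A => [H|].
  have [Q Q0 hQ] := H `|A| (normr_ge0 _); exists Q => // K /hQ; apply: le_trans.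
  by rewrite ler_wpM2r ?exprn_ge0// ler_norm.
pose m := Num.truncn ((N.+1)%:R / a).
have am : N.+1%:R <= a * m.+1%:R.
  by rewrite mulrC -ler_pdivrMr// ltW// truncnS_gt.
pose B := A * 5 ^+ N * (m.+1)`!%:R; pose Q := (Num.truncn B).+1.
exists Q => // K QK.
have K1 : 1 <= K%:R :> R by rewrite ler1n; apply: leq_trans QK.
have BK : B <= K%:R.
  by apply: le_trans (ltW (truncnS_gt B)) _; rewrite ler_nat.
have f0 : 0 < (m.+1)`!%:R :> R by rewrite ltr0n fact_gt0.
have := @expR_ge1Dxn R (K%:R `^ a) m (powR_ge0 _ _).
suff h : A * (4 * K + 1)%N%:R ^+ N <= (K%:R `^ a) ^+ m.+1 / (m.+1)`!%:R.
  by move=> h1; apply: le_trans h _; lra.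
have -> : (K%:R `^ a) ^+ m.+1 = K%:R `^ (a * m.+1%:R).
  by rewrite powRrM powR_mulrn// powR_ge0.
rewrite ler_pdivlMr//; apply: le_trans (_ : K%:R `^ N.+1%:R <= _); last exact: ler_powR.
rewrite powR_mulrn// exprSr.
apply: le_trans (_ : B * K%:R ^+ N <= _); last by rewrite mulrC ler_wpM2l ?exprn_ge0.
have -> : B * K%:R ^+ N = A * (5 ^+ N * K%:R ^+ N) * (m.+1)`!%:R by rewrite /B; ring.
apply: ler_wpM2r; first exact: ltW.
apply: ler_wpM2l => //.
rewrite -exprMn lerXn2r ?nnegrE ?mulr_ge0//.
by rewrite natrD natrM; lra.
Qed.

(** Here q stands for K^a, b for 2^a, g and w for [gap] and [width]. As (1 - 2 g)(1 + g) <= 1 - g,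
    doubling K while raising rho by a factor at most 1 + g loses at least the fraction g of the
    strip, and g w = 2 makes d K at least rho q. The same inequality, doubled, is the last
    conclusion. *)
Lemma width_facts (g w rho rho' q Kr b s s' d : R) :
  g * w = 2 -> b = 2 - 4 * g -> 0 < g -> g < 1 / 4 -> 1 <= g * rho ->
  rho <= rho' -> rho' <= (1 + g) * rho -> 1 <= q -> 1 <= Kr ->
  s = w * rho * q / Kr -> s' = w * rho' * (b * q) / (2 * Kr) -> d = (s - s') / 2 ->
  [/\ 4 <= rho, rho * q <= d * Kr, 0 <= s', s' <= s
    & b * rho' <= (2 - 2 * g) * rho].
Proof.
move=> gw bE g0 g4 gr rr' r'r q1 K1 sE s'E dE.
have r0 : 0 < rho by rewrite -(pmulr_rgt0 _ g0); apply: lt_le_trans gr.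
have gr4 : g * rho <= 1 / 4 * rho by rewrite ler_wpM2r// ltW.
have r4 : 4 <= rho by move: gr gr4; clra.
have w0 : 0 < w by rewrite -(pmulr_rgt0 _ g0) gw.
have q0 : 0 < q by apply: lt_le_trans q1.
have K0 : 0 < Kr by apply: lt_le_trans K1.
have b0 : 0 < b by rewrite bE; move: g4; clra.
have g2 : 0 <= g ^+ 2 * rho by rewrite mulr_ge0 ?sqr_ge0// ltW.
have s'0 : 0 <= s'.
  by rewrite s'E divr_ge0 ?mulr_ge0 ?(ltW w0) ?(ltW b0) ?(ltW q0) ?(ltW K0)//;
    apply: le_trans (ltW r0) _.
have dK : rho * q <= d * Kr.
  have -> : d * Kr = (w * q) * (rho - rho' * (1 - 2 * g)) / 2.
    by rewrite dE sE s'E bE; field; rewrite gt_eqF.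
  rewrite ler_pdivlMr//; apply: le_trans (_ : w * q * (g * rho) <= _).
    have -> : w * q * (g * rho) = (g * w) * (rho * q) by ring.
    by rewrite gw mulrC.
  rewrite ler_wpM2l ?mulr_ge0 ?(ltW w0) ?(ltW q0)//.
  have : rho' * (1 - 2 * g) <= (1 + g) * rho * (1 - 2 * g).
    by rewrite ler_wpM2r//; move: g4; clra.
  have -> : (1 + g) * rho * (1 - 2 * g) = rho - g * rho - 2 * (g ^+ 2 * rho) by ring.
  by move: g2; clra.
have d0 : 0 <= d.
  by rewrite -(pmulr_lge0 _ K0); apply: le_trans dK; rewrite mulr_ge0 ?ltW.
split=> //; first by move: d0; rewrite dE; clra.
have h1 : b * rho' <= b * ((1 + g) * rho) by rewrite ler_wpM2l// ltW.
have h2 : b * ((1 + g) * rho) = (2 - 2 * g) * rho - 4 * (g ^+ 2 * rho) by rewrite bE; ring.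
by move: h1 g2; rewrite h2; clra.
Qed.

(** Collects the quadratic part of [newton_error], with pn = pi n, Kr = K, V = (2 K + 1)^n, L = 4 K
    + 1 and G the cost of the small divisors. Each term is at most a constant times V^2 K^2 (G
    eps)^2 or (G eps)^2. *)
Lemma quad_bound (pn Om Cw L V Kr G eps zeta : R) m :
  0 <= pn -> 0 <= Om -> 0 <= Cw -> 1 <= L -> 1 <= Kr -> Kr <= L -> 0 <= V ->
  V <= L ^+ m -> 1 <= G -> 0 <= eps -> zeta = 8 * Cw * V * (G * eps) ->
  6 * (pn * Kr) * zeta ^+ 2 + 4 * (pn * Kr) ^+ 2 * Om * zeta ^+ 2
  + 12 * (pn * Kr) * V * zeta * eps + 4 * eps ^+ 2
  <= (384 * pn * Cw ^+ 2 + 256 * pn ^+ 2 * Om * Cw ^+ 2 + 96 * pn * Cw + 4)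
     * L ^+ (2 * m + 2) * (G * eps) ^+ 2.
Proof.
move=> pn0 Om0 Cw0 L1 K1 KL V0 VL G1 eps0 zE.
have L0 : 0 <= L by apply: le_trans L1.
have K0 : 0 <= Kr by apply: le_trans K1.
have G0 : 0 <= G by apply: le_trans G1.
pose Z := (G * eps) ^+ 2; have Z0 : 0 <= Z by exact: sqr_ge0.
pose L2 := L ^+ (2 * m + 2).
have V2 : V ^+ 2 * Kr ^+ 2 <= L2.
  rewrite /L2 exprD mulnC exprM; apply: ler_pM; rewrite ?exprn_ge0//.
    by rewrite lerXn2r ?nnegrE ?exprn_ge0.
  by rewrite lerXn2r ?nnegrE.
have V2' : V ^+ 2 * Kr <= L2.
  by apply: le_trans V2; rewrite ler_wpM2l ?sqr_ge0// ler_eXnr.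
have L21 : 1 <= L2 by rewrite exprn_ege1.
have eZ : eps ^+ 2 <= Z.
  by rewrite /Z exprMn -[leLHS]mul1r ler_wpM2r ?sqr_ge0// exprn_ege1.
have GZ : G * eps ^+ 2 <= Z.
  by rewrite /Z exprMn ler_wpM2r ?sqr_ge0// ler_eXnr.
pose A1 := 384 * pn * Cw ^+ 2; pose A2 := 256 * pn ^+ 2 * Om * Cw ^+ 2.
pose A3 := 96 * pn * Cw.
have A10 : 0 <= A1 := mulr_ge0 (mulr_ge0 (ler0n _ _) pn0) (sqr_ge0 _).
have A20 : 0 <= A2 := mulr_ge0 (mulr_ge0 (mulr_ge0 (ler0n _ _) (sqr_ge0 _)) Om0) (sqr_ge0 _).
have A30 : 0 <= A3 := mulr_ge0 (mulr_ge0 (ler0n _ _) pn0) Cw0.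
have -> : 6 * (pn * Kr) * zeta ^+ 2 + 4 * (pn * Kr) ^+ 2 * Om * zeta ^+ 2
      + 12 * (pn * Kr) * V * zeta * eps + 4 * eps ^+ 2
    = A1 * ((V ^+ 2 * Kr) * Z) + A2 * ((V ^+ 2 * Kr ^+ 2) * Z)
      + A3 * ((V ^+ 2 * Kr) * (G * eps ^+ 2)) + 4 * eps ^+ 2.
  by rewrite zE /A1 /A2 /A3 /Z; ring.
have -> : (A1 + A2 + A3 + 4) * L2 * Z
    = A1 * (L2 * Z) + A2 * (L2 * Z) + A3 * (L2 * Z) + 4 * (L2 * Z) by ring.
apply: lerD; last by rewrite ler_wpM2l//; apply: le_trans eZ _; rewrite ler_peMl.
apply: lerD.
  by apply: lerD; rewrite ler_wpM2l// ler_wpM2r.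
rewrite ler_wpM2l//; apply: ler_pM => //.
  by rewrite mulr_ge0 ?sqr_ge0.
by rewrite mulr_ge0 ?sqr_ge0.
Qed.

(** From pi >= 2 the exponent pi d K is at least 2 rq, and d K >= 1 gives 2 / (pi d) <= K. *)
Lemma tail_factor_le n (d L rq : R) K :
  0 < d -> 1 <= d * K%:R -> 2 * rq <= 2 * (d * K%:R) -> 0 <= L -> K%:R + 1 <= L ->
  tail_factor n d K <= expR (- (2 * rq)) * L ^+ n.
Proof.
move=> d0 dK1 dK L0 KL; have pi2 := @pi_ge2 R; have pi0 := @pi_ge0 R.
have pd0 : 0 < pi * d by rewrite mulr_gt0 ?pi_gt0.
have dK0 : 0 <= d * K%:R by rewrite mulr_ge0 ?ler0n ?(ltW d0).
apply: ler_pM; rewrite ?expR_ge0 ?exprn_ge0 ?addr_ge0 ?divr_ge0 ?(ltW pd0)//.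
  rewrite ler_expR lerN2 -mulrA; apply: le_trans dK _.
  by rewrite ler_wpM2r.
have h : 2 / (pi * d) <= K%:R.
  rewrite ler_pdivrMr// mulrCA -[leLHS]mulr1; apply: ler_pM => //.
  by rewrite mulrC.
have h2 : 1 + 2 / (pi * d) <= L by apply: le_trans KL; rewrite addrC lerD2r.
by rewrite lerXn2r ?nnegrE ?addr_ge0 ?divr_ge0 ?(ltW pd0).
Qed.

Lemma zeta_le (x Cw V L GE Y E : R) m p :
  0 <= x -> 0 <= Cw -> 0 <= L -> 0 <= V -> V <= L ^+ m -> 0 <= Y -> 0 < E ->
  GE = Y / E -> x * (8 * Cw) * L ^+ (m + p) <= E -> x * L ^+ p * (8 * Cw * V * GE) <= Y.
Proof.
move=> x0 Cw0 L0 V0 VL Y0 E0 -> xE.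
have -> : x * L ^+ p * (8 * Cw * V * (Y / E)) = ((x * (8 * Cw)) * (V * L ^+ p)) * Y / E.
  by ring.
rewrite ler_pdivrMr// mulrC ler_wpM2l//; apply: le_trans xE.
by rewrite ler_wpM2l ?mulr_ge0// exprD ler_wpM2r ?exprn_ge0.
Qed.

(** All summands of [kc] are nonnegative; each inequality keeps one of them and lowers the power of
    L. Here ki is 1 / kappa. *)
Lemma consts_le (p Om Cw ki kc L E : R) n :
  0 <= p -> 0 <= Om -> 0 <= Cw -> 0 <= ki -> 1 <= L ->
  kc = 4 * (384 * p * Cw ^+ 2 + 256 * p ^+ 2 * Om * Cw ^+ 2 + 96 * p * Cw + 4)
    + 56 + 16 * p + 8 * Cw + 64 * p * Cw + (16 * Cw + 64 * p * Cw + 4) * ki ->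
  kc * L ^+ (2 * n + 4) <= E ->
  [/\ (384 * p * Cw ^+ 2 + 256 * p ^+ 2 * Om * Cw ^+ 2 + 96 * p * Cw + 4)
        * L ^+ (2 * n + 2) * 4 <= E,
      56 * L ^+ n <= E, 16 * p * L ^+ (n + 2) <= E,
      1 * (8 * Cw) * L ^+ (n + 1) <= E & 8 * p * (8 * Cw) * L ^+ (n + 1) <= E] /\
  [/\ 2 * ki * (8 * Cw) * L ^+ (n + (n + 4)) <= E,
      8 * p * ki * (8 * Cw) * L ^+ (n + (n + 2)) <= E
    & 4 * ki * L <= E].
Proof.
move=> p0 Om0 Cw0 ki0 L1 kcE hA.
have L0 : 0 <= L by apply: le_trans L1.
have AL (x y : R) m : 0 <= x -> 0 <= y -> kc = x + y -> (m <= 2 * n + 4)%N ->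
    x * L ^+ m <= E.
  move=> x0 y0 xA mN; apply: le_trans hA; apply: ler_pM; rewrite ?exprn_ge0//.
    by rewrite xA lerDl.
  by rewrite ler_weXn2l.
have [S1 S1E] : exists S1, S1 = 384 * p * Cw ^+ 2 + 256 * p ^+ 2 * Om * Cw ^+ 2
  + 96 * p * Cw + 4 by eexists.
have S10 : 0 <= S1.
  rewrite S1E; apply: addr_ge0 (ler0n _ _).
  apply: addr_ge0; last exact: mulr_ge0 (mulr_ge0 (ler0n _ _) p0) Cw0.
  apply: addr_ge0; first exact: mulr_ge0 (mulr_ge0 (ler0n _ _) p0) (sqr_ge0 _).
  exact: mulr_ge0 (mulr_ge0 (mulr_ge0 (ler0n _ _) (sqr_ge0 _)) Om0) (sqr_ge0 _).
rewrite -S1E in kcE *; clear S1E.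
have pC : 0 <= p * Cw by rewrite mulr_ge0.
have ck : 0 <= Cw * ki by rewrite mulr_ge0.
have pck : 0 <= p * Cw * ki by rewrite mulr_ge0.
have {}kcE : kc = 4 * S1 + 56 + 16 * p + 8 * Cw + 64 * (p * Cw)
    + (16 * (Cw * ki) + 64 * (p * Cw * ki) + 4 * ki).
  by rewrite kcE; ring.
split; split.
- rewrite mulrAC [S1 * 4]mulrC.
  by apply: (AL _ (kc - 4 * S1)); [lra|rewrite kcE; lra|lra|nlia].
- by apply: (AL _ (kc - 56)); [lra|rewrite kcE; lra|lra|nlia].
- by apply: (AL _ (kc - 16 * p)); [lra|rewrite kcE; lra|lra|nlia].
- by apply: (AL _ (kc - 8 * Cw)); [lra|rewrite kcE; lra|lra|nlia].
- by apply: (AL _ (kc - 64 * (p * Cw))); [lra|rewrite kcE; lra|lra|nlia].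
- by apply: (AL _ (kc - 16 * (Cw * ki))); [lra|rewrite kcE; lra|lra|nlia].
- by apply: (AL _ (kc - 64 * (p * Cw * ki))); [lra|rewrite kcE; lra|lra|nlia].
- by rewrite -[L]expr1; apply: (AL _ (kc - 4 * ki)); [lra|rewrite kcE; lra|lra|nlia].
Qed.

End Numeric.

(** * One step of the iteration, from degree K to 2 K *)

Section KamStep.
Variables (R : realType) (n : nat).
Local Notation C := R[i].
Implicit Types (k l : 'rV[int]_n) (z w h v : 'rV[C]_n) (c d : 'rV[int]_n -> C).

(** Weight of the frequencies that enter when the truncation of F passes from K to 2 K. *)
Definition blk (t : R) K c : R :=
  \sum_(k <- box n (K + K) | k \notin box n K) nc (c k) * expR (2 * pi * t * (ell1 k)%:R).

Lemma lip_blk (t : R) K c :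
  lip t (K + K) c <= lip t K c + 4 * pi * (n * K)%:R * blk t K c.
Proof.
rewrite /lip (big_box_split _ (leq_addr K K)) lerD2l /blk mulr_sumr.
rewrite [leLHS]big_mkcond [leRHS]big_mkcond; apply: ler_sum_box => k kK; case: ifP => // _.
have -> : nc (c k) * (2 * pi * (ell1 k)%:R) * expR (2 * pi * t * (ell1 k)%:R)
  = 2 * pi * (ell1 k)%:R * (nc (c k) * expR (2 * pi * t * (ell1 k)%:R)) by ring.
rewrite ler_wpM2r ?mulr_ge0 ?nc_ge0 ?expR_ge0//.
have : (ell1 k)%:R <= (n * (K + K))%:R :> R.
  by rewrite ler_nat; apply: leq_trans (ell1_le k) _; rewrite leq_mul.
rewrite mulnDr natrD => h.
by have := ler_wpM2l (mulr_ge0 (ler0n R 2) (pi_ge0 R)) h; lra.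
Qed.

Variables (a tau Om Cw kappa : R) (om : 'rV[R]_n).
Hypotheses (a01 : 0 < a < 1) (tau0 : 0 < tau) (Om0 : 0 <= Om) (Cw0 : 0 <= Cw).
Hypothesis kappa01 : 0 < kappa < 1 / 2.
Hypothesis omOm : forall i, `|om 0 i| <= Om.
Hypothesis omd : forall k, k != 0 -> freq_dot k om != 0 /\
  `|2 * pi * freq_dot k om|^-1 <= Cw * expR (tau / a * (freq_norm k)%:R `^ a).

Ltac clra ::= clear - R n a tau Om Cw kappa om a01 tau0 Om0 Cw0 kappa01 omOm omd; lra.

Let b : R := 2 `^ a.
(* Doubling the degree multiplies K^a by 2^a = 2 - 4 gap, a Newton step doubles the exponent
   rho K^a; [width] makes the loss of strip at each step, times K, exceed rho K^a. *)
Definition gap : R := (2 - 2 `^ a) / 4.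
Definition width : R := 2 / gap.

Lemma powR2_bounds : 1 < b < 2.
Proof.
move/andP: a01 => [a0 a1].
have l2 : 0 < ln 2 :> R by rewrite ln_gt0// ltr1n.
have bE : b = expR (a * ln 2) by rewrite /b /powR pnatr_eq0.
rewrite bE; apply/andP; split; first by rewrite expR_gt1 mulr_gt0.
by rewrite -[ltRHS]lnK ?posrE// ltr_expR gtr_pMl.
Qed.

Lemma gap_gt0 : 0 < gap.
Proof. by have /andP[_ h] := powR2_bounds; rewrite /gap -/b; lra. Qed.

Lemma gap_lt : gap < 1 / 4.
Proof. by have /andP[h _] := powR2_bounds; rewrite /gap -/b; lra. Qed.

Lemma width_gt0 : 0 < width. Proof. by rewrite divr_gt0// gap_gt0. Qed.

Definition strip_w K (rho : R) : R := width * rho * K%:R `^ a / K%:R.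
Definition eps_of K (rho : R) : R := expR (- (rho * K%:R `^ a)).
(* Decay rate, per unit of rho, for which F stays small on twice the strip. *)
Definition fdecay : R := 4 * pi * n%:R * width + 4.

(* Sum of the constants of the terms of [newton_error] and of the bounds on the corrections. *)
Definition kam_const : R :=
  4 * (384 * pi * n%:R * Cw ^+ 2 + 256 * (pi * n%:R) ^+ 2 * Om * Cw ^+ 2
       + 96 * pi * n%:R * Cw + 4)
  + 56 + 16 * pi * n%:R + 8 * Cw + 64 * pi * n%:R * Cw
  + (16 * Cw + 64 * pi * n%:R * Cw + 4) / kappa.

(** F is controlled on twice the strip because z + U(z) lies there. The bounds lU and lF are
    parameters: each step raises them by a summable amount. *)
Definition kam_inv K (rho lU lF : R) (F U : 'I_n -> 'rV[int]_n -> C)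
    (lam : 'I_n -> R) :=
  [/\ forall i, csym (U i), forall i k, (K < freq_norm k)%N -> U i k = 0,
      forall i, lip (strip_w K rho) K (U i) <= lU,
      forall i, lip (2 * strip_w K rho) K (F i) <= lF
    & forall i z, strip (strip_w K rho) z ->
        nc (err om K K F U lam i z) <= eps_of K rho].

(** K^a / K <= |k|^a / |k| for |k| <= K, so the growth of the exponentials on the doubled strip is a
    multiple of rho |k|^a in the exponent. *)
Lemma strip_ell1 K (rho : R) k : (0 < K)%N -> 0 <= rho -> (freq_norm k <= K)%N ->
  2 * pi * (2 * strip_w K rho) * (ell1 k)%:R
    <= 4 * pi * n%:R * width * rho * (freq_norm k)%:R `^ a.
Proof.
move=> K0 r0 kK; have Rh0 := ltW width_gt0; have pi0 := @pi_ge0 R.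
have [x xE] : exists x : R, x = (freq_norm k)%:R `^ a by eexists.
have h1 : (ell1 k)%:R <= n%:R * (freq_norm k)%:R :> R.
  by rewrite -natrM ler_nat ell1_le.
have h2 : strip_w K rho * (freq_norm k)%:R <= width * rho * x.
  rewrite /strip_w mulrAC ler_pdivrMr ?ltr0n//.
  have kK' : (freq_norm k)%:R <= K%:R :> R by rewrite ler_nat.
  have := ler_wpM2l (mulr_ge0 Rh0 r0) (powR_ratio a01 (ler0n R _) kK').
  by rewrite -xE !mulrA.
have s0 : 0 <= strip_w K rho.
  apply: divr_ge0 (ler0n _ _); apply: mulr_ge0 (powR_ge0 _ _); exact: mulr_ge0.
rewrite -xE; apply: le_trans (_ : 4 * pi * strip_w K rho * (n%:R * (freq_norm k)%:R) <= _).
  rewrite (_ : 2 * pi * (2 * strip_w K rho) = 4 * pi * strip_w K rho); last by ring.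
  by apply: ler_wpM2l => //; apply: mulr_ge0 s0; exact: mulr_ge0 (ler0n _ _) pi0.
have -> : 4 * pi * strip_w K rho * (n%:R * (freq_norm k)%:R)
   = 4 * (pi * n%:R) * (strip_w K rho * (freq_norm k)%:R) by ring.
have -> : 4 * pi * n%:R * width * rho * x = 4 * (pi * n%:R) * (width * rho * x) by ring.
apply: ler_wpM2l => //; exact: mulr_ge0 (ler0n _ _) (mulr_ge0 pi0 (ler0n _ _)).
Qed.

(** The first summand of [fdecay] cancels the growth on the doubled strip. Of the remaining exp(-4
    rho' |k|^a), where |k| > K, the exponent 2 rho K^a is kept and the rest pays for two factors
    exp(K^a). *)
Lemma blk_le K (rho rho' s' : R) c :
  (0 < K)%N -> 4 <= rho -> rho <= rho' -> s' = strip_w (K + K) rho' ->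
  (forall k, nc (c k) <=
     expR (K%:R `^ a) * expR (- (fdecay * rho' * (freq_norm k)%:R `^ a))) ->
  blk (2 * s') K c
    <= (4 * K + 1)%N%:R ^+ n * (expR (- (2 * (rho * K%:R `^ a))) / expR (K%:R `^ a)).
Proof.
move=> K0 r4 rr' s'E hdec; move/andP: (a01) => [a0 a1].
have Rh0 := ltW width_gt0; have pi0 := @pi_ge0 R.
have r'0 : 0 <= rho' by apply: le_trans rr'; apply: le_trans r4.
have LKK : size (box n (K + K)) = ((4 * K + 1) ^ n)%N.
  by rewrite size_box; congr (_ ^ _)%N; clear; lia.
apply: le_trans (_ : \sum_(k <- box n (K + K))
   (expR (- (2 * (rho * K%:R `^ a))) / expR (K%:R `^ a)) <= _); last first.
  by rewrite big_const_seq count_predT LKK iter_addr_0 -[leLHS]mulr_natl natrX.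
rewrite /blk big_mkcond; apply: ler_sum_box => k kKK.
case: ifPn; last by rewrite divr_ge0 ?expR_ge0.
rewrite mem_box -ltnNge => Kk.
apply: le_trans (ler_wpM2r (expR_ge0 _) (hdec k)) _.
rewrite -expRN -!expRD ler_expR.
have [q qE] : exists q : R, q = K%:R `^ a by eexists.
have [x xE] : exists x : R, x = (freq_norm k)%:R `^ a by eexists.
rewrite -qE -xE; have q0 : 0 <= q by rewrite qE powR_ge0.
have xq : q <= x.
  by rewrite qE xE ge0_ler_powR ?nnegrE ?ler0n ?(ltW a0)// ler_nat ltnW.
have e1 : 2 * pi * (2 * s') * (ell1 k)%:R <= 4 * pi * n%:R * width * rho' * x.
  rewrite s'E xE; apply: strip_ell1 => //.
  by rewrite addn_gt0 K0.
have e2 : fdecay * rho' * x = 4 * pi * n%:R * width * rho' * x + 4 * (rho' * x).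
  by rewrite /fdecay; ring.
have e3 : rho * q <= rho' * x.
  by apply: ler_pM => //; apply: le_trans r4.
have e4 : 4 * q <= rho * q by rewrite ler_wpM2r.
by move: e1 e2 e3 e4 q0; clra.
Qed.

(** The small divisors, squared, and one factor exp(K^a) for polynomial factors leave of Newton's
    exponent 2 rho K^a at least (2 rho - 2 tau/a - 1) K^a. The hypothesis on gap * rho makes this at
    least (2 - 2 gap) rho K^a, which by [width_facts] reaches the exponent rho' (2 K)^a required
    next. The Newton step is followed by the enlargement of the truncation of F to 2 K. *)
Lemma kam_step K (rho rho' lU lF : R) (F U : 'I_n -> 'rV[int]_n -> C)
    (lam : 'I_n -> R) :
  (0 < K)%N ->
  kam_const * (4 * K + 1)%N%:R ^+ (2 * n + 4) <= expR (K%:R `^ a) ->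
  2 * (tau / a) + 1 <= 2 * gap * rho -> 1 <= gap * rho ->
  rho <= rho' -> rho' <= (1 + gap) * rho ->
  (forall i, csym (F i)) ->
  (forall i k, nc (F i k) <=
     expR (K%:R `^ a) * expR (- (fdecay * rho' * (freq_norm k)%:R `^ a))) ->
  lU <= 1 / 4 -> lF <= 1 -> kam_inv K rho lU lF F U lam ->
  exists (W : 'I_n -> 'rV[int]_n -> C) (mu : 'I_n -> R),
  [/\ kam_inv (K + K) rho' (lU + kappa / K%:R) (lF + 1 / (4 * K%:R)) F
        (fun i k => U i k + W i k) (fun i => lam i + mu i),
      forall i k, (K + K < freq_norm k)%N -> W i k = 0,
      forall i, csym (W i),
      forall i k, nc (W i k) <= kappa / (K%:R * (4 * K + 1)%N%:R ^+ (n + 3))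
         * expR (- ((rho - (tau / a + 1)) * K%:R `^ a))
    & forall i, `|mu i| <= kappa / K%:R].
Proof.
move=> K0 hA hrho1 hrho2 rr' r'r hF hdec lU4 lF1 [hUs hUsupp hlU hlF herr].
move/andP: (a01) => [a0 a1]; move/andP: (kappa01) => [k0 k1].
have pn0 : 0 <= pi * n%:R :> R by rewrite mulr_ge0 ?pi_ge0 ?ler0n.
have [q qE] : exists q : R, q = K%:R `^ a by eexists.
have [E EE] : exists E, E = expR q by eexists.
have [L LE] : exists L : R, L = (4 * K + 1)%N%:R by eexists.
have [Kr KrE] : exists Kr : R, Kr = K%:R by eexists.
have [V VE] : exists V : R, V = (K.*2.+1 ^ n)%:R by eexists.
have K1 : 1 <= Kr by rewrite KrE ler1n.
have Kr0 : 0 < Kr by apply: lt_le_trans K1.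
have q1 : 1 <= q by rewrite qE -[leLHS](powRr0 Kr) -KrE ler_powR// ltW.
have q0 : 0 < q by apply: lt_le_trans q1.
have L1 : 1 <= L by rewrite LE ler1n addn1.
have L0 : 0 <= L by apply: le_trans L1.
have L4 : L = 4 * Kr + 1 by rewrite LE KrE natrD natrM.
have KL1 : Kr + 1 <= L by rewrite L4; move: Kr0; clra.
have KL : Kr <= L by apply: le_trans KL1; rewrite lerDl.
have V0 : 0 <= V by rewrite VE ler0n.
have VL : V <= L ^+ n.
  by rewrite VE natrX LE lerXn2r ?nnegrE// ler_nat; clear; lia.
have E0 : 0 < E by rewrite EE expR_gt0.
have ki0 : 0 <= kappa^-1 by rewrite invr_ge0 ltW.
have hA' : kam_const * L ^+ (2 * n + 4) <= E by rewrite LE EE qE.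
have kcE : kam_const = 4 * (384 * (pi * n%:R) * Cw ^+ 2 + 256 * (pi * n%:R) ^+ 2 * Om * Cw ^+ 2
    + 96 * (pi * n%:R) * Cw + 4) + 56 + 16 * (pi * n%:R) + 8 * Cw + 64 * (pi * n%:R) * Cw
    + (16 * Cw + 64 * (pi * n%:R) * Cw + 4) / kappa by rewrite /kam_const; ring.
have [[cA1 cA2 cA3 cA4 cA5] [cA6 cA7 cA8]] :=
  consts_le pn0 Om0 Cw0 ki0 L1 kcE hA'.
have [s sE0] : exists s : R, s = strip_w K rho by eexists.
have [s' s'E0] : exists s' : R, s' = strip_w (K + K) rho' by eexists.
have [d dE] : exists d : R, d = (s - s') / 2 by eexists.
have KKr : (K + K)%:R = 2 * Kr :> R by rewrite natrD -KrE; ring.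
have bq : (K + K)%:R `^ a = b * q by rewrite KKr powRM ?(ltW Kr0)// KrE -qE.
have sE : s = width * rho * q / Kr by rewrite sE0 /strip_w -qE -KrE.
have s'E : s' = width * rho' * (b * q) / (2 * Kr) by rewrite s'E0 /strip_w bq KKr.
have g0 := gap_gt0.
have b4 : b = 2 - 4 * gap by rewrite /gap -/b; field.
have gw : gap * width = 2 by rewrite /width mulrCA divff ?mulr1// gt_eqF.
have [r4 dK s'0 ss' rr2] :=
  width_facts gw b4 g0 gap_lt hrho2 rr' r'r q1 K1 sE s'E dE.
have r0 : 0 <= rho by apply: le_trans r4.
have rt : tau / a + 1 <= rho.
  have : gap * rho <= 1 / 4 * rho by rewrite ler_wpM2r// ltW// gap_lt.
  have : 0 < tau / a by rewrite divr_gt0.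
  by move: hrho1; rewrite -mulrA; clra.
have rq1 : 1 <= rho * q.
  by apply: mulr_ege1 => //; apply: le_trans r4; rewrite ler1n.
have dK1 : 1 <= d * Kr by apply: le_trans dK.
have d0 : 0 < d by rewrite -(pmulr_lgt0 _ Kr0); apply: lt_le_trans dK1.
have sds' : s - 2 * d = s' by rewrite dE; field.
have s0 : 0 <= s by apply: le_trans ss'.
have [G GE] : exists G : R, G = expR (tau / a * q) by eexists.
have [eps epsE] : exists eps : R, eps = eps_of K rho by eexists.
have G1 : 1 <= G.
  by rewrite GE -[leLHS]expR0 ler_expR mulr_ge0 ?(ltW q0)// divr_ge0 ?ltW.
have eps0 : 0 < eps by rewrite epsE expR_gt0.
have Gam0 : 0 <= Cw * G by rewrite mulr_ge0//; apply: le_trans G1.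
have [zeta zE] : exists zeta : R, zeta = newton_size n (Cw * G) eps K by eexists.
have zE' : zeta = 8 * Cw * V * (G * eps) by rewrite zE /newton_size -VE; ring.
(* G eps = Y / E with E = exp(K^a): the factor 1 / E kept apart from Y pays for the polynomial
   factors in the bounds on zeta. *)
have [Y YE] : exists Y : R, Y = expR (- ((rho - (tau / a + 1)) * q)) by eexists.
have Y0 : 0 <= Y by rewrite YE expR_ge0.
have Y1 : Y <= 1.
  by rewrite YE -[leRHS]expR0 ler_expR oppr_le0 mulr_ge0 ?subr_ge0// ltW.
have GY : G * eps = Y / E.
  rewrite GE epsE /eps_of YE EE -expRN -!expRD; congr expR; rewrite -qE; ring.
have z0 : 0 <= zeta.
  by rewrite zE' !mulr_ge0 ?(ltW eps0)//; apply: le_trans G1.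
have z_Y x p : 0 <= x -> x * (8 * Cw) * L ^+ (n + p) <= E -> x * L ^+ p * zeta <= Y.
  by move=> x0 xE; rewrite zE'; exact: (zeta_le x0 Cw0 L0 V0 VL Y0 E0 GY xE).
have zd : zeta <= d.
  rewrite -(ler_pM2r Kr0); apply: le_trans dK1; apply: le_trans Y1.
  apply: le_trans (z_Y 1 1%N ler01 cA4); rewrite mul1r expr1 mulrC.
  by rewrite ler_wpM2r.
have nKE : (n * K)%:R = n%:R * Kr :> R by rewrite natrM KrE.
have zK : 2 * pi * (n * K)%:R * zeta <= 1 / 4.
  have x0 : 0 <= 8 * (pi * n%:R) :> R by rewrite mulr_ge0.
  have := le_trans (z_Y _ 1%N x0 cA5) Y1; rewrite expr1.
  have : 8 * (pi * n%:R) * Kr * zeta <= 8 * (pi * n%:R) * L * zeta.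
    by rewrite ler_wpM2r// ler_wpM2l.
  by rewrite nKE; clra.
have hGam k : k != 0 -> (freq_norm k <= K)%N ->
    freq_dot k om != 0 /\ `|2 * pi * freq_dot k om|^-1 <= Cw * G.
  move=> kn0 kK; have [h1 h2] := omd kn0; split; first exact: h1.
  apply: le_trans h2 _; apply: ler_wpM2l; first exact: Cw0.
  rewrite GE ler_expR; apply: ler_wpM2l; first by rewrite divr_ge0 ?ltW.
  by rewrite qE ge0_ler_powR ?nnegrE ?ler0n ?(ltW a0)// ler_nat.
have [W [mu [hW WB muB herr']]] : exists (W : 'I_n -> 'rV[int]_n -> C) (mu : 'I_n -> R),
  [/\ forall i, csym (W i) /\ (forall k, (K + K < freq_norm k)%N -> W i k = 0),
      forall i z, strip s z -> nc (pev (K + K) (W i) z) <= 2 * zeta,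
      forall i, `|mu i| <= 4 * eps
    & forall i z, strip s' z ->
        nc (err om K (K + K) F (fun i k => U i k + W i k) (fun i => lam i + mu i) i z)
          <= newton_error n Om (Cw * G) d eps K].
  rewrite -sds' zE; apply: newton_step.
  - exact: d0.
  - by rewrite sds'.
  - exact: eps0.
  - exact: Gam0.
  - exact: hGam.
  - exact: omOm.
  - exact: Om0.
  - exact: hF.
  - exact: hUs.
  - exact: hUsupp.
  - by move=> i; rewrite sE0; apply: le_trans (hlU i) _.
  - by move=> i; rewrite sE0; apply: le_trans (hlF i) _.
  - by move=> i z; rewrite sE0 epsE; exact: herr.
  - by rewrite -zE.
  - by rewrite -zE.
have WkB i k : nc (W i k) <= 2 * zeta.
  have [kK|kK] := leqP (freq_norm k) (K + K).
    exact: (coef_bound0 s0 (WB i) kK).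
  by rewrite (hW i).2// nc0 mulr_ge0.
have LKK : ((K + K).*2.+1 ^ n)%:R = L ^+ n.
  by rewrite natrX LE; congr (_%:R ^+ _); clear; lia.
have lipW i : lip s (K + K) (W i) <= kappa / Kr.
  apply: le_trans (lip_le_wnorm s (K + K) (W i)) _.
  apply: le_trans (ler_wpM2l _ (wnorm_le s0 (WB i) (leqnn _))) _.
    by rewrite !mulr_ge0 ?pi_ge0.
  rewrite LKK natrM KKr ler_pdivlMr//.
  have x0 : 0 <= 8 * (pi * n%:R) / kappa by apply: divr_ge0 (ltW k0); apply: mulr_ge0.
  have := le_trans (z_Y _ _ x0 cA7) Y1.
  rewrite -(ler_pM2l k0) mulr1; apply: le_trans.
  have -> : kappa * (8 * (pi * n%:R) / kappa * L ^+ (n + 2) * zeta)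
     = (8 * (pi * n%:R) * zeta * L ^+ n) * L ^+ 2.
    by rewrite exprD; field; rewrite gt_eqF.
  have -> : 2 * pi * (n%:R * (2 * Kr)) * (L ^+ n * (2 * zeta)) * Kr
     = (8 * (pi * n%:R) * zeta * L ^+ n) * Kr ^+ 2 by ring.
  apply: ler_wpM2l; first by rewrite mulr_ge0 ?exprn_ge0// mulr_ge0// mulr_ge0.
  by rewrite lerXn2r ?nnegrE// ltW.
have e21 : expR (- (2 * (rho * q))) <= 1.
  by rewrite -[leRHS]expR0 ler_expR oppr_le0 mulr_ge0//; apply: le_trans rq1.
have blkB i : blk (2 * s') K (F i) <= L ^+ n * (expR (- (2 * (rho * q))) / E).
  by rewrite LE EE qE; apply: blk_le rr' s'E0 (hdec i).
have blk1 i : 4 * pi * (n * K)%:R * blk (2 * s') K (F i) <= 1 / (4 * Kr).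
  rewrite ler_pdivlMr ?mulr_gt0//.
  apply: le_trans (_ : 4 * pi * (n%:R * Kr) * (L ^+ n * (1 / E)) * (4 * Kr) <= _).
    rewrite nKE; apply: ler_wpM2r; first by rewrite mulr_ge0// ltW.
    apply: ler_wpM2l; first by rewrite !mulr_ge0 ?pi_ge0// ltW.
    apply: le_trans (blkB i) _; apply: ler_wpM2l; first by rewrite exprn_ge0.
    by apply: ler_wpM2r => //; rewrite invr_ge0 ltW.
  have -> : 4 * pi * (n%:R * Kr) * (L ^+ n * (1 / E)) * (4 * Kr)
     = 16 * (pi * n%:R) * L ^+ n * Kr ^+ 2 / E by ring.
  rewrite ler_pdivrMr// mul1r; apply: le_trans cA3.
  have -> : 16 * (pi * n%:R) * L ^+ (n + 2) = 16 * (pi * n%:R) * L ^+ n * L ^+ 2.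
    by rewrite exprD; ring.
  apply: ler_wpM2l; first by rewrite mulr_ge0 ?exprn_ge0// mulr_ge0.
  by rewrite lerXn2r ?nnegrE// ltW.
have lipUW i : lip s' (K + K) (fun k => U i k + W i k) <= lU + kappa / Kr.
  apply: le_trans (lip_le _ _ ss') _; apply: le_trans (lipD _ _ _ _) _.
  by rewrite (lip_widen _ (leq_addr K K) (hUsupp i)) lerD// sE0.
have kK1 : kappa / Kr <= 1 / 2.
  by rewrite ler_pdivrMr//; move: K1 k1 k0; clra.
pose U' i k := U i k + W i k.
have U's i : csym (U' i) by move=> k; rewrite /U' conjc_add hUs (hW i).1.
(* The exponent of X separates what the Newton step yields from what the invariant at (2 K, rho')
   asks for. *)
have [X XE] : exists X : R, X = expR (- ((2 - 2 * gap) * rho * q)) by eexists.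
have X0 : 0 < X by rewrite XE expR_gt0.
have Xeps : X <= eps_of (K + K) rho'.
  rewrite XE /eps_of bq ler_expR lerN2 mulrA [rho' * b]mulrC.
  by apply: ler_wpM2r => //; exact: ltW.
have e2X : expR (- (2 * (rho * q))) <= X.
  rewrite XE ler_expR lerN2 -mulrA; apply: ler_wpM2r; first by apply: le_trans rq1.
  by move: g0; clra.
have ZX : E * (G * eps) ^+ 2 <= X.
  rewrite GE epsE /eps_of -qE EE XE -expRD expr2 -!expRD ler_expR.
  have : (2 * (tau / a) + 1) * q <= 2 * gap * rho * q by apply: ler_wpM2r => //; exact: ltW.
  by clra.
have eE : eps * E <= 1.
  rewrite epsE /eps_of EE -expRD -[leRHS]expR0 ler_expR -qE.
  have : 4 * q <= rho * q by apply: ler_wpM2r => //; exact: ltW.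
  by move: q0; clra.
have newtonE : newton_error n Om (Cw * G) d eps K <= X / 2.
  have quad := quad_bound pn0 Om0 Cw0 L1 K1 KL V0 VL G1 (ltW eps0) zE'.
  have {}quad : 4 * (6 * (pi * n%:R * Kr) * zeta ^+ 2 + 4 * (pi * n%:R * Kr) ^+ 2 * Om * zeta ^+ 2 +
          12 * (pi * n%:R * Kr) * V * zeta * eps + 4 * eps ^+ 2) <= X.
    apply: le_trans ZX; apply: le_trans (ler_wpM2l (ler0n R 4) quad) _.
    have := ler_wpM2r (sqr_ge0 (G * eps)) cA1; apply: le_trans.
    by apply: eq_ler; ring.
  have tailE : 14 * eps * tail_factor n d K * 4 <= X.
    apply: le_trans e2X.
    have tf : tail_factor n d K <= expR (- (2 * (rho * q))) * L ^+ n.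
      by apply: tail_factor_le; rewrite -?KrE// ler_wpM2l.
    apply: le_trans (_ : 14 * eps * (expR (- (2 * (rho * q))) * L ^+ n) * 4 <= _).
      apply: ler_wpM2r => //; apply: ler_wpM2l tf.
      by rewrite mulr_ge0// ltW.
    have -> : 14 * eps * (expR (- (2 * (rho * q))) * L ^+ n) * 4
       = expR (- (2 * (rho * q))) * (eps * (56 * L ^+ n)) by ring.
    rewrite -[leRHS]mulr1; apply: ler_wpM2l; first exact: expR_ge0.
    apply: le_trans eE; apply: ler_wpM2l => //; exact: ltW.
  have -> : newton_error n Om (Cw * G) d eps K
     = 6 * (pi * n%:R * Kr) * zeta ^+ 2 + 4 * (pi * n%:R * Kr) ^+ 2 * Om * zeta ^+ 2
       + 12 * (pi * n%:R * Kr) * V * zeta * eps + 4 * eps ^+ 2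
       + 14 * eps * tail_factor n d K.
    by rewrite /newton_error -zE -VE nKE; ring.
  by move: quad tailE; clra.
have blk2 i : blk (2 * s') K (F i) <= X / 4.
  apply: le_trans (blkB i) _; rewrite ler_pdivlMr//; apply: le_trans e2X.
  have -> : L ^+ n * (expR (- (2 * (rho * q))) / E) * 4
     = expR (- (2 * (rho * q))) * ((4 * L ^+ n) / E) by ring.
  rewrite -[leRHS]mulr1; apply: ler_wpM2l; first exact: expR_ge0.
  rewrite ler_pdivrMr// mul1r; apply: le_trans cA2.
  by apply: ler_wpM2r; rewrite ?exprn_ge0// ler_nat.
exists W, mu; split=> [|i|i|i k|i]; [|exact: (hW i).2|exact: (hW i).1| |].
- split=> [i|i k kK|i|i|i z zs].
  + exact: U's.
  + by rewrite hUsupp ?(hW i).2 ?addr0//; apply: leq_ltn_trans kK; exact: leq_addr.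
  + by rewrite -s'E0 -KrE; exact: lipUW.
  + rewrite -s'E0 -KrE; apply: le_trans (lip_blk _ _ _) _; apply: lerD (blk1 i).
    by apply: le_trans (hlF i); apply: lip_le; rewrite -sE0 ler_wpM2l.
  + apply: le_trans Xeps; rewrite -s'E0 in zs.
    have [z' z'E] : exists z', z' = z + \row_j pev (K + K) (U' j) z by eexists.
    have z's : strip (2 * s') z'.
      have -> : 2 * s' = s' + s' by ring.
      rewrite z'E; apply: stripD => // j; rewrite mxE.
      apply: le_trans (pev_Im _ s'0 (U's j) zs) _.
      rewrite -[leRHS]mulr1; apply: ler_wpM2l => //; apply: le_trans (lipUW j) _.
      by move: lU4 kK1; clra.
    (* Enlarging the truncation of F adds the block K < |k| <= 2 K, evaluated at a point of the
       strip of width 2 s'. *)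
    have -> : err om (K + K) (K + K) F (fun i k => U i k + W i k) (fun i => lam i + mu i) i z
       = err om K (K + K) F U' (fun i => lam i + mu i) i z
         + \sum_(k <- box n (K + K) | k \notin box n K) F i k * ek k z'.
      by rewrite /err -z'E {1}/pev (big_box_split _ (leq_addr K K)) -/(pev K (F i) z'); ring.
    apply: le_trans (ncD _ _) _.
    have h2 : nc (\sum_(k <- box n (K + K) | k \notin box n K) F i k * ek k z')
        <= blk (2 * s') K (F i).
      apply: le_trans (nc_sum _ _ _) _; apply: ler_sum => k _.
      by rewrite ncM ler_wpM2l ?nc_ge0// nc_ek.
    have h3 := le_trans (herr' i z zs) newtonE; have h4 := le_trans h2 (blk2 i).
    apply: le_trans (lerD h3 h4) _; by move: X0; clra.
- apply: le_trans (WkB i k) _; rewrite -qE -LE -KrE -YE.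
  have LKn : 0 < Kr * L ^+ (n + 3).
    by rewrite mulr_gt0// exprn_gt0//; apply: lt_le_trans L1.
  rewrite mulrAC ler_pdivlMr// -ler_pdivrMl//.
  have x0 : 0 <= 2 / kappa by rewrite divr_ge0// ltW.
  apply: le_trans (z_Y _ _ x0 cA6).
  have -> : kappa^-1 * (2 * zeta * (Kr * L ^+ (n + 3)))
     = (2 / kappa * L ^+ (n + 3) * zeta) * Kr by ring.
  have -> : 2 / kappa * L ^+ (n + 4) * zeta = (2 / kappa * L ^+ (n + 3) * zeta) * L.
    by rewrite [(n + 4)%N]addnS exprS; ring.
  by apply: ler_wpM2l KL; rewrite mulr_ge0// mulr_ge0// exprn_ge0.
- apply: le_trans (muB i) _; rewrite -KrE ler_pdivlMr// -[kappa]mulr1 -ler_pdivrMl//.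
  apply: le_trans eE; have -> : kappa^-1 * (4 * eps * Kr) = eps * (4 / kappa * Kr) by ring.
  apply: ler_wpM2l; first exact: ltW.
  apply: le_trans cA8; apply: ler_wpM2l => //.
  by rewrite divr_ge0// ltW.
Qed.

End KamStep.

(** * Limits of sequences with geometric increments *)

Section GeometricLimits.
Variable R : realType.

Lemma geo_increments (u : nat -> R) (c : R) J m :
  (forall j, (J <= j)%N -> `|u j.+1 - u j| <= c * (1 / 2) ^+ j) ->
  `|u (J + m)%N - u J| <= 2 * c * (1 / 2) ^+ J * (1 - (1 / 2) ^+ m).
Proof.
move=> h; elim: m => [|m IH]; first by rewrite addn0 subrr normr0 ?expr0 ?subrr mulr0.
have -> : u (J + m.+1)%N - u J = (u (J + m).+1 - u (J + m)%N) + (u (J + m)%N - u J).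
  by rewrite addnS; ring.
apply: le_trans (ler_normD _ _) _; apply: le_trans (lerD (h _ (leq_addr _ _)) IH) _.
by rewrite exprD exprS; apply: eq_ler; field.
Qed.

(** The tail estimate is offered for every constant c' valid from J on, since one limit is later
    estimated with different constants: one for all steps, others, depending on a decay rate, only
    from some step on. *)
Lemma geo_limit (u : nat -> R) (c : R) :
  (forall j, `|u j.+1 - u j| <= c * (1 / 2) ^+ j) ->
  exists l : R, forall J (c' : R), (forall j, (J <= j)%N -> `|u j.+1 - u j| <= c' * (1 / 2) ^+ j) ->
    `|l - u J| <= 2 * c' * (1 / 2) ^+ J.
Proof.
move=> h; have half : `|1 / 2 : R| < 1 by rewrite ger0_norm; lra.
have cv : cvgn (series (telescope u)).
  apply: normed_cvg.
  apply: (@series_le_cvg R (fun j => `|telescope u j|) (geometric c (1 / 2))) => //.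
    by move=> j; apply: le_trans (h j).
  exact: is_cvg_geometric_series.
have cu : cvgn u.
  rewrite (_ : u = (fun n => u 0%N + series (telescope u) n)); last first.
    by apply/funext => j; rewrite telescopeK /= addrC subrK.
  by apply: is_cvgD => //; exact: is_cvg_cst.
exists (limn u) => J c' h'.
have pos : 0 <= 2 * c' * (1 / 2) ^+ J.
  have := le_trans (normr_ge0 _) (h' J (leqnn J)).
  by rewrite -mulrA => hc; rewrite mulr_ge0.
have cJ : `|u j - u J| @[j --> \oo] --> `|limn u - u J|.
  by apply: cvg_norm; apply: cvgB => //; exact: cvg_cst.
rewrite -(cvg_lim _ cJ)//; apply: limr_le; first by apply/cvg_ex; exists (`|limn u - u J|).
exists J => // j /= Jj; have := @geo_increments u c' J (j - J) h'.
rewrite subnKC// => h2; apply: le_trans h2 _.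
by rewrite ler_piMr// gerBl exprn_ge0.
Qed.

End GeometricLimits.

(** * The Newton sequence and its limit *)

Section KamSequence.
Variables (R : realType) (n : nat).
Local Notation C := R[i].
Implicit Types (k l : 'rV[int]_n) (z w h v : 'rV[C]_n).

Lemma geo_limitC (u : nat -> C) (c : R) :
  (forall j, nc (u j.+1 - u j) <= c * (1 / 2) ^+ j) ->
  exists l : C, forall J (c' : R), (forall j, (J <= j)%N -> nc (u j.+1 - u j) <= c' * (1 / 2) ^+ j) ->
    nc (l - u J) <= 4 * c' * (1 / 2) ^+ J.
Proof.
move=> h.
have reB (x y : C) : `|complex.Re x - complex.Re y| <= nc (x - y).
  by apply: le_trans (nc_Re (x - y)); rewrite ReD; case: y => p q /=.
have imB (x y : C) : `|complex.Im x - complex.Im y| <= nc (x - y).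
  by apply: le_trans (nc_Im (x - y)); rewrite ImD; case: y => p q /=.
have [lr hr] := geo_limit (u := fun j => complex.Re (u j)) (fun j => le_trans (reB _ _) (h j)).
have [li hi] := geo_limit (u := fun j => complex.Im (u j)) (fun j => le_trans (imB _ _) (h j)).
exists (lr +i* li)%C => J c' h'.
have h1 := hr J c' (fun j Jj => le_trans (reB _ _) (h' j Jj)).
have h2 := hi J c' (fun j Jj => le_trans (imB _ _) (h' j Jj)).
apply: le_trans (nc_le_ReIm _) _.
have -> : complex.Re ((lr +i* li)%C - u J) = lr - complex.Re (u J).
  by rewrite ReD; case: (u J).
have -> : complex.Im ((lr +i* li)%C - u J) = li - complex.Im (u J).
  by rewrite ImD; case: (u J).
lra.
Qed.

Variables (a tau Om Cw kappa : R) (om : 'rV[R]_n).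
Hypotheses (a01 : 0 < a < 1) (tau0 : 0 < tau) (Om0 : 0 <= Om) (Cw0 : 0 <= Cw).
Hypothesis kappa01 : 0 < kappa <= 1 / 8.
Hypothesis omOm : forall i, `|om 0 i| <= Om.
Hypothesis omd : forall k, k != 0 -> freq_dot k om != 0 /\
  `|2 * pi * freq_dot k om|^-1 <= Cw * expR (tau / a * (freq_norm k)%:R `^ a).

Variables (K0 : nat) (rho0 : R).
Hypothesis K00 : (0 < K0)%N.
Hypothesis hA : forall K, (K0 <= K)%N ->
  kam_const n Om Cw kappa * (4 * K + 1)%N%:R ^+ (2 * n + 4) <= expR (K%:R `^ a).
Hypotheses (hrho1 : 2 * (tau / a) + 1 <= 2 * gap a * rho0) (hrho2 : 1 <= gap a * rho0).

Definition scale j : nat := (K0 * 2 ^ j)%N.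

Lemma scaleS j : scale j.+1 = (scale j + scale j)%N.
Proof. by rewrite /scale expnS mulnCA mul2n -addnn. Qed.

Lemma scale_ge j : (K0 <= scale j)%N.
Proof. by rewrite /scale leq_pmulr// expn_gt0. Qed.

Lemma scale_gt0 j : (0 < scale j)%N.
Proof. exact: leq_trans K00 (scale_ge j). Qed.

Lemma scale_half j : 1 / (scale j)%:R <= (1 / 2) ^+ j :> R.
Proof.
rewrite exprMn expr1n mul1r exprVn mul1r lef_pV2 ?posrE ?exprn_gt0 ?ltr0n ?scale_gt0//.
by rewrite -natrX ler_nat /scale leq_pmull.
Qed.

Variable F : 'I_n -> 'rV[int]_n -> C.
Hypothesis Fsym : forall i, csym (F i).
Variable B : nat -> R.
Hypothesis hB : forall m i k, nc (F i k)
  <= B m * expR (- (fdecay n a * (rho0 + m%:R) * (freq_norm k)%:R `^ a)).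
(** Makes U = 0, lambda = 0 an admissible start: the weighted sum of the truncated F is at most this
    times the number of frequencies, and the factor 1 + 4 pi n K0 leaves room for one derivative,
    with [lip] at most 1/2. *)
Definition kam_small : R :=
  eps_of a K0 rho0 / ((1 + 4 * pi * (n * K0)%:R) * (K0.*2.+1 ^ n)%:R).
Hypothesis B0 : B 0 <= kam_small.

(* rho increases by one as soon as the bound for F at the next decay rate is absorbed by
   exp(K_j^a); the bounds [B] are arbitrary, but K_j tends to infinity. *)
Fixpoint level j : nat :=
  if j is j'.+1 then
    if B (level j').+1 <= expR ((scale j')%:R `^ a) then (level j').+1 else level j'
  else 0%N.

Lemma scale_powR_le i j : (i <= j)%N -> (scale i)%:R `^ a <= (scale j)%:R `^ a :> R.
Proof.
move=> ij; case/andP: (a01) => a0 _; rewrite ge0_ler_powR ?nnegrE ?ler0n ?(ltW a0)//.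
by rewrite ler_nat leq_mul2l leq_exp2l// ij orbT.
Qed.

Lemma rho0_ge4 : 4 <= rho0.
Proof.
have g0 := gap_gt0 a01; have g1 := gap_lt a01.
have r0 : 0 < rho0 by rewrite -(pmulr_rgt0 _ g0); apply: lt_le_trans hrho2.
have : gap a * rho0 <= 1 / 4 * rho0 by rewrite ler_wpM2r// ltW.
have := hrho2; lra.
Qed.

Lemma kam_small_le1 : kam_small <= 1.
Proof.
rewrite /kam_small ler_pdivrMr; last first.
  by rewrite mulr_gt0 ?ltr0n ?expn_gt0// ltr_pwDl// !mulr_ge0 ?pi_ge0.
rewrite mul1r; apply: le_trans (_ : 1 * 1 <= _).
  rewrite mul1r -[leRHS]expR0 ler_expR oppr_le0 mulr_ge0 ?powR_ge0//.
  by apply: le_trans rho0_ge4.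
by apply: ler_pM => //; rewrite ?ler1n ?expn_gt0// lerDl !mulr_ge0 ?pi_ge0.
Qed.

Lemma levelP j : B (level j) <= expR ((scale j)%:R `^ a) /\
  B (level j.+1) <= expR ((scale j)%:R `^ a).
Proof.
have h j' : B (level j') <= expR ((scale j')%:R `^ a) ->
    B (level j'.+1) <= expR ((scale j')%:R `^ a).
  by move=> hj /=; case: ifP.
have h1 : B (level j) <= expR ((scale j)%:R `^ a).
  elim: j => [|j IH] /=.
    apply: le_trans B0 _; apply: le_trans kam_small_le1 _.
    by rewrite -[leLHS]expR0 ler_expR powR_ge0.
  have e : expR ((scale j)%:R `^ a) <= expR ((scale j.+1)%:R `^ a) :> R.
    by rewrite ler_expR scale_powR_le.
  by case: ifP => h2; apply: le_trans e.
by split=> //; exact: h.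
Qed.

Lemma level_mono i j : (i <= j)%N -> (level i <= level j)%N.
Proof.
move=> /subnKC <-; elim: (j - i)%N => [|m IH]; first by rewrite addn0.
by apply: leq_trans IH _; rewrite addnS /=; case: ifP.
Qed.

Lemma powR_unbounded (M : R) : exists J, forall j, (J <= j)%N -> M <= expR ((scale j)%:R `^ a).
Proof.
case/andP: (a01) => a0 _.
have [Q Q0 hQ] := exp_dominates `|M| 0 a0; exists Q => j Qj.
have Qs : (Q <= scale j)%N.
  apply: leq_trans Qj _; apply: leq_trans (ltnW (ltn_expl j (ltnSn 1))) _.
  by rewrite /scale leq_pmull.
by have := hQ _ Qs; rewrite expr0 mulr1; apply: le_trans; exact: ler_norm.
Qed.

Lemma level_unbounded M : exists J, forall j, (J <= j)%N -> (M <= level j)%N.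
Proof.
elim: M => [|M [J hJ]]; first by exists 0%N.
have [J' hJ'] := powR_unbounded (B M.+1).
exists (maxn J J').+1 => j Jj.
apply: leq_trans (level_mono Jj) => /=.
have h1 := hJ _ (leq_maxl J J'); have h2 := hJ' _ (leq_maxr J J').
move: h1; rewrite leq_eqVlt => /predU1P[e|h1]; first by rewrite -e h2.
by case: ifP => // _; apply: leq_trans h1 _.
Qed.

Definition rho j : R := rho0 + (level j)%:R.
(** Loss of exponent from the defect to the correction: tau / a for the small divisors, 1 for the
    polynomial factors. *)
Definition rhostar : R := tau / a + 1.

Let st := (('I_n -> 'rV[int]_n -> C) * ('I_n -> R))%type.

(** The two bounds are partial sums of the geometric series that dominate the increments kappa / K_j
    and 1 / (4 K_j); they stay below 1/4 and 1 as [kam_step] demands. *)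
Definition kam_good j (x : st) :=
  kam_inv a om (scale j) (rho j) (2 * kappa * (1 - (1 / 2) ^+ j))
    (1 / 2 + 1 / 2 * (1 - (1 / 2) ^+ j)) F x.1 x.2.

Definition kam_next j (x y : st) :=
  exists (W : 'I_n -> 'rV[int]_n -> C),
  [/\ forall i k, y.1 i k = x.1 i k + W i k,
      forall i k, (scale j.+1 < freq_norm k)%N -> W i k = 0,
      forall i k, nc (W i k) <= kappa / ((scale j)%:R * (4 * scale j + 1)%N%:R ^+ (n + 3))
         * expR (- ((rho j - rhostar) * (scale j)%:R `^ a))
    & forall i, `|y.2 i - x.2 i| <= kappa / (scale j)%:R].

Lemma kam_good_step j x : kam_good j x -> exists y, kam_good j.+1 y /\ kam_next j x y.
Proof.
move=> gx; have /andP[k0 k1] := kappa01.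
have p1 : 0 <= (1 / 2 : R) ^+ j by rewrite exprn_ge0.
have rj : rho0 <= rho j by rewrite lerDl.
have rr : rho j <= rho j.+1.
  by rewrite lerD2l ler_nat level_mono.
have g0 := gap_gt0 a01.
have lS : (level j.+1)%:R <= (level j)%:R + 1 :> R.
  by rewrite natr1 ler_nat /=; case: ifP.
have gr : gap a * rho0 <= gap a * rho j by rewrite ler_wpM2l// ltW.
have kk : 0 < kappa < 1 / 2 by apply/andP; split=> //; apply: le_lt_trans k1 _; lra.
have h1 : 2 * (tau / a) + 1 <= 2 * gap a * rho j.
  by apply: le_trans hrho1 _; rewrite -[leLHS]mulrA -[leRHS]mulrA ler_wpM2l.
have h2 : rho j.+1 <= (1 + gap a) * rho j.
  rewrite mulrDl mul1r; apply: le_trans (_ : rho j + 1 <= _).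
    by rewrite /rho -addrA lerD2l.
  by rewrite lerD2l; exact: le_trans hrho2 gr.
have h3 i k : nc (F i k) <= expR ((scale j)%:R `^ a)
    * expR (- (fdecay n a * rho j.+1 * (freq_norm k)%:R `^ a)).
  apply: le_trans (hB (level j.+1) i k) _.
  by rewrite ler_wpM2r ?expR_ge0//; exact: (levelP j).2.
have h4 : 2 * kappa * (1 - (1 / 2) ^+ j) <= 1 / 4.
  have : 2 * kappa * (1 - (1 / 2) ^+ j) <= 2 * kappa * 1.
    by rewrite ler_wpM2l ?mulr_ge0 ?(ltW k0)// gerBl.
  lra.
have h5 : 1 / 2 + 1 / 2 * (1 - (1 / 2) ^+ j) <= 1 :> R by lra.
have [W [mu [inv Wsupp Wsym WB muB]]] := kam_step a01 tau0 Om0 Cw0 kk omOm omd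
  (scale_gt0 j) (hA (scale_ge j)) h1 (le_trans hrho2 gr) rr h2 Fsym h3 h4 h5 gx.
exists ((fun i k => x.1 i k + W i k), (fun i => x.2 i + mu i)); split; last first.
  exists W; split=> // [i k|i]; first by rewrite scaleS; exact: Wsupp.
  by rewrite /= addrC addKr.
have h2' : 1 / (scale j)%:R <= (1 / 2) ^+ j :> R := scale_half j.
rewrite /kam_good scaleS; case: inv => i1 i2 i3 i4 i5; split=> // i /=.
- apply: le_trans (i3 i) _.
  have : kappa / (scale j)%:R <= kappa * (1 / 2) ^+ j.
    by rewrite -[kappa / _]mulr1 -mulrA [_^-1 * 1]mulrC ler_wpM2l// ltW.
  by rewrite exprS; lra.
- apply: le_trans (i4 i) _.
  have -> : 1 / (4 * (scale j)%:R) = 1 / 4 * (1 / (scale j)%:R) :> R.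
    by field; rewrite pnatr_eq0 -lt0n scale_gt0.
  by rewrite exprS; lra.
Qed.

Lemma kam_good0 : kam_good 0 ((fun _ _ => 0), (fun=> 0)).
Proof.
case/andP: (a01) => a0 a1; have pi0 := @pi_ge0 R.
have s0E : scale 0 = K0 by rewrite /scale expn0 muln1.
have r0E : rho 0 = rho0 by rewrite /rho addr0.
rewrite /kam_good s0E r0E expr0 subrr !mulr0 addr0.
have w0 := ltW (width_gt0 a01); have r0 : 0 <= rho0 by apply: le_trans rho0_ge4.
pose s := strip_w a K0 rho0.
have s0 : 0 <= s by rewrite divr_ge0 ?ler0n// mulr_ge0 ?powR_ge0// mulr_ge0.
pose V : R := (K0.*2.+1 ^ n)%:R.
have V0 : 0 < V by rewrite ltr0n expn_gt0.
pose P : R := 1 + 4 * pi * (n * K0)%:R.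
have P0 : 0 < P by rewrite ltr_pwDl// !mulr_ge0.
have e0 : 0 < kam_small by rewrite divr_gt0 ?expR_gt0// mulr_gt0.
have cB i k : (freq_norm k <= K0)%N ->
    nc (F i k) * expR (2 * pi * (2 * s) * (ell1 k)%:R) <= kam_small.
  move=> kK; have h := hB 0 i k; rewrite addr0 in h.
  set e1 := expR (- _) in h; set e2 := expR _.
  have e10 : 0 < e1 by exact: expR_gt0.
  have b0 : 0 <= B 0 by rewrite -(pmulr_lge0 _ e10); apply: le_trans h; exact: nc_ge0.
  apply: le_trans (ler_wpM2r (expR_ge0 _) h) _; rewrite -[leLHS]mulrA.
  apply: le_trans (_ : B 0 * 1 <= _); last by rewrite mulr1.
  rewrite ler_wpM2l// -expRD -[leRHS]expR0 ler_expR.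
  have h1 := strip_ell1 a01 K00 r0 kK.
  have : 0 <= 4 * (rho0 * (freq_norm k)%:R `^ a) by rewrite !mulr_ge0 ?powR_ge0.
  rewrite /fdecay /s; lra.
have wB i : wnorm (2 * s) K0 (F i) <= V * kam_small.
  apply: le_trans (ler_sum_box (cB i)) _.
  by rewrite big_const_seq count_predT size_box iter_addr_0 -[leLHS]mulr_natl.
have eE : V * kam_small * P = eps_of a K0 rho0.
  by rewrite /kam_small -/V -/P; field; rewrite !gt_eqF.
have eps1 : eps_of a K0 rho0 <= 1.
  by rewrite -[leRHS]expR0 ler_expR oppr_le0 mulr_ge0 ?powR_ge0.
have P1 : 1 <= P by rewrite lerDl !mulr_ge0.
have Ve0 : 0 <= V * kam_small by rewrite mulr_ge0 ?ltW.
split=> //= [i k|i|i|i z zs].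
- by rewrite rmorph0.
- by rewrite /lip big1// => k _; rewrite nc0 !mul0r.
- apply: le_trans (lip_le_wnorm _ _ _) _.
  apply: le_trans (ler_wpM2l _ (wB i)) _; first by rewrite !mulr_ge0.
  have : V * kam_small * P = V * kam_small + 2 * (2 * pi * (n * K0)%:R * (V * kam_small)).
    by rewrite /P; ring.
  lra.
- rewrite /err (_ : pev K0 (dcoef _ _) z = 0) ?subr0; last first.
    by rewrite /pev big1// => k _; rewrite /dcoef mulr0 mul0r.
  rewrite (_ : \row_j _ = 0) ?addr0; last first.
    by apply/rowP => j; rewrite !mxE /pev big1// => k _; rewrite mul0r.
  have z2 : strip (2 * s) z by apply: strip_le zs; rewrite -/s; lra.
  apply: le_trans (nc_pev _ _ z2) _; apply: le_trans (wB i) _.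
  by rewrite -eE ler_peMr.
Qed.

Lemma kam_states : exists x : nat -> st,
  [/\ x 0%N = ((fun _ _ => 0), (fun=> 0)), forall j, kam_good j (x j)
    & forall j, kam_next j (x j) (x j.+1)].
Proof.
have hf (p : nat * st) : exists y : st,
    kam_good p.1 p.2 -> kam_good p.1.+1 y /\ kam_next p.1 p.2 y.
  case: (pselect (kam_good p.1 p.2)) => [g|g]; last by exists p.2.
  by have [y hy] := kam_good_step g; exists y.
have [f hf'] := choice hf.
pose x := fix x j : st := if j is j'.+1 then f (j', x j') else ((fun _ _ => 0), (fun=> 0)).
have g j : kam_good j (x j).
  by elim: j => [|j IH]; [exact: kam_good0|exact: (hf' (j, x j) IH).1].
by exists x; split=> // j; exact: (hf' (j, x j) (g j)).2.
Qed.

(** The same increments are summed twice. At rate r = 0, for all j, they give the weight (1 + 2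
    |k|)^(n+3) with the small constant 4 kappa, hence closeness to the identity in C^1. At an
    arbitrary rate r they decay from the step on where rho_j exceeds 2 r + rhostar, which suffices
    for membership in the class. *)
Lemma kam_limit :
  exists (U : nat -> 'I_n -> 'rV[int]_n -> C) (lam : nat -> 'I_n -> R)
    (u : 'I_n -> 'rV[int]_n -> C) (l : 'I_n -> R),
  [/\ forall i, csym (u i),
      [/\ forall j i, csym (U j i),
        forall j i k, (scale j < freq_norm k)%N -> U j i k = 0
      & forall j i z, strip 0 z ->
        nc (err om (scale j) (scale j) F (U j) (lam j) i z) <= expR (- (scale j)%:R `^ a)],
      (forall i k, U 0 i k = 0) /\ (forall i, lam 0 i = 0),
      (forall j i k, nc (u i k - U j i k) * (1 + 2 * freq_norm k)%N%:R ^+ (n + 3)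
         <= 4 * kappa * (1 / 2) ^+ j) /\
      (forall j i, `|l i - lam j i| <= 2 * kappa * (1 / 2) ^+ j)
    & forall r, 0 < r -> exists D, forall i k,
        nc (u i k) <= D * expR (- (r * (freq_norm k)%:R `^ a))].
Proof.
have [x [x0 xg xn]] := kam_states; have /andP[k0 _] := kappa01; case/andP: (a01) => a0 a1.
have r4 j : 4 <= rho j by apply: le_trans rho0_ge4 _; rewrite lerDl.
have rs j : rhostar <= rho j.
  apply: le_trans (_ : rho0 <= _); last by rewrite lerDl.
  have g1 := gap_lt a01; have r0 : 0 < rho0 by apply: lt_le_trans rho0_ge4.
  have : gap a * rho0 <= 1 / 4 * rho0 by rewrite ler_wpM2r ?ltW.
  have t0 : 0 <= tau / a by rewrite divr_ge0 ?ltW.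
  by rewrite /rhostar; move: hrho1 t0 r0; rewrite -[2 * gap a * _]mulrA; lra.
have q0 j : 0 <= (scale j)%:R `^ a :> R by exact: powR_ge0.
(* The correction has |k| <= 2 K_j, hence |k|^a <= 2 K_j^a and 1 + 2 |k| <= 4 K_j + 1; the first
   bound is the origin of the factor 2 in front of r. *)
have incr j i k r : 0 <= r -> 2 * r <= rho j - rhostar ->
    nc ((x j.+1).1 i k - (x j).1 i k)
      <= kappa / (1 + 2 * freq_norm k)%N%:R ^+ (n + 3)
         * expR (- (r * (freq_norm k)%:R `^ a)) * (1 / 2) ^+ j.
  move=> r0 rr; have [W [WE Wsupp WB _]] := xn j.
  rewrite WE addrC addKr.
  case: (leqP (freq_norm k) (scale j.+1)) => kj; last first.
    rewrite Wsupp// nc0; apply: mulr_ge0; last by rewrite exprn_ge0.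
    by rewrite mulr_ge0 ?expR_ge0 ?divr_ge0 ?exprn_ge0 ?(ltW k0).
  apply: le_trans (WB i k) _.
  have s0 : 0 < (scale j)%:R :> R by rewrite ltr0n scale_gt0.
  have -> : kappa / ((scale j)%:R * (4 * scale j + 1)%N%:R ^+ (n + 3))
     = kappa / (4 * scale j + 1)%N%:R ^+ (n + 3) * (1 / (scale j)%:R).
    by field; rewrite gt_eqF// expf_neq0 // pnatr_eq0 addn1.
  have kd (m : nat) : 0 <= kappa / m%:R ^+ (n + 3) by rewrite divr_ge0 ?exprn_ge0 ?(ltW k0).
  rewrite mulrAC; apply: ler_pM; [exact: mulr_ge0 (kd _) (expR_ge0 _)|by rewrite divr_ge0| |
    exact: scale_half].
  apply: ler_pM; rewrite ?expR_ge0 ?divr_ge0 ?exprn_ge0 ?(ltW k0)//.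
    rewrite ler_pM2l// lef_pV2 ?posrE ?exprn_gt0 ?ltr0n ?addn1//.
    rewrite lerXn2r ?nnegrE// ler_nat; move: kj; rewrite scaleS; nlia.
  rewrite ler_expR lerN2.
  apply: le_trans (_ : r * (2 * (scale j)%:R `^ a) <= _).
    rewrite ler_wpM2l//; apply: le_trans (_ : (2 * (scale j)%:R) `^ a <= _).
      rewrite ge0_ler_powR ?nnegrE ?(ltW a0)//.
      by rewrite -natrM ler_nat; move: kj; rewrite scaleS; nlia.
    rewrite powRM//; rewrite ler_wpM2r// -[leRHS]powRr1//; apply: ler_powR => //; first by lra.
    exact: ltW.
  by rewrite mulrA [r * 2]mulrC ler_wpM2r.
have e0 : (0 : R) <= 0 by [].
have rs0 j : 2 * 0 <= rho j - rhostar by rewrite mulr0 subr_ge0.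
have hk0 k : 0 < (1 + 2 * freq_norm k)%N%:R ^+ (n + 3) :> R by rewrite exprn_gt0// ltr0n.
have incr0 j i k : nc ((x j.+1).1 i k - (x j).1 i k)
      <= kappa / (1 + 2 * freq_norm k)%N%:R ^+ (n + 3) * (1 / 2) ^+ j.
  by have := incr j i k 0 e0 (rs0 j); rewrite mul0r oppr0 expR0 mulr1.
have hu (p : 'I_n * 'rV[int]_n) := @geo_limitC (fun j => (x j).1 p.1 p.2) _
  (fun j => incr0 j p.1 p.2).
have [u hu'] := choice hu.
have incrl j i : `|(x j.+1).2 i - (x j).2 i| <= kappa * (1 / 2) ^+ j.
  have [W [_ _ _ h]] := xn j; apply: le_trans (h i) _.
  by have := ler_wpM2l (ltW k0) (scale_half j); rewrite mulrA mulr1.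
have [l hl] := choice (fun i => @geo_limit _ (fun j => (x j).2 i) _ (fun j => incrl j i)).
have uB j i k : nc (u (i, k) - (x j).1 i k) * (1 + 2 * freq_norm k)%N%:R ^+ (n + 3)
    <= 4 * kappa * (1 / 2) ^+ j.
  rewrite -ler_pdivlMr//; apply: le_trans (hu' (i, k) j _ (fun j' _ => incr0 j' i k)) _.
  by apply: eq_ler; field; rewrite gt_eqF// ltr0n.
exists (fun j => (x j).1), (fun j => (x j).2), (fun i k => u (i, k)), l; split.
- move=> i k; apply/subr0_eq/nc_eq0/eqP; rewrite eq_le nc_ge0 andbT.
  apply/ler_addgt0Pl => e e0'; rewrite addr0.
  have [m hm] : exists m : nat, 8 * kappa * (1 / 2) ^+ m <= e.
    have [m hm] : exists m : nat, 8 * kappa / e <= m%:R.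
      by exists (Num.truncn (8 * kappa / e)).+1; exact: ltW (truncnS_gt _).
    exists m; apply: le_trans (_ : 8 * kappa / m.+1%:R <= _).
      apply: ler_wpM2l; first exact: mulr_ge0 (ler0n _ _) (ltW k0).
      rewrite exprMn expr1n mul1r exprVn lef_pV2 ?posrE ?exprn_gt0 ?ltr0n//.
      by rewrite -natrX ler_nat; exact: ltn_expl.
    rewrite ler_pdivrMr ?ltr0n// [e * _]mulrC -ler_pdivrMr//.
    by apply: le_trans hm _; rewrite ler_nat.
  apply: le_trans hm.
  have [hs _ _ _ _] := xg m.
  have uB' k' : nc (u (i, k') - (x m).1 i k') <= 4 * kappa * (1 / 2) ^+ m.
    apply: le_trans (uB m i k'); rewrite ler_peMr ?nc_ge0// exprn_ege1//.
    by rewrite ler1n.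
  have -> : conjc (u (i, k)) - u (i, - k)
      = conjc (u (i, k) - (x m).1 i k) - (u (i, - k) - (x m).1 i (- k)).
    by rewrite conjc_sub (hs i k); ring.
  by apply: le_trans (ncB _ _) _; rewrite nc_conj; have := uB' k; have := uB' (- k); lra.
- split=> j i; [by case: (xg j)|by case: (xg j) => _ h _ _ _ k; exact: h|].
  move=> z zs; have [_ _ _ _ h] := xg j; apply: le_trans (h i z _) _.
    apply: strip_le zs; rewrite divr_ge0// mulr_ge0// mulr_ge0 ?(ltW (width_gt0 a01))//.
    by apply: le_trans (r4 j).
  rewrite /eps_of ler_expR lerN2 ler_peMl//; apply: le_trans (r4 j); lra.
- by rewrite x0.
- by split=> // j i; apply: hl => j' _.
move=> r r0.
have [J hJ] := level_unbounded (Num.truncn (2 * r + rhostar)).+1.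
have rJ j : (J <= j)%N -> 2 * r <= rho j - rhostar.
  move=> /hJ h; have h1 : 2 * r + rhostar <= (level j)%:R.
    by apply: le_trans (ltW (truncnS_gt _)) _; rewrite ler_nat.
  by rewrite /rho; have := rho0_ge4; move: h1; lra.
(* The polynomial reached at step J contributes the finite constant D1; all later increments decay
   at rate r. *)
pose D1 : R := \sum_i \sum_(k <- box n (scale J)) nc ((x J).1 i k) * expR (r * (freq_norm k)%:R `^ a).
exists (D1 + 4 * kappa) => i k.
have -> : u (i, k) = (u (i, k) - (x J).1 i k) + (x J).1 i k by rewrite subrK.
apply: le_trans (ncD _ _) _; rewrite mulrDl addrC; apply: lerD.
  rewrite expRN ler_pdivlMr ?expR_gt0//.
  case: (leqP (freq_norm k) (scale J)) => kJ; last first.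
    have [_ h _ _ _] := xg J; rewrite h// nc0 mul0r /D1.
    by rewrite sumr_ge0// => i' _; rewrite sumr_ge0// => k' _; rewrite mulr_ge0 ?nc_ge0 ?expR_ge0.
  rewrite /D1 (bigD1 i)//= (bigD1_seq k) ?box_uniq ?mem_box//= -addrA lerDl.
  rewrite addr_ge0// ?sumr_ge0// => i' _; first by rewrite mulr_ge0 ?nc_ge0 ?expR_ge0.
  by rewrite sumr_ge0// => k' _; rewrite mulr_ge0 ?nc_ge0 ?expR_ge0.
apply: le_trans (hu' (i, k) J (kappa * expR (- (r * (freq_norm k)%:R `^ a))) _) _.
  move=> j Jj /=; apply: le_trans (incr j i k r (ltW r0) (rJ j Jj)) _.
  rewrite ler_wpM2r ?exprn_ge0// ler_wpM2r ?expR_ge0// ler_pdivrMr//.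
  by rewrite ler_peMr ?(ltW k0)// exprn_ege1// ler1n.
rewrite /= mulrA; apply: ler_piMr; last first.
  by apply: exprn_ile1 => //; lra.
by rewrite !mulr_ge0 ?expR_ge0 ?(ltW k0).
Qed.

End KamSequence.

(** * Fourier series on the torus *)

Section MaxNorm.
Variable R : realType.

Lemma mx_norm_entry m p (A : 'M[R]_(m, p)) i j : `|A i j| <= `|A|.
Proof.
rewrite [leRHS]mx_normrE.
exact: (@le_bigmax _ _ _ (0 : R) (fun i : 'I_m * 'I_p => `|A i.1 i.2|) (i, j)).
Qed.

Lemma mx_norm_le m p (A : 'M[R]_(m, p)) (b : R) : 0 <= b ->
  (forall i j, `|A i j| <= b) -> `|A| <= b.
Proof. by move=> b0 h; rewrite [leLHS]mx_normrE; apply: bigmax_le => // -[i j] _; exact: h. Qed.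

Lemma mulmx_norm m p q (A : 'M[R]_(m, p)) (B : 'M[R]_(p, q)) :
  `|A *m B| <= p%:R * `|A| * `|B|.
Proof.
apply: mx_norm_le => [|i j]; first by rewrite !mulr_ge0.
rewrite mxE; apply: le_trans (ler_norm_sum _ _ _) _.
apply: le_trans (_ : \sum_(k < p) `|A| * `|B| <= _).
  by apply: ler_sum => k _; rewrite normrM; apply: ler_pM; rewrite ?mx_norm_entry.
by rewrite sumr_const card_ord -mulrA mulr_natl.
Qed.

Lemma freq_dot_norm n (k : 'rV[int]_n) (h : 'rV[R]_n) :
  `|freq_dot k h| <= n%:R * (freq_norm k)%:R * `|h|.
Proof.
apply: le_trans (ler_norm_sum _ _ _) _.
apply: le_trans (_ : \sum_(i < n) (freq_norm k)%:R * `|h| <= _).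
  apply: ler_sum => i _; rewrite normrM; apply: ler_pM; rewrite ?mx_norm_entry//.
  by rewrite -intr_norm -natr_absz ler_nat freq_norm_ge.
by rewrite sumr_const card_ord -[leLHS]mulr_natl mulrA.
Qed.

(** A matrix M of left kernel vectors satisfies M = - M E, so |M| <= |M| / 2. *)
Lemma unitmx_near1 n (E : 'M[R]_n) : n%:R * `|E| <= 1 / 2 -> 1%:M + E \in unitmx.
Proof.
move=> hE; rewrite -row_free_unit -kermx_eq0; set M := kermx _.
have e : M = - (M *m E).
  by apply/eqP; rewrite -addr_eq0 -[X in X + _]mulmx1 -mulmxDr mulmx_ker.
rewrite -normr_le0; have h : `|M| <= n%:R * `|M| * `|E| by rewrite {1}e normrN; exact: mulmx_norm.
have : `|M| * (n%:R * `|E|) <= `|M| * (1 / 2) by rewrite ler_wpM2l.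
rewrite mulrA [`|M| * _]mulrC; lra.
Qed.

End MaxNorm.

(** * Values, increments and derivatives of Fourier series *)

Section Evaluation.
Variables (R : realType) (n : nat).
Local Notation C := R[i].
Implicit Types (k l : 'rV[int]_n) (x h v : 'rV[R]_n) (c d : 'rV[int]_n -> C).

Definition rsum c x N : R := complex.Re (pev N c (toC x)).
Definition fev c x : R := limn (rsum c x).
(** The base 1 + 2 |k| is the side of the box of radius |k|, so that its n-th power counts the
    frequencies of that box and p = n + 2 is summable with an explicit constant. *)
Definition wsup p (A : R) c := forall k, nc (c k) * (1 + 2 * freq_norm k)%N%:R ^+ p <= A.

Lemma fpartial_rsum (f : fourier_series R n) x N : fpartial f x N = rsum f x N.
Proof.
rewrite /fpartial /rsum /pev; congr (complex.Re _).
rewrite (_ : [set k | _] = [set` box n N]); last first.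
  by apply/seteqP; split=> k /=; rewrite mem_box.
rewrite -fsbig_seq ?box_uniq//; apply: eq_bigr => k _.
by rewrite ek_toC.
Qed.

Lemma feval_fev (f : fourier_series R n) x : feval f x = fev f x.
Proof. by rewrite /feval /fev (_ : fpartial f x = rsum f x)//; apply/funext => N; exact: fpartial_rsum. Qed.

Lemma wsup_ge0 p A c : wsup p A c -> 0 <= A.
Proof. by move=> /(_ 0); apply: le_trans; rewrite mulr_ge0 ?nc_ge0. Qed.

Lemma wsup_le p q A c : (p <= q)%N -> wsup q A c -> wsup p A c.
Proof.
move=> pq h k; apply: le_trans (h k); rewrite ler_wpM2l ?nc_ge0//.
by rewrite ler_weXn2l// ler1n.
Qed.

(** The shell |k| = N + 1 has at most (2 N + 3)^n points and contributes at most (2 N + 3)^-2, which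
    is below 1/(N + 1) - 1/(N + 2); the bound 2 - 1/(N + 1) telescopes. *)
Lemma sum_freq_weight N :
  \sum_(k <- box n N) ((1 + 2 * freq_norm k)%N%:R ^+ (n + 2))^-1 <= 2 :> R.
Proof.
apply: le_trans (_ : 2 - N.+1%:R^-1 <= _); last by rewrite gerBl invr_ge0.
elim: N => [|N IH].
  rewrite (_ : box n 0 = [:: 0]).
    by rewrite big_seq1 freq_norm0 muln0 addn0 expr1n invr1; lra.
  have := size_box n 0; rewrite exp1n.
  case E : (box n 0) => [|k [|]]// _; congr [:: _].
  have : k \in box n 0 by rewrite E inE.
  by rewrite mem_box leqn0 freq_norm_eq0 => /eqP.
rewrite (big_box_split _ (leqnSn N)); apply: le_trans (lerD IH (_ : _ <= ((1 + 2 * N.+1)%N%:R ^+ 2)^-1)) _.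
  rewrite big_seq_cond; apply: le_trans (_ : \sum_(k <- box n N.+1) ((1 + 2 * N.+1)%N%:R ^+ (n + 2))^-1 <= _).
    rewrite [leRHS]big_seq [leRHS](bigID (fun k => k \notin box n N))/=.
    apply: ler_wpDr; first by apply: sumr_ge0 => k _; rewrite invr_ge0 exprn_ge0.
    apply: ler_sum => k; rewrite !mem_box -ltnNge => /andP[kN Nk].
    by rewrite (_ : freq_norm k = N.+1)//; apply/eqP; rewrite eqn_leq kN Nk.
  rewrite big_const_seq count_predT iter_addr_0 size_box.
  rewrite (_ : N.+1.*2.+1 = 1 + 2 * N.+1)%N; last by lia.
  have p0 : (1 + 2 * N.+1)%N%:R != 0 :> R by rewrite pnatr_eq0.
  rewrite -[leLHS]mulr_natl natrX exprD invfM mulrA divff ?mul1r// expf_neq0.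
have N0 : 0 < N.+1%:R :> R by rewrite ltr0n.
have -> : (1 + 2 * N.+1)%N%:R = 1 + 2 * N.+1%:R :> R by rewrite natrD natrM.
rewrite -[N.+2%:R]natr1; move: (N.+1%:R : R) N0 => y y0.
suff : ((1 + 2 * y) ^+ 2)^-1 <= y^-1 - (y + 1)^-1 by lra.
have -> : y^-1 - (y + 1)^-1 = (y * (y + 1))^-1.
  by field; rewrite !gt_eqF//; lra.
have yy : 0 < y * (y + 1) by rewrite mulr_gt0//; lra.
by rewrite lef_pV2 ?posrE// ?exprn_gt0//; nra.
Qed.

Lemma wsup_abs_sum A c N : wsup (n + 2) A c -> \sum_(k <- box n N) nc (c k) <= 2 * A.
Proof.
move=> h; have A0 := wsup_ge0 h.
apply: le_trans (_ : \sum_(k <- box n N) A * ((1 + 2 * freq_norm k)%N%:R ^+ (n + 2))^-1 <= _).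
  apply: ler_sum_box => k _; rewrite ler_pdivlMr ?exprn_gt0 ?ltr0n//; exact: h.
by rewrite -mulr_sumr mulrC; apply: ler_wpM2r => //; exact: sum_freq_weight.
Qed.

Lemma nc_character k x : nc (ek k (toC x)) = 1.
Proof.
rewrite nc_cexp cdot_toC /i2pi (_ : complex.Re _ = 0) ?expR0//=.
by rewrite mul0r mulr0 subr0.
Qed.

Lemma rsum_bound A c x N : wsup (n + 2) A c -> `|rsum c x N| <= 2 * A.
Proof.
move=> h; apply: le_trans (nc_Re _) _; apply: le_trans (nc_sum _ _ _) _.
apply: le_trans (wsup_abs_sum N h); apply: eq_ler; apply: eq_bigr => k _.
by rewrite ncM nc_character mulr1.
Qed.

(* Adding the partial sums of the absolute values makes the sequence monotone. *)
Lemma rsum_cvg A c : wsup (n + 2) A c -> forall x, cvgn (rsum c x).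
Proof.
move=> h x; pose S N : R := \sum_(k <- box n N) nc (c k).
have cS : cvgn S.
  apply: nondecreasing_is_cvgn.
    apply/nondecreasing_seqP => N; rewrite /S (big_box_split _ (leqnSn N)) lerDl.
    by apply: sumr_ge0 => k _; exact: nc_ge0.
  by exists (2 * A) => _ [N _ <-]; exact: wsup_abs_sum.
have cT : cvgn (fun N => rsum c x N + S N).
  apply: nondecreasing_is_cvgn.
    apply/nondecreasing_seqP => N; rewrite /S /rsum /pev !(big_box_split _ (leqnSn N)) ReD.
    rewrite addrACA lerDl -lerBlDr sub0r -lerN2 opprK.
    apply: le_trans (ler_norm _) _; rewrite normrN; apply: le_trans (nc_Re _) _.
    apply: le_trans (nc_sum _ _ _) _; apply: eq_ler; apply: eq_bigr => k _.
    by rewrite ncM nc_character mulr1.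
  exists (2 * A + 2 * A) => _ [N _ <-]; apply: lerD; last exact: wsup_abs_sum.
  by apply: le_trans (ler_norm _) _; exact: rsum_bound.
rewrite (_ : rsum c x = (fun N => (rsum c x N + S N) - S N)); last first.
  by apply/funext => N; rewrite addrK.
by apply: is_cvgB.
Qed.

Lemma fev_bound A c x : wsup (n + 2) A c -> `|fev c x| <= 2 * A.
Proof.
move=> h; have cv := @rsum_cvg _ _ h x.
have cn : `|rsum c x N| @[N --> \oo] --> `|fev c x| by apply: cvg_norm.
rewrite -(cvg_lim _ cn)//; apply: limr_le; first by apply/cvg_ex; exists `|fev c x|.
by near=> N; exact: rsum_bound.
Unshelve. all: by end_near. Qed.

Lemma fev_eq c d x : c =1 d -> fev c x = fev d x.
Proof. by move=> /funext ->. Qed.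

Lemma fevD A B c d x : wsup (n + 2) A c -> wsup (n + 2) B d ->
  fev (fun k => c k + d k) x = fev c x + fev d x.
Proof.
move=> hc hd; have cc := @rsum_cvg _ _ hc x; have cd := @rsum_cvg _ _ hd x.
rewrite /fev -limD//; rewrite (_ : rsum (fun k => c k + d k) x = rsum c x + rsum d x)//.
by apply/funext => N; rewrite /rsum pevD ReD.
Qed.

Lemma fevZ (r : R) A c x : wsup (n + 2) A c -> fev (fun k => (r%:C)%C * c k) x = r * fev c x.
Proof.
move=> hc; have cc := @rsum_cvg _ _ hc x.
apply: cvg_lim => //; rewrite (_ : rsum _ x = (fun N => r * rsum c x N)).
  by apply: cvgM => //; exact: cvg_cst.
apply/funext => N.
by rewrite /rsum pevZ; case: (pev _ _ _) => p q /=; rewrite mul0r subr0.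
Qed.

Lemma wsupD p A B c d : wsup p A c -> wsup p B d -> wsup p (A + B) (fun k => c k + d k).
Proof.
move=> hc hd k; apply: le_trans (_ : (nc (c k) + nc (d k)) * (1 + 2 * freq_norm k)%N%:R ^+ p <= _).
  by rewrite ler_wpM2r ?ncD.
by rewrite mulrDl lerD.
Qed.

Lemma wsupZ p (r : C) A c : wsup p A c -> wsup p (nc r * A) (fun k => r * c k).
Proof. by move=> h k; rewrite ncM -[leLHS]mulrA ler_wpM2l ?nc_ge0//; exact: h. Qed.

Lemma wsupN p A c : wsup p A c -> wsup p A (fun k => - c k).
Proof. by move=> h k; rewrite ncN; exact: h. Qed.

Lemma fevB A B c d x : wsup (n + 2) A c -> wsup (n + 2) B d ->
  fev (fun k => c k - d k) x = fev c x - fev d x.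
Proof.
move=> hc hd; rewrite (fevD _ hc (wsupN hd)); congr (_ + _).
rewrite -mulN1r -(fevZ _ _ hd); apply: fev_eq => k.
by rewrite rmorphN1 mulN1r.
Qed.

Lemma fev_supp N c x : (forall k, (N < freq_norm k)%N -> c k = 0) -> fev c x = rsum c x N.
Proof.
move=> h; apply: cvg_lim => //; apply: cvg_near_cst.
by exists N => // M /= NM; rewrite /rsum (pev_widen _ NM).
Qed.

(** Translation multiplies the coefficients, so increments and Taylor remainders are again series,
    estimated through [wsup_mul] and [fev_bound]. *)
Lemma fev_translate c x h : fev c (x + h) = fev (fun k => c k * ek k (toC h)) x.
Proof.
rewrite /fev; congr (limn _); apply/funext => N; rewrite /rsum /pev; congr (complex.Re _).
apply: eq_bigr => k _; rewrite (_ : toC (x + h) = toC x + toC h); last first.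
  by apply/rowP => i; rewrite !mxE rmorphD.
by rewrite ekDr mulrA mulrAC.
Qed.

Lemma wsup_mul p q (b : R) A c (m : 'rV[int]_n -> C) : 0 <= b ->
  (forall k, nc (m k) <= b * (1 + 2 * freq_norm k)%N%:R ^+ q) ->
  wsup (p + q) A c -> wsup p (b * A) (fun k => c k * m k).
Proof.
move=> b0 hm hc k; rewrite ncM.
apply: le_trans (_ : nc (c k) * (b * (1 + 2 * freq_norm k)%N%:R ^+ q)
   * (1 + 2 * freq_norm k)%N%:R ^+ p <= _).
  by rewrite ler_wpM2r// ler_wpM2l ?nc_ge0.
have := ler_wpM2l b0 (hc k); rewrite exprD => h.
by apply: le_trans h; apply: eq_ler; ring.
Qed.

Lemma i2pi_cdot_real k h : i2pi R * cdot k (toC h) = (0 +i* (2 * pi * freq_dot k h))%C.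
Proof. by rewrite cdot_toC /i2pi /GRing.mul /= !mul0r !mulr0 subrr add0r. Qed.

Lemma angle_le k h :
  `|2 * pi * freq_dot k h| <= pi * n%:R * `|h| * (1 + 2 * freq_norm k)%N%:R ^+ 1.
Proof.
have pi0 := @pi_ge0 R.
rewrite expr1 normrM ger0_norm; last exact: mulr_ge0 (ler0n _ _) pi0.
apply: le_trans (ler_wpM2l (mulr_ge0 (ler0n _ 2) pi0) (freq_dot_norm k h)) _.
have -> : 2 * pi * (n%:R * (freq_norm k)%:R * `|h|)
   = pi * n%:R * `|h| * (2 * (freq_norm k)%:R) by ring.
apply: ler_wpM2l; first by apply: mulr_ge0 => //; exact: mulr_ge0.
by rewrite natrD natrM lerDr.
Qed.

(** In a full series k.h is unbounded, so the estimate has to hold for every real t; for |t| > 2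
    boundedness of the cosine gives it. *)
Lemma cexp_imag_taylor1 (t : R) : nc (cexp (0 +i* t)%C - 1) <= 2 * `|t|.
Proof.
apply: le_trans (nc_le_ReIm _) _.
rewrite /cexp /= expR0 !mul1r oppr0 addr0.
have h1 := sin_le_norm t.
have h2 : `|cos t - 1| <= `|t|.
  have [t2|t2] := leP `|t| 2.
    apply: le_trans (cos_taylor2 t) _; rewrite -real_normK ?num_real// expr2.
    have : `|t| * `|t| <= 2 * `|t| by rewrite ler_wpM2r.
    lra.
  apply: le_trans (ler_normB _ _) _; rewrite normr1; have := cos_max t; lra.
lra.
Qed.

Lemma cexp_imag_taylor2 (t : R) :
  nc (cexp (0 +i* t)%C - 1 - (0 +i* t)%C) <= 3 * `|t| ^+ 2.
Proof.
apply: le_trans (nc_le_ReIm _) _.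
rewrite /cexp /= expR0 !mul1r oppr0 !addr0.
have h1 := cos_taylor2 t; rewrite -[t ^+ 2]real_normK ?num_real// in h1.
have h2 : `|sin t - t| <= 2 * `|t| ^+ 2.
  have [t1|t1] := leP `|t| 1.
    apply: le_trans (sin_taylor2 t1) _; rewrite -real_normK ?num_real//.
    have := sqr_ge0 `|t|; lra.
  apply: le_trans (ler_normB _ _) _; have := sin_le_norm t.
  have : `|t| * 1 <= `|t| * `|t| by rewrite ler_wpM2l// ltW.
  rewrite expr2; lra.
have := sqr_ge0 `|t|; lra.
Qed.

Lemma wsup_dcoef p A c h : wsup (p + 1) A c -> wsup p (pi * n%:R * `|h| * A) (dcoef (toC h) c).
Proof.
move=> hc; have := @wsup_mul p 1 (pi * n%:R * `|h|) A c (fun k => i2pi R * cdot k (toC h)).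
move=> H k; rewrite /dcoef [_ * c k]mulrC; apply: H => //.
  by rewrite !mulr_ge0 ?pi_ge0.
by move=> l; rewrite nc_i2pi_omega angle_le.
Qed.

Lemma fev_lip A c x h : wsup (n + 3) A c ->
  `|fev c (x + h) - fev c x| <= 4 * pi * n%:R * A * `|h|.
Proof.
move=> hc; have hc2 : wsup (n + 2) A c by apply: wsup_le hc; lia.
have b0 : 0 <= 2 * (pi * n%:R * `|h|) by rewrite !mulr_ge0 ?pi_ge0.
have hm k : nc (ek k (toC h) - 1) <= 2 * (pi * n%:R * `|h|) * (1 + 2 * freq_norm k)%N%:R ^+ 1.
  rewrite /ek i2pi_cdot_real; apply: le_trans (cexp_imag_taylor1 _) _.
  by rewrite -[leRHS]mulrA ler_wpM2l// angle_le.
rewrite addnS -[(n + 2).+1]addn1 in hc; have hd := wsup_mul b0 hm hc.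
have e : fev c (x + h) = fev (fun k => c k + c k * (ek k (toC h) - 1)) x.
  by rewrite fev_translate; apply: fev_eq => k; rewrite mulrBr mulr1 addrC subrK.
rewrite e (fevD x hc2 hd) addrAC subrr add0r.
by apply: le_trans (fev_bound x hd) _; apply: eq_ler; ring.
Qed.

Lemma fev_taylor A c x h : wsup (n + 4) A c ->
  `|fev c (x + h) - fev c x - fev (dcoef (toC h) c) x| <= 6 * (pi * n%:R) ^+ 2 * A * `|h| ^+ 2.
Proof.
move=> hc; have hc2 : wsup (n + 2) A c by apply: wsup_le hc; lia.
have hc3 : wsup (n + 2 + 1) A c by apply: wsup_le hc; lia.
have b0 : 0 <= 3 * (pi * n%:R * `|h|) ^+ 2 by apply: mulr_ge0 => //; exact: sqr_ge0.
have hm k : nc (ek k (toC h) - 1 - i2pi R * cdot k (toC h))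
    <= 3 * (pi * n%:R * `|h|) ^+ 2 * (1 + 2 * freq_norm k)%N%:R ^+ 2.
  rewrite /ek i2pi_cdot_real; apply: le_trans (cexp_imag_taylor2 _) _.
  rewrite -[leRHS]mulrA ler_wpM2l// -exprMn lerXn2r ?nnegrE ?normr_ge0//.
    by rewrite !mulr_ge0 ?pi_ge0.
  by have := angle_le k h; rewrite expr1.
have hc4 : wsup (n + 2 + 2) A c by apply: wsup_le hc; lia.
have hd := wsup_mul b0 hm hc4; have hdc := @wsup_dcoef _ _ _ h hc3.
have e : fev c (x + h) = fev (fun k => c k + (dcoef (toC h) c k
     + c k * (ek k (toC h) - 1 - i2pi R * cdot k (toC h)))) x.
  by rewrite fev_translate; apply: fev_eq => k; rewrite /dcoef; ring.
rewrite e (fevD x hc2 (wsupD hdc hd)) (fevD x hdc hd).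
rewrite (_ : forall u v w : R, u + (v + w) - u - v = w); last by move=> *; ring.
by apply: le_trans (fev_bound x hd) _; apply: eq_ler; ring.
Qed.

Lemma fev_dcoef_lin A c x (r : R) h v : wsup (n + 3) A c ->
  fev (dcoef (toC (r *: h + v)) c) x = r * fev (dcoef (toC h) c) x + fev (dcoef (toC v) c) x.
Proof.
rewrite addnS -[(n + 2).+1]addn1 => hc.
have h1 := @wsup_dcoef _ _ _ h hc; have h2 := @wsup_dcoef _ _ _ v hc.
rewrite -(fevZ _ _ h1) -(fevD _ (wsupZ _ h1) h2); apply: fev_eq => k.
rewrite /dcoef; have -> : toC (r *: h + v) = (r%:C)%C *: toC h + toC v.
  by apply/rowP => i; rewrite !mxE rmorphD rmorphM.
by rewrite cdotDr cdotZr; ring.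
Qed.

Lemma fev_period c x (m : 'rV[int]_n) : fev c (x + map_mx (fun z : int => z%:~R) m) = fev c x.
Proof.
rewrite fev_translate; apply: fev_eq => k.
rewrite (_ : ek _ _ = 1) ?mulr1//.
rewrite /ek cdot_toC (_ : freq_dot k _ = (\sum_i k 0 i * m 0 i)%:~R).
  rewrite (_ : (_%:C)%C = (\sum_i k 0 i * m 0 i)%:~R) ?cexp_i2pi_int//.
  by rewrite -intC.
rewrite rmorph_sum; apply: eq_bigr => i _.
by rewrite mxE rmorphM.
Qed.

End Evaluation.

(** * Diffeomorphisms close to the identity *)

Section QuadraticRemainder.
Variable R : realType.

(** Differentiability is always obtained from an explicit quadratic bound on the remainder, a form
    that passes through sums, products, compositions and inverses. *)
Lemma quad_differentiable (V W : normedModType R) (f : V -> W) (L : {linear V -> W}) x (K : R) :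
  continuous L -> (forall h, `|f (x + h) - f x - L h| <= K * `|h| ^+ 2) ->
  differentiable f x /\ forall v, 'd f x v = L v.
Proof.
move=> Lc hf; have K0 : 0 < `|K| + 1 by rewrite ltr_wpDl.
have hx : f \o shift x = cst (f x) + L +o_ 0 id.
  apply/eqaddoP => e e0; near=> h.
  rewrite [X in `|X|](_ : _ = f (x + h) - f x - L h); last first.
    by rewrite !fctE /= [h + x]addrC opprD addrA.
  apply: le_trans (hf h) _; rewrite expr2 mulrA ler_wpM2r//.
  apply: le_trans (_ : (`|K| + 1) * `|h| <= _).
    by rewrite ler_wpM2r//; apply: le_trans (ler_norm _) _; rewrite lerDl.
  rewrite mulrC -ler_pdivlMr//.
  near: h; apply: nbhs0_le; rewrite divr_gt0//.
have hd : differentiable f x.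
  apply/diffP => /=.
  apply: (@getPex _ (fun (df : {linear V -> W}) => continuous df /\
    forall y, f y = f (lim (nbhs x)) + df (y - lim (nbhs x))
                  +o_(y \near x) (y - lim (nbhs x)))).
  exists L; split=> //.
  have dxf h : f (h + x) = f x + L h +o_(h \near 0) h by move: hx; rewrite funeqE; apply.
  apply: eqaddoEx => y; rewrite lim_id// -[in LHS](subrK x y) dxf; congr (_ + _).
  rewrite -(comp_centerK x id) -[X in the_littleo _ _ _ X](comp_centerK x).
  by rewrite -[_ (y - x)]/((_ \o (center x)) y) -littleo_center0.
by split=> // v; rewrite (diff_unique Lc hx).
Unshelve. all: by end_near. Qed.

Lemma mulmxr_continuous m p (M : 'M[R]_(m, p)) :
  continuous (mulmxr M : {linear 'rV[R]_m -> 'rV[R]_p}).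
Proof.
apply: bounded_linear_continuous; apply/bounded_funP => r; exists (m%:R * r * `|M|) => x xr.
apply: le_trans (mulmx_norm _ _) _; rewrite ler_wpM2r// ler_wpM2l//.
Qed.

Lemma quad_diff_mx m p (f : 'rV[R]_m -> 'rV[R]_p) (M : 'M[R]_(m, p)) (x : 'rV[R]_m) (K : R) :
  (forall h, `|f (x + h) - f x - h *m M| <= K * `|h| ^+ 2) ->
  differentiable f x /\ forall v, 'd f x v = v *m M.
Proof. by move=> hf; exact: (quad_differentiable (@mulmxr_continuous m p M) hf). Qed.

Lemma quad_jacobian m p (f : 'rV[R]_m -> 'rV[R]_p) (M : 'M[R]_(m, p)) (x : 'rV[R]_m) (K : R) :
  (forall h, `|f (x + h) - f x - h *m M| <= K * `|h| ^+ 2) -> 'J f x = M.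
Proof.
move=> hf; have [_ h] := quad_diff_mx hf.
by apply/row_matrixP => i; rewrite !rowE mul_rV_lin1 h.
Qed.

End QuadraticRemainder.

(** * Rapidly decaying series are smooth *)

Section RapidSeries.
Variables (R : realType) (n : nat).
Local Notation C := R[i].
Implicit Types (k l : 'rV[int]_n) (x y h v w : 'rV[R]_n) (c d : 'rV[int]_n -> C).

(** Smoothness is read off this decay: it is stable under [dcoef], and the series of the statement
    have it ([decay_rapid]). *)
Definition rapid c := forall p, exists A : R, wsup p A c.

Lemma rapid_dcoef v c : rapid c -> rapid (dcoef (toC v) c).
Proof. by move=> rc p; have [A hA] := rc (p + 1)%N; eexists; exact: wsup_dcoef. Qed.

Lemma fev_dcoef_sum c x h : rapid c ->
  fev (dcoef (toC h) c) x = \sum_j h 0 j * fev (dcoef (toC (delta_mx 0 j)) c) x.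
Proof.
move=> rc; have [A hA] := rc (n + 3)%N.
have hlin (s : seq 'I_n) : fev (dcoef (toC (\sum_(j <- s) h 0 j *: delta_mx 0 j)) c) x
    = \sum_(j <- s) h 0 j * fev (dcoef (toC (delta_mx 0 j)) c) x.
  elim: s => [|j s IH]; last by rewrite !big_cons (fev_dcoef_lin _ _ _ _ hA) IH.
  rewrite !big_nil; have := fev_dcoef_lin x (-1) 0 0 hA; rewrite scaler0 add0r.
  by rewrite mulN1r addNr.
by rewrite -hlin -row_sum_delta.
Qed.

Lemma rapid_bounds c : rapid c -> exists K : R, [/\ 0 <= K,
   forall x, `|fev c x| <= K,
   forall x h, `|fev c (x + h) - fev c x| <= K * `|h|,
   forall x h, `|fev c (x + h) - fev c x - fev (dcoef (toC h) c) x| <= K * `|h| ^+ 2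
 & forall x h, `|fev (dcoef (toC h) c) x| <= K * `|h| ].
Proof.
move=> rc; have [A hA] := rc (n + 4)%N; have A0 := wsup_ge0 hA.
have pn : 0 <= pi * n%:R :> R by rewrite mulr_ge0 ?pi_ge0.
have h3 : wsup (n + 3) A c by apply: wsup_le hA; lia.
have h2 : wsup (n + 2) A c by apply: wsup_le hA; lia.
have h3' : wsup (n + 2 + 1) A c by apply: wsup_le hA; lia.
exists (2 * A + 4 * pi * n%:R * A + 6 * (pi * n%:R) ^+ 2 * A).
have a1 : 0 <= 4 * pi * n%:R * A by rewrite -[4 * pi * _]mulrA; do 2 apply: mulr_ge0 => //.
have a2 : 0 <= 6 * (pi * n%:R) ^+ 2 * A by rewrite mulr_ge0// mulr_ge0 ?sqr_ge0.
split; first by lra.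
- by move=> x; apply: le_trans (fev_bound x h2) _; lra.
- move=> x h; apply: le_trans (fev_lip x h h3) _; rewrite ler_wpM2r//; lra.
- move=> x h; apply: le_trans (fev_taylor x h hA) _; rewrite ler_wpM2r ?sqr_ge0//; lra.
- move=> x h; have h4 := @wsup_dcoef R n (n + 2) A c h h3'.
  apply: le_trans (fev_bound x h4) _.
  have -> : 2 * (pi * n%:R * `|h| * A) = 2 * (pi * n%:R * A) * `|h| by ring.
  by rewrite ler_wpM2r//; lra.
Qed.

Lemma rapid_bounds_fam (I : finType) (c : I -> 'rV[int]_n -> C) : (forall i, rapid (c i)) ->
  exists K : R, [/\ 0 <= K,
   forall i x, `|fev (c i) x| <= K,
   forall i x h, `|fev (c i) (x + h) - fev (c i) x| <= K * `|h|,
   forall i x h, `|fev (c i) (x + h) - fev (c i) x - fev (dcoef (toC h) (c i)) x| <= K * `|h| ^+ 2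
 & forall i x h, `|fev (dcoef (toC h) (c i)) x| <= K * `|h| ].
Proof.
move=> rc; have [K hK] := choice (fun i => rapid_bounds (rc i)).
have le i : K i <= \sum_j K j.
  rewrite (bigD1 i)//= lerDl sumr_ge0// => j _; by have [] := hK j.
exists (\sum_j K j); split.
- by apply: sumr_ge0 => j _; have [] := hK j.
- by move=> i x; apply: le_trans (le i); have [_ h _ _ _] := hK i.
- by move=> i x h; have [_ _ H _ _] := hK i; apply: le_trans (H x h) _; rewrite ler_wpM2r.
- by move=> i x h; have [_ _ _ H _] := hK i; apply: le_trans (H x h) _; rewrite ler_wpM2r ?sqr_ge0.
- by move=> i x h; have [_ _ _ _ H] := hK i; apply: le_trans (H x h) _; rewrite ler_wpM2r.
Qed.

(* For row vectors: the derivative in the direction h is [h *m vjac u x]. *)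
Definition vev (u : 'I_n -> 'rV[int]_n -> C) x : 'rV[R]_n := \row_i fev (u i) x.
Definition vjac (u : 'I_n -> 'rV[int]_n -> C) x : 'M[R]_n :=
  \matrix_(j, i) fev (dcoef (toC (delta_mx 0 j)) (u i)) x.

Lemma vjacE u x h : (forall i, rapid (u i)) ->
  h *m vjac u x = vev (fun i => dcoef (toC h) (u i)) x.
Proof.
move=> ru; apply/rowP => i; rewrite !mxE fev_dcoef_sum//.
by apply: eq_bigr => j _; rewrite mxE.
Qed.

Lemma vev_quad u : (forall i, rapid (u i)) -> exists2 K : R, 0 <= K &
  forall x h, `|vev u (x + h) - vev u x - h *m vjac u x| <= K * `|h| ^+ 2.
Proof.
move=> ru; have [K [K0 _ _ hK _]] := rapid_bounds_fam ru; exists K => // x h.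
rewrite vjacE//; apply: mx_norm_le => [|i j]; first by rewrite mulr_ge0 ?sqr_ge0.
by rewrite !mxE; exact: hK.
Qed.

Lemma affine_vev_quad (r : R) w u : (forall i, rapid (u i)) -> exists2 K : R, 0 <= K &
  forall x h, `|(r *: (x + h) + w + vev u (x + h)) - (r *: x + w + vev u x)
     - h *m (r%:M + vjac u x)| <= K * `|h| ^+ 2.
Proof.
move=> ru; have [K K0 hK] := vev_quad ru; exists K => // x h.
apply: le_trans (hK x h); apply: eq_ler; congr `|_|.
rewrite mulmxDr mul_mx_scalar scalerDr; apply/rowP => i; rewrite !mxE; ring.
Qed.

(** The affine part closes the induction: the derivative in the direction v has the same form, with
    linear part 0, constant r v and differentiated coefficients. *)
Lemma class_C_affine_vev (k : nat) (r : R) w u : (forall i, rapid (u i)) ->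
  class_C k (fun x => r *: x + w + vev u x).
Proof.
elim: k r w u => [|k IH] r w u ru; have [K K0 hK] := affine_vev_quad r w ru;
  have hd x := @quad_diff_mx R n n (fun x => r *: x + w + vev u x) _ x K (hK x).
  by move=> x; apply: (@differentiable_continuous _ _ _ x); have [] := hd x.
split=> [x|v]; first by have [] := hd x.
have := IH 0 (r *: v) (fun i => dcoef (toC v) (u i)) (fun i => rapid_dcoef v (ru i)).
rewrite (_ : (fun x => 0 *: x + _ + _) = (fun x => 'd (fun x => r *: x + w + vev u x) x v))//.
apply/funext => x; have [_ ->] := hd x.
by rewrite mulmxDr mul_mx_scalar vjacE// scale0r add0r.
Qed.

End RapidSeries.

(** * Maps near the identity: bijectivity and invertible Jacobian *)

Section InverseMap.
Variables (R : realType) (n : nat).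
Local Notation C := R[i].
Implicit Types (k l : 'rV[int]_n) (x y h v w : 'rV[R]_n) (c d : 'rV[int]_n -> C).

Variables (u : 'I_n -> 'rV[int]_n -> C) (A : R).
Hypothesis ur : forall i, rapid (u i).
Hypothesis uA : forall i, wsup (n + 3) A (u i).
Hypothesis A1 : 4 * pi * n%:R * A <= 1 / 2.
Hypothesis nA : n%:R * (4 * pi * n%:R * A) <= 1 / 2.

Let theta : R := 4 * pi * n%:R * A.
Definition near_id x := x + vev u x.

Lemma A_ge0 (i : 'I_n) : 0 <= A. Proof. exact: wsup_ge0 (uA i). Qed.

Lemma theta_ge0 (i : 'I_n) : 0 <= theta.
Proof. by rewrite /theta mulr_ge0 ?(A_ge0 i)// mulr_ge0// mulr_ge0 ?pi_ge0. Qed.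

Lemma vev_lip x h : `|vev u (x + h) - vev u x| <= 1 / 2 * `|h|.
Proof.
apply: mx_norm_le => [|i j]; first by rewrite mulr_ge0.
rewrite !mxE; apply: le_trans (fev_lip x h (uA j)) _.
by rewrite ler_wpM2r.
Qed.

Lemma vjac_entry x (i j : 'I_n) : `|vjac u x i j| <= theta.
Proof.
have h3' : wsup (n + 2 + 1) A (u j) by apply: wsup_le (uA j); lia.
have A0 := A_ge0 i; have pn : 0 <= pi * n%:R * A by rewrite !mulr_ge0 ?pi_ge0.
rewrite mxE; have h4 := @wsup_dcoef R n (n + 2) A (u j) (delta_mx 0 i) h3'.
apply: le_trans (fev_bound x h4) _.
have d1 : `|delta_mx 0 i : 'rV[R]_n| <= 1.
  by apply: mx_norm_le => // a b; rewrite mxE; case: (_ && _); rewrite ?normr1 ?normr0.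
have : pi * n%:R * A * `|delta_mx 0 i : 'rV[R]_n| <= pi * n%:R * A * 1.
  by rewrite ler_wpM2l.
rewrite /theta; lra.
Qed.

Lemma vjac_norm x : n%:R * `|vjac u x| <= 1 / 2.
Proof.
have [n0|n_gt0] := posnP n; first by rewrite [X in X%:R * _]n0 mul0r.
apply: le_trans nA; rewrite ler_wpM2l//.
by apply: mx_norm_le => [|i j]; [exact: (theta_ge0 (Ordinal n_gt0))|exact: vjac_entry].
Qed.

Lemma vjac_mul m (M : 'M[R]_(m, n)) x : `|M *m vjac u x| <= 1 / 2 * `|M|.
Proof.
by apply: le_trans (mulmx_norm _ _) _; rewrite mulrAC ler_wpM2r// vjac_norm.
Qed.

Definition jac x : 'M[R]_n := 1%:M + vjac u x.

Lemma near_id_quad : exists2 K : R, 0 <= K &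
  forall x h, `|near_id (x + h) - near_id x - h *m jac x| <= K * `|h| ^+ 2.
Proof.
have [K K0 hK] := affine_vev_quad 1 0 ur; exists K => // x h.
by have := hK x h; rewrite !scale1r !addr0.
Qed.

Lemma smooth_near_id : smooth near_id.
Proof.
move=> k; have := class_C_affine_vev k 1 0 ur.
rewrite (_ : (fun x => _) = near_id)//.
by apply/funext => x; rewrite scale1r addr0.
Qed.

Lemma jacobian_near_id x : 'J near_id x = jac x.
Proof. by have [K K0 hK] := near_id_quad; exact: quad_jacobian (hK x). Qed.

Lemma near_id_expand x y : `|x - y| <= 2 * `|near_id x - near_id y|.
Proof.
have h1 := vev_lip y (x - y); rewrite [y + _]addrC subrK in h1.
have -> : near_id x - near_id y = (x - y) - - (vev u x - vev u y).
  by rewrite /near_id opprK opprD addrACA.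
have := lerB_dist (x - y) (- (vev u x - vev u y)); rewrite normrN; lra.
Qed.

Lemma near_id_inj : injective near_id.
Proof.
move=> x y e; apply/eqP; rewrite -subr_eq0 -normr_le0.
by apply: le_trans (near_id_expand x y) _; rewrite e subrr normr0 mulr0.
Qed.

(** Fixed point of the contraction x |-> y - u(x), whose iterates converge coordinatewise by
    [geo_limit]. *)
Lemma near_id_surj y : exists x, near_id x = y.
Proof.
have [X XS] : exists X : nat -> 'rV[R]_n, forall m, X m.+1 = y - vev u (X m).
  by exists (fun m => iter m (fun x => y - vev u x) 0).
have incr m : `|X m.+1 - X m| <= `|X 1%N - X 0%N| * (1 / 2) ^+ m.
  elim: m => [|m IH]; first by rewrite expr0 mulr1.
  have -> : X m.+2 - X m.+1 = - (vev u (X m.+1) - vev u (X m)).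
    by rewrite XS XS opprB opprB addrC addrA subrK.
  rewrite normrN; have := vev_lip (X m) (X m.+1 - X m); rewrite [X m + _]addrC subrK => h.
  by apply: le_trans h _; rewrite exprS; lra.
have incri m i : `|(X m.+1) 0 i - (X m) 0 i| <= `|X 1%N - X 0%N| * (1 / 2) ^+ m.
  apply: le_trans (incr m); rewrite (_ : _ - _ = (X m.+1 - X m) 0 i) ?mx_norm_entry//.
  by rewrite !mxE.
have [l hl] := choice (fun i => geo_limit (fun m => incri m i)).
pose x : 'rV[R]_n := \row_i l i.
have xX m : `|x - X m| <= 2 * `|X 1%N - X 0%N| * (1 / 2) ^+ m.
  apply: mx_norm_le => [|a i]; first by rewrite !mulr_ge0 ?exprn_ge0.
  by rewrite !mxE (ord1 a); apply: hl => m' _; exact: incri.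
exists x; apply/eqP; rewrite -subr_eq0 -normr_le0; apply/ler_addgt0Pl => e e0; rewrite addr0.
have [m hm] := half_pow_le (3 * `|X 1%N - X 0%N|) e0.
apply: le_trans hm.
have -> : near_id x - y = (vev u x - vev u (X m)) + (x - X m.+1).
  by rewrite XS /near_id; apply/rowP => i; rewrite !mxE; ring.
apply: le_trans (ler_normD _ _) _.
have h1 := vev_lip (X m) (x - X m); rewrite [X m + _]addrC subrK in h1.
have h2 := xX m; have h3 := xX m.+1; rewrite exprS in h3.
have : 0 <= `|X 1%N - X 0%N| * (1 / 2) ^+ m by rewrite mulr_ge0 ?exprn_ge0.
lra.
Qed.

Lemma jac_unit x : jac x \in unitmx.
Proof. exact: unitmx_near1 (vjac_norm x). Qed.

(** The inverse S of I + Du satisfies S = I - S Du, so |S| <= 1 + |S| / 2. *)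
Lemma invjac_norm x : `|invmx (jac x)| <= 2.
Proof.
have e : invmx (jac x) = 1%:M - invmx (jac x) *m vjac u x.
  by rewrite -(mulVmx (jac_unit x)) {2}/jac mulmxDr mulmx1 addrK.
have h1 : `|1%:M : 'M[R]_n| <= 1.
  by apply: mx_norm_le => // i j; rewrite mxE; case: (_ == _); rewrite ?normr1 ?normr0.
have := vjac_mul (invmx (jac x)) x.
have : `|invmx (jac x)| <= `|1%:M : 'M[R]_n| + `|invmx (jac x) *m vjac u x|.
  by rewrite {1}e; exact: ler_normB.
lra.
Qed.

End InverseMap.

(** * Smoothness of the inverse map *)

Section InverseSmooth.
Variables (R : realType) (n : nat).
Local Notation C := R[i].
Implicit Types (x y h v w : 'rV[R]_n) (c : 'rV[int]_n -> C).

Variables (u : 'I_n -> 'rV[int]_n -> C) (A : R).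
Hypothesis ur : forall i, rapid (u i).
Hypothesis uA : forall i, wsup (n + 3) A (u i).
Hypothesis A1 : 4 * pi * n%:R * A <= 1 / 2.
Hypothesis nA : n%:R * (4 * pi * n%:R * A) <= 1 / 2.
Variable Psi : 'rV[R]_n -> 'rV[R]_n.
Hypothesis PsiK : forall y, near_id u (Psi y) = y.

Let N y := invmx (jac u (Psi y)).

Lemma N_norm y : `|N y| <= 2. Proof. exact: (invjac_norm uA A1 nA). Qed.

Lemma Psi_lip y h : `|Psi (y + h) - Psi y| <= 2 * `|h|.
Proof.
apply: le_trans (near_id_expand uA A1 _ _) _.
by rewrite !PsiK addrC addKr.
Qed.

Lemma sqr_lip (r s K : R) : 0 <= r -> r <= K * s -> r ^+ 2 <= K ^+ 2 * s ^+ 2.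
Proof. by move=> r0 rs; rewrite -exprMn lerXn2r ?nnegrE//; apply: le_trans rs. Qed.

(** With d = Psi(y + h) - Psi(y), the vector h is the increment of id + u for the displacement d.
    The remainder is therefore (d J - h) N, the quadratic remainder of id + u multiplied by the
    inverse Jacobian. *)
Lemma Psi_quad : exists2 K : R, 0 <= K &
  forall y h, `|Psi (y + h) - Psi y - h *m N y| <= K * `|h| ^+ 2.
Proof.
have [K K0 hK] := near_id_quad ur.
exists (n%:R * (K * 4) * 2) => [|y h]; first by rewrite !mulr_ge0.
pose d := Psi (y + h) - Psi y.
have -> : Psi (y + h) - Psi y - h *m N y = (d *m jac u (Psi y) - h) *m N y.
  by rewrite mulmxBl -mulmxA /N mulmxV ?mulmx1// (jac_unit uA A1 nA).
apply: le_trans (mulmx_norm _ _) _; rewrite [leRHS]mulrAC.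
apply: ler_pM; rewrite ?N_norm ?mulr_ge0// -mulrA ler_wpM2l//.
have := hK (Psi y) d; rewrite {1}/d [Psi y + _]addrC subrK !PsiK [y + h]addrC addrK.
rewrite -normrN opprB => h1; apply: le_trans h1 _; rewrite -mulrA ler_wpM2l//.
have := sqr_lip (normr_ge0 _) (Psi_lip y h).
by rewrite -/d (_ : 2 ^+ 2 = 4 :> R) //; ring.
Qed.

(* Closed under partial derivatives, by [pulled_grad]; this gives smoothness of [Psi] without
   differentiating the inverse of a matrix repeatedly. *)
Inductive pulled : ('rV[R]_n -> R) -> Prop :=
| pulled_fev c : rapid c -> pulled (fun y => fev c (Psi y))
| pulled_inv i j : pulled (fun y => N y i j)
| pulled_cst (r : R) : pulled (fun=> r)
| pulledD f g : pulled f -> pulled g -> pulled (fun y => f y + g y)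
| pulledM f g : pulled f -> pulled g -> pulled (fun y => f y * g y).

Lemma pulled_sum (I : Type) (s : seq I) (f : I -> 'rV[R]_n -> R) :
  (forall i, pulled (f i)) -> pulled (fun y => \sum_(i <- s) f i y).
Proof.
move=> hf; elim: s => [|i s IH].
  rewrite (_ : (fun=> _) = fun=> 0); first exact: pulled_cst.
  by apply/funext => y; rewrite big_nil.
rewrite (_ : (fun=> _) = fun y => f i y + \sum_(j <- s) f j y); first exact: pulledD.
by apply/funext => y; rewrite big_cons.
Qed.

Lemma pulledN f : pulled f -> pulled (fun y => - f y).
Proof.
move=> hf; rewrite (_ : (fun=> _) = fun y => -1 * f y).
  by apply: pulledM => //; exact: pulled_cst.
by apply/funext => y; rewrite mulN1r.
Qed.

(** Bound, Lipschitz estimate and quadratic remainder with one constant for all y: the three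
    together are stable under products. *)
Definition has_grad (f : 'rV[R]_n -> R) (G : 'I_n -> 'rV[R]_n -> R) :=
  exists K : R, forall y h,
  [/\ `|f y| <= K, `|f (y + h) - f y| <= K * `|h|
    & `|f (y + h) - f y - \sum_j h 0 j * G j y| <= K * `|h| ^+ 2].

Lemma grad_fev c : rapid c ->
  has_grad (fun y => fev c (Psi y))
    (fun j y => \sum_i N y j i * fev (dcoef (toC (delta_mx 0 i)) c) (Psi y)).
Proof.
move=> rc; have [K [K0 h1 h2 h3 h4]] := rapid_bounds rc.
have [L L0 hL] := Psi_quad.
exists (K * (1 + 2 + 4 + L)) => y h.
have hK (r : R) : 0 <= r -> 0 <= K * r by exact: mulr_ge0.
pose d := Psi (y + h) - Psi y.
have Pd : Psi (y + h) = Psi y + d by rewrite [RHS]addrC subrK.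
have hd : `|d| <= 2 * `|h| := Psi_lip y h.
split.
- by apply: le_trans (h1 _) _; rewrite ler_peMr//; lra.
- rewrite Pd; apply: le_trans (h2 _ _) _; rewrite -mulrA ler_wpM2l//.
  apply: le_trans hd _; rewrite ler_wpM2r//; lra.
rewrite (_ : \sum_j _ = fev (dcoef (toC (h *m N y)) c) (Psi y)); last first.
  rewrite (fev_dcoef_sum _ _ rc); under eq_bigr do rewrite mulr_sumr.
  rewrite exchange_big; apply: eq_bigr => i _; rewrite mxE mulr_suml.
  by apply: eq_bigr => j _; rewrite mulrA.
have e : fev (dcoef (toC d) c) (Psi y) - fev (dcoef (toC (h *m N y)) c) (Psi y)
    = fev (dcoef (toC (d - h *m N y)) c) (Psi y).
  have [B hB] := rc (n + 3)%N.
  have -> : d - h *m N y = (-1) *: (h *m N y) + d by rewrite scaleN1r addrC.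
  by rewrite (fev_dcoef_lin _ _ _ _ hB) mulN1r addrC.
rewrite Pd (_ : _ - _ - _ = (fev c (Psi y + d) - fev c (Psi y) - fev (dcoef (toC d) c) (Psi y))
   + fev (dcoef (toC (d - h *m N y)) c) (Psi y)); last by rewrite -e; ring.
apply: le_trans (ler_normD _ _) _; apply: le_trans (lerD (h3 _ _) (h4 _ _)) _.
rewrite -mulrDr -mulrA ler_wpM2l//.
apply: le_trans (lerD (sqr_lip (normr_ge0 _) hd) (hL y h)) _.
by rewrite -mulrDl ler_wpM2r ?sqr_ge0//; lra.
Qed.

Lemma grad_cst r : has_grad (fun=> r) (fun _ _ => 0).
Proof.
exists `|r| => y h; rewrite subrr normr0 big1 ?subrr ?normr0; last by move=> j _; rewrite mulr0.
by split=> //; rewrite !mulr_ge0 ?sqr_ge0.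
Qed.

Lemma gradD f g F G : has_grad f F -> has_grad g G ->
  has_grad (fun y => f y + g y) (fun j y => F j y + G j y).
Proof.
move=> [K hK] [L hL]; exists (K + L) => y h.
have [a1 a2 a3] := hK y h; have [b1 b2 b3] := hL y h.
rewrite [_ + _ - (_ + _)](_ : _ = (f (y + h) - f y) + (g (y + h) - g y)); last by ring.
split.
- by apply: le_trans (ler_normD _ _) _; exact: lerD.
- by rewrite mulrDl; apply: le_trans (ler_normD _ _) _; exact: lerD.
under eq_bigr do rewrite mulrDr.
rewrite big_split /= opprD addrACA mulrDl.
by apply: le_trans (ler_normD _ _) _; exact: lerD.
Qed.

Lemma gradM f g F G : has_grad f F -> has_grad g G ->
  has_grad (fun y => f y * g y) (fun j y => f y * G j y + g y * F j y).
Proof.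
move=> [K hK] [L hL]; exists (3 * (K * L)) => y h.
have [a1 a2 a3] := hK y h; have [b1 b2 b3] := hL y h.
have [a1' _ _] := hK (y + h) 0.
have K0 : 0 <= K by exact: le_trans a1.
have L0 : 0 <= L by exact: le_trans b1.
have KL : 0 <= K * L by exact: mulr_ge0.
have h0 := normr_ge0 h.
have KLh : 0 <= K * L * `|h| by exact: mulr_ge0.
have KLh2 : 0 <= K * L * `|h| ^+ 2 by rewrite mulr_ge0 ?sqr_ge0.
split.
- by rewrite normrM; have := ler_pM (normr_ge0 _) (normr_ge0 _) a1 b1; lra.
- rewrite (_ : _ - _ = f (y + h) * (g (y + h) - g y) + g y * (f (y + h) - f y)); last by ring.
  apply: le_trans (ler_normD _ _) _; rewrite !normrM.
  have := ler_pM (normr_ge0 _) (normr_ge0 _) a1' b2.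
  have := ler_pM (normr_ge0 _) (normr_ge0 _) b1 a2; lra.
have -> : \sum_j h 0 j * (f y * G j y + g y * F j y)
    = f y * (\sum_j h 0 j * G j y) + g y * (\sum_j h 0 j * F j y).
  by rewrite !mulr_sumr -big_split; apply: eq_bigr => j _ /=; ring.
set SF := \sum_j h 0 j * F j y in a3 *; set SG := \sum_j h 0 j * G j y in b3 *.
rewrite (_ : _ - _ - _ = (f (y + h) - f y) * (g (y + h) - g y)
   + f y * (g (y + h) - g y - SG) + g y * (f (y + h) - f y - SF)); last by ring.
apply: le_trans (ler_normD _ _) _; apply: le_trans (lerD (ler_normD _ _) (lexx _)) _.
rewrite !normrM.
have := ler_pM (normr_ge0 _) (normr_ge0 _) a2 b2.
have := ler_pM (normr_ge0 _) (normr_ge0 _) a1 b3.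
have := ler_pM (normr_ge0 _) (normr_ge0 _) b1 a3; lra.
Qed.

(** Chain rule for the entry (a, b) of the Jacobian composed with Psi, differentiated along the k-th
    coordinate. *)
Let DJ k a b y :=
  \sum_i N y k i * fev (dcoef (toC (delta_mx 0 i)) (dcoef (toC (delta_mx 0 a)) (u b))) (Psi y).

Lemma jac_quad : exists2 K : R, 0 <= K & forall y h,
  `|jac u (Psi (y + h)) - jac u (Psi y)| <= K * `|h| /\
  `|jac u (Psi (y + h)) - jac u (Psi y) - \matrix_(a, b) \sum_k h 0 k * DJ k a b y| <= K * `|h| ^+ 2.
Proof.
have [K hK] := choice (fun p : 'I_n * 'I_n =>
  grad_fev (rapid_dcoef (delta_mx 0 p.1) (ur p.2))).
have K0 p : 0 <= K p by have [h _ _] := hK p 0 0; exact: le_trans h.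
have le p : K p <= \sum_q K q by rewrite (bigD1 p)//= lerDl sumr_ge0.
have S0 : 0 <= \sum_q K q by exact: sumr_ge0.
exists (\sum_q K q) => // y h; split; (apply: mx_norm_le => [|a b]; first by rewrite mulr_ge0 ?sqr_ge0).
  have [_ h2 _] := hK (a, b) y h.
  by rewrite !mxE opprD addrACA subrr add0r; apply: le_trans h2 _; rewrite ler_wpM2r.
have [_ _ h3] := hK (a, b) y h.
by rewrite !mxE opprD addrACA subrr add0r; apply: le_trans h3 _; rewrite ler_wpM2r ?sqr_ge0.
Qed.

(** For inverses S, S' of two matrices with difference P, the hypothesis is the resolvent identity.
    Used once more, it leaves, beyond the linear term - S L S, a product of two small increments and
    a term in P - L. *)
Lemma resolvent_remainder (S S' P L : 'M[R]_n) : S' - S = - (S' *m P *m S) ->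
  S' - S + S *m L *m S = - ((S' - S) *m P *m S) - S *m (P - L) *m S.
Proof.
move=> h; rewrite (mulmxBl S' S P) mulmxBl (mulmxBr S P L) mulmxBl {1}h.
by rewrite !opprB [RHS]addrC addrA subrK addrC.
Qed.

Lemma trilinear_sum (p q : 'I_n -> R) (h : 'rV[R]_n) (D : 'I_n -> 'I_n -> 'I_n -> R) :
  \sum_k h 0 k * (- \sum_a \sum_b p a * D k a b * q b)
  = - \sum_b (\sum_a p a * \sum_k h 0 k * D k a b) * q b.
Proof.
under eq_bigr do rewrite mulrN; rewrite sumrN; congr (- _).
transitivity (\sum_k \sum_a \sum_b h 0 k * (p a * D k a b * q b)).
  by apply: eq_bigr => k _; rewrite mulr_sumr; apply: eq_bigr => a _; rewrite mulr_sumr.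
rewrite exchange_big; under eq_bigr do rewrite exchange_big.
rewrite exchange_big; apply: eq_bigr => b _; rewrite mulr_suml.
apply: eq_bigr => a _; rewrite mulr_sumr mulr_suml; apply: eq_bigr => k _; ring.
Qed.

Lemma grad_inv i j :
  has_grad (fun y => N y i j) (fun k y => - \sum_a \sum_b N y i a * DJ k a b y * N y b j).
Proof.
have [K K0 hK] := jac_quad.
have N2 (M : 'M[R]_n) y y' : `|N y *m M *m N y'| <= 4 * n%:R ^+ 2 * `|M|.
  apply: le_trans (mulmx_norm _ _) _.
  apply: le_trans (_ : n%:R * (n%:R * 2 * `|M|) * 2 <= _); last by apply: eq_ler; ring.
  apply: ler_pM; rewrite ?N_norm ?mulr_ge0// ler_wpM2l//.
  apply: le_trans (mulmx_norm _ _) _; rewrite ler_wpM2r// ler_wpM2l//; exact: N_norm.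
have diffN y y' : N y' - N y = - (N y' *m (jac u (Psi y') - jac u (Psi y)) *m N y).
  rewrite mulmxBr mulmxBl {2}/N mulVmx ?(jac_unit uA A1 nA)// mul1mx -(mulmxA _ (jac u (Psi y))).
  by rewrite [X in _ *m X]mulmxV ?(jac_unit uA A1 nA)// mulmx1 opprB.
have n4 : 0 <= 4 * n%:R ^+ 2 :> R by rewrite mulr_ge0 ?sqr_ge0.
have lipN y h : `|N (y + h) - N y| <= 4 * n%:R ^+ 2 * K * `|h|.
  rewrite diffN normrN; apply: le_trans (N2 _ _ _) _.
  by rewrite -[leRHS]mulrA ler_wpM2l//; have [] := hK y h.
exists (2 + 4 * n%:R ^+ 2 * K + n%:R * (n%:R * (4 * n%:R ^+ 2 * K) * K) * 2 + 4 * n%:R ^+ 2 * K) => y h.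
have q1 : 0 <= 4 * n%:R ^+ 2 * K by exact: mulr_ge0.
have q2 : 0 <= n%:R * (n%:R * (4 * n%:R ^+ 2 * K) * K) * 2 by rewrite !mulr_ge0.
split.
- by apply: le_trans (mx_norm_entry _ _ _) _; apply: le_trans (N_norm _) _; lra.
- rewrite (_ : _ - _ = (N (y + h) - N y) i j); last by rewrite !mxE.
  apply: le_trans (mx_norm_entry _ _ _) _; apply: le_trans (lipN _ _) _.
  by rewrite ler_wpM2r//; lra.
pose L : 'M[R]_n := \matrix_(a, b) \sum_k h 0 k * DJ k a b y.
pose P := jac u (Psi (y + h)) - jac u (Psi y).
have -> : \sum_k h 0 k * (- \sum_a \sum_b N y i a * DJ k a b y * N y b j)
    = - (N y *m L *m N y) i j.
  rewrite trilinear_sum mxE; congr (- _); apply: eq_bigr => b _; rewrite mxE.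
  by congr (_ * _); apply: eq_bigr => a _; rewrite mxE.
rewrite (_ : _ - _ - _ = (- ((N (y + h) - N y) *m P *m N y) - N y *m (P - L) *m N y) i j); last first.
  rewrite -(resolvent_remainder L (diffN y (y + h))) opprK; symmetry.
  by rewrite mxE mxE [X in _ + X + _]mxE.
apply: le_trans (mx_norm_entry _ _ _) _; apply: le_trans (ler_normB _ _) _; rewrite normrN.
have [p1 p2] := hK y h; rewrite -/P in p1 p2; rewrite -/L in p2.
have t1 : `|(N (y + h) - N y) *m P *m N y|
    <= n%:R * (n%:R * (4 * n%:R ^+ 2 * K) * K) * 2 * `|h| ^+ 2.
  apply: le_trans (mulmx_norm _ _) _.
  rewrite [leRHS](_ : _ = n%:R * (n%:R * (4 * n%:R ^+ 2 * K * `|h|) * (K * `|h|)) * 2); last by ring.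
  apply: ler_pM; rewrite ?N_norm ?mulr_ge0// ler_wpM2l//.
  apply: le_trans (mulmx_norm _ _) _; apply: ler_pM; rewrite ?mulr_ge0// ler_wpM2l//.
have t2 : `|N y *m (P - L) *m N y| <= 4 * n%:R ^+ 2 * K * `|h| ^+ 2.
  by apply: le_trans (N2 _ _ _) _; rewrite -[leRHS]mulrA ler_wpM2l.
apply: le_trans (lerD t1 t2) _; rewrite -mulrDl ler_wpM2r ?sqr_ge0//; lra.
Qed.

Lemma pulled_grad f : pulled f -> exists G, (forall j, pulled (G j)) /\ has_grad f G.
Proof.
elim=> [c rc|i j|r|f1 g1 _ [F [PF gF]] _ [G [PG gG]]|f1 g1 Pf1 [F [PF gF]] Pg1 [G [PG gG]]].
- exists (fun j y => \sum_i N y j i * fev (dcoef (toC (delta_mx 0 i)) c) (Psi y)).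
  split; last exact: grad_fev.
  move=> j; apply: pulled_sum => i; apply: pulledM; first exact: pulled_inv.
  by apply: pulled_fev; exact: rapid_dcoef.
- exists (fun k y => - \sum_a \sum_b N y i a * DJ k a b y * N y b j).
  split; last exact: grad_inv.
  move=> k; apply: pulledN; apply: pulled_sum => a; apply: pulled_sum => b.
  apply: pulledM; last exact: pulled_inv.
  apply: pulledM; first exact: pulled_inv.
  apply: pulled_sum => l; apply: pulledM; first exact: pulled_inv.
  by apply: pulled_fev; do 2 apply: rapid_dcoef.
- by exists (fun _ _ => 0); split=> [j|]; [exact: pulled_cst|exact: grad_cst].
- by exists (fun j y => F j y + G j y); split=> [j|]; [exact: pulledD|exact: gradD].
- exists (fun j y => f1 y * G j y + g1 y * F j y); split=> [j|]; last exact: gradM.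
  by apply: pulledD; exact: pulledM.
Qed.

Lemma pulled_row_diff (f : 'I_n -> 'rV[R]_n -> R) : (forall i, pulled (f i)) ->
  exists2 G : 'I_n -> 'I_n -> 'rV[R]_n -> R, forall i j, pulled (G i j) &
  forall y, differentiable (fun y => \row_i f i y) y /\
    forall v, 'd (fun y => \row_i f i y) y v = v *m \matrix_(j, i) G i j y.
Proof.
move=> Pf; have [G hG] := choice (fun i => pulled_grad (Pf i)).
have [K hK] := choice (fun i => (hG i).2).
exists G => [i|y]; first exact: (hG i).1.
apply: (@quad_diff_mx R n n (fun y => \row_i f i y) _ y (\sum_i `|K i|)) => h.
have S0 : 0 <= \sum_i `|K i| by exact: sumr_ge0.
apply: mx_norm_le => [|a i]; first by rewrite mulr_ge0 ?sqr_ge0.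
have [_ _ h3] := hK i y h; rewrite !mxE.
under eq_bigr do rewrite mxE.
rewrite (ord1 a); apply: le_trans h3 _; rewrite ler_wpM2r ?sqr_ge0//.
by apply: le_trans (ler_norm _) _; rewrite (bigD1 i)//= lerDl sumr_ge0.
Qed.

Lemma pulled_class_C (k : nat) (f : 'I_n -> 'rV[R]_n -> R) :
  (forall i, pulled (f i)) -> class_C k (fun y => \row_i f i y).
Proof.
elim: k f => [|k IH] f Pf; have [G PG hG] := pulled_row_diff Pf.
  by move=> y; apply: differentiable_continuous; have [] := hG y.
split=> [y|v]; first by have [] := hG y.
rewrite (_ : (fun y => _) = (fun y => \row_i \sum_j v 0 j * G i j y)).
  apply: IH => i; apply: pulled_sum => j; apply: pulledM => //; exact: pulled_cst.
apply/funext => y; have [_ ->] := hG y; apply/rowP => i; rewrite !mxE.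
by apply: eq_bigr => j _; rewrite mxE.
Qed.

Lemma smooth_Psi : smooth Psi.
Proof.
have [K _ hK] := Psi_quad.
have hd y := @quad_diff_mx R n n Psi (N y) y K (hK y).
move=> [|k]; first by move=> y; apply: differentiable_continuous; have [] := hd y.
split=> [y|v]; first by have [] := hd y.
rewrite (_ : (fun y => _) = (fun y => \row_i \sum_j v 0 j * N y j i)).
  apply: pulled_class_C => i; apply: pulled_sum => j.
  by apply: pulledM; [exact: pulled_cst|exact: pulled_inv].
by apply/funext => y; have [_ ->] := hd y; apply/rowP => i; rewrite !mxE.
Qed.

End InverseSmooth.

(** * Descent to the torus *)

Section TorusDiffeo.
Variables (R : realType) (n : nat) (u : 'I_n -> 'rV[int]_n -> R[i]) (A : R).
Hypothesis ur : forall i, rapid (u i).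
Hypothesis uA : forall i, wsup (n + 3) A (u i).
Hypothesis A1 : 4 * pi * n%:R * A <= 1 / 2.
Hypothesis nA : n%:R * (4 * pi * n%:R * A) <= 1 / 2.

Lemma near_id_period (x : 'rV[R]_n) (m : 'rV[int]_n) :
  near_id u (x + map_mx (fun z : int => z%:~R) m)
  = near_id u x + map_mx (fun z : int => z%:~R) m.
Proof.
by apply/rowP => i; rewrite !mxE (fev_period (u i) x m) addrAC.
Qed.

Lemma torus_eq_refl (x : 'rV[R]_n) : torus_eq x x.
Proof. by exists 0; rewrite subrr; apply/rowP => i; rewrite !mxE. Qed.

Lemma near_id_torus_diffeo : torus_diffeo (near_id u).
Proof.
have [Psi PsiK] := choice (near_id_surj uA A1).
have inj := near_id_inj uA A1.
exists Psi; split.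
- split; first exact: smooth_near_id.
  move=> x y [m hm]; exists m.
  have -> : x = y + map_mx (fun z : int => z%:~R) m by rewrite -hm addrC subrK.
  by rewrite near_id_period addrAC subrr add0r.
- split; first exact: (smooth_Psi ur uA A1 nA PsiK).
  move=> x y [m hm]; exists m.
  have -> : x = y + map_mx (fun z : int => z%:~R) m by rewrite -hm addrC subrK.
  have -> : Psi (y + map_mx (fun z : int => z%:~R) m) = Psi y + map_mx (fun z : int => z%:~R) m.
    by apply: inj; rewrite near_id_period !PsiK.
  by rewrite addrAC subrr add0r.
- by move=> x; rewrite (_ : Psi _ = x); [exact: torus_eq_refl|apply: inj; rewrite PsiK].
- by move=> x; rewrite PsiK; exact: torus_eq_refl.
Qed.

End TorusDiffeo.

(** * Sufficiency of the arithmetic condition *)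

Section LimitConjugacy.
Variables (R : realType) (n : nat).
Local Notation C := R[i].
Implicit Types (k l : 'rV[int]_n) (x h v w : 'rV[R]_n) (c d : 'rV[int]_n -> C).

Lemma csym_pev_real c x N : csym c -> pev N c (toC x) = ((rsum c x N)%:C)%C.
Proof.
move=> hc; have := pev_conj N (toC x) hc.
rewrite (_ : map_mx _ (toC x) = toC x); last first.
  by apply/rowP => i; rewrite !mxE conjc_real.
rewrite /rsum; case: (pev N c (toC x)) => p q /= [e].
by congr (_ +i* _)%C; lra.
Qed.

Lemma rsum_trunc c x N :
  rsum c x N = fev (fun k => if (freq_norm k <= N)%N then c k else 0) x.
Proof.
rewrite (@fev_supp _ _ N) => [|k kN]; last by rewrite leqNgt kN.
by rewrite /rsum (pev_eq (d := fun k => if (freq_norm k <= N)%N then c k else 0))// => k ->.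
Qed.

Lemma wsup_trunc p (A : R) c N : wsup p A c ->
  wsup p A (fun k => if (freq_norm k <= N)%N then c k else 0).
Proof.
move=> h k; case: ifP => // _; rewrite nc0 mul0r; exact: wsup_ge0 h.
Qed.

Lemma half_pow_small (D e : R) : 0 <= D -> 0 < e ->
  exists J, forall j, (J <= j)%N -> D * (1 / 2) ^+ j <= e.
Proof.
move=> D0 e0; have [J hJ] := half_pow_le D e0; exists J => j Jj.
by apply: le_trans hJ; rewrite ler_wpM2l// ler_wiXn2l//; lra.
Qed.

(** At a fixed x the defect of the truncated equation tends to 0, and replacing u and l by U_j and
    lambda_j costs O(2^-j): the weight n + 3 bounds the Lipschitz constants of all truncations of F
    and the series of d_omega (u - U_j). *)
Lemma limit_conjugacy (om : 'rV[R]_n) (F u : 'I_n -> 'rV[int]_n -> C)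
    (U : nat -> 'I_n -> 'rV[int]_n -> C) (lam : nat -> 'I_n -> R) (l : 'I_n -> R)
    (K : nat -> nat) (D : R) :
  0 <= D ->
  (forall i, wsup (n + 3) D (F i)) -> (forall i, rapid (u i)) ->
  (forall j i, csym (U j i)) ->
  (forall j i k, (K j < freq_norm k)%N -> U j i k = 0) ->
  (forall j i, wsup (n + 3) (D * (1 / 2) ^+ j) (fun k => u i k - U j i k)) ->
  (forall j i, `|l i - lam j i| <= D * (1 / 2) ^+ j) ->
  (forall j, (j <= K j)%N) ->
  (forall e, 0 < e -> exists J, forall j, (J <= j)%N -> forall i z, strip 0 z ->
     nc (err om (K j) (K j) F (U j) (lam j) i z) <= e) ->
  forall x i, fev (F i) (x + vev u x) - l i = fev (dcoef (toC om) (u i)) x.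
Proof.
have n23 : (n + 2 <= n + 3)%N by clear; lia.
have n33 : (n + 2 + 1 <= n + 3)%N by clear; lia.
have n12 : (n + 2 <= n + 2 + 1)%N by clear; lia.
move=> D0 FD ur Us Usupp uU lU jK herr x i.
have pn : 0 <= pi * n%:R :> R by rewrite mulr_ge0 ?pi_ge0.
apply/eqP; rewrite -subr_eq0 -normr_le0; apply/ler_addgt0Pl => e e0; rewrite addr0.
(* G 2^-j collects the three replacements: u inside F, lambda, and d_omega u. *)
pose G : R := 4 * pi * n%:R * D * (2 * D) + D + 2 * (pi * n%:R * `|om| * D).
have q1 : 0 <= 4 * pi * n%:R * D * (2 * D).
  by rewrite -[4 * pi * _]mulrA; do 3 apply: mulr_ge0 => //.
have G0 : 0 <= G.
  apply: addr_ge0; first exact: addr_ge0.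
  by apply: mulr_ge0 => //; do 2 apply: mulr_ge0 => //.
have e3 : 0 < e / 3 by lra.
have [J1 hJ1] := half_pow_small G0 e3.
have [J2 hJ2] := herr _ e3.
have F2 : wsup (n + 2) D (F i) := wsup_le n23 (FD i).
(* The defect contains F truncated at K_j. The point x + u(x) does not depend on j, so pointwise
   convergence of the partial sums is enough. *)
have [J3 hJ3] : exists J, forall N, (J <= N)%N ->
    `|fev (F i) (x + vev u x) - rsum (F i) (x + vev u x) N| <= e / 3.
  have cv : rsum (F i) (x + vev u x) @ \oo --> fev (F i) (x + vev u x) :=
    @rsum_cvg _ _ _ _ F2 (x + vev u x).
  move/cvgrPdist_le : cv => /(_ _ e3) [J _ hJ]; exists J => N; exact: hJ.
pose j := maxn J1 (maxn J2 J3).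
have hj1 := hJ1 j (leq_maxl _ _).
have hj2 : (J2 <= j)%N by rewrite /j; lia.
have hj3 : (J3 <= K j)%N by apply: leq_trans (jK j); rewrite /j; lia.
pose b : R := (1 / 2) ^+ j; have b0 : 0 <= b by rewrite exprn_ge0.
have u2 i' : wsup (n + 2) (D * b) (fun k => u i' k - U j i' k).
  exact: wsup_le n23 (uU j i').
have U2 i' : exists B, wsup (n + 2 + 1) B (U j i').
  have [B hB] := ur i' (n + 2 + 1)%N.
  have uU' : wsup (n + 2 + 1) (D * b) (fun k => u i' k - U j i' k).
    exact: wsup_le n33 (uU j i').
  exists (B + D * b) => k; have := wsupD hB (wsupN uU') k.
  by rewrite opprB addrC subrK.
have dB i' : fev (u i') x - fev (U j i') x = fev (fun k => u i' k - U j i' k) x.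
  have [B hB] := ur i' (n + 2)%N; have [B' hB'] := U2 i'.
  by rewrite (fevB x hB (wsup_le n12 hB')).
have hd : `|vev u x - vev (U j) x| <= 2 * (D * b).
  apply: mx_norm_le => [|a i']; first by rewrite !mulr_ge0.
  by rewrite !mxE dB; exact: fev_bound.
have eU : \row_i' pev (K j) (U j i') (toC x) = toC (vev (U j) x).
  apply/rowP => i'; rewrite !mxE csym_pev_real//; congr (_%:C)%C.
  by rewrite (fev_supp x (Usupp j i')).
have E := hJ2 j hj2 i (toC x) (strip_toC x (lexx 0)).
have {E}E : `|rsum (F i) (x + vev (U j) x) (K j) - lam j i
      - fev (dcoef (toC om) (U j i)) x| <= e / 3.
  apply: le_trans E; apply: le_trans (nc_Re _); apply: eq_ler; congr `|_|.
  have -> : fev (dcoef (toC om) (U j i)) x = rsum (dcoef (toC om) (U j i)) x (K j).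
    by apply: fev_supp => k kN; rewrite /dcoef Usupp// mulr0.
  rewrite /err eU (_ : toC x + toC _ = toC (x + vev (U j) x)); last first.
    by apply/rowP => a; rewrite !mxE rmorphD.
  rewrite (csym_pev_real _ _ (csym_dcoef om (Us j i))) /rsum.
  by case: (pev _ (F i) _).
have h4 : `|rsum (F i) (x + vev u x) (K j) - rsum (F i) (x + vev (U j) x) (K j)|
    <= 4 * pi * n%:R * D * (2 * (D * b)).
  rewrite !rsum_trunc.
  have := fev_lip (x + vev (U j) x) (vev u x - vev (U j) x) (@wsup_trunc _ _ _ (K j) (FD i)).
  rewrite -addrA [vev (U j) x + _]addrC subrK => h; apply: le_trans h _.
  by apply: ler_wpM2l => //; rewrite -[4 * pi * _]mulrA; do 2 apply: mulr_ge0 => //.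
have h5 : `|fev (dcoef (toC om) (u i)) x - fev (dcoef (toC om) (U j i)) x|
    <= 2 * (pi * n%:R * `|om| * (D * b)).
  have uU' : wsup (n + 2 + 1) (D * b) (fun k => u i k - U j i k).
    exact: wsup_le n33 (uU j i).
  have [B hB] := ur i (n + 2 + 1)%N; have [B' hB'] := U2 i.
  have d1 := @wsup_dcoef _ _ _ _ _ om hB; have d2 := @wsup_dcoef _ _ _ _ _ om hB'.
  have d3 := @wsup_dcoef _ _ _ _ _ om uU'.
  rewrite -(fevB x d1 d2); apply: le_trans (fev_bound x d3).
  apply: eq_ler; congr `|_|; apply: fev_eq => k; rewrite /dcoef; ring.
have h6 := lU j i; rewrite -/b in h6.
have h7 := hJ3 _ hj3.
have hG : G * b = 4 * pi * n%:R * D * (2 * (D * b)) + D * b + 2 * (pi * n%:R * `|om| * (D * b)).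
  by rewrite /G; ring.
rewrite -/b hG in hj1.
move: h4 h5 h6 h7 E hj1.
move: (fev (F i) (x + vev u x)) (rsum _ _ _) (rsum _ _ _) (fev _ _) (fev _ _) (lam j i) (l i)
  (4 * pi * n%:R * D * (2 * (D * b))) (D * b) (2 * (pi * n%:R * `|om| * _)) => f1 f2 f3 f4 f5 g1 g2 t1 t2 t3.
rewrite !ler_norml => /andP[? ?] /andP[? ?] /andP[? ?] /andP[? ?] /andP[? ?] ?.
apply/andP; split; lra.
Qed.

End LimitConjugacy.

(** * From the norms of the statement to coefficient bounds *)

Section Translation.
Variables (R : realType) (n : nat) (a : R).
Hypothesis a01 : 0 < a < 1.
Implicit Types (k : 'rV[int]_n) (f : fourier_series R n) (c : 'rV[int]_n -> R[i]).

Lemma weightE r k : weight a r k = expR (r / a * (freq_norm k)%:R `^ a).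
Proof. by rewrite /weight /phi_pow; congr expR; ring. Qed.

Lemma weight_gt0 r k : 0 < weight a r k. Proof. exact: expR_gt0. Qed.

Lemma fnorm_coef f r (b : R) k : (fnorm a r f <= b%:E)%E ->
  nc (f k) <= b * expR (- (r / a * (freq_norm k)%:R `^ a)).
Proof.
move=> h; rewrite expRN -weightE ler_pdivlMr ?weight_gt0// -lee_fin.
by apply: le_trans h; apply: ereal_sup_ubound; exists k.
Qed.

Lemma fnorm_le f r (b : R) :
  (forall k, nc (f k) <= b * expR (- (r / a * (freq_norm k)%:R `^ a))) ->
  (fnorm a r f <= b%:E)%E.
Proof.
move=> h; apply: ge_ereal_sup => _ [k _ <-]; rewrite lee_fin.
by rewrite -ler_pdivlMr ?weight_gt0// weightE -expRN.
Qed.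

Lemma fspace_coef f r : fspace a r f -> exists b : R, forall k,
  nc (f k) <= b * expR (- (r / a * (freq_norm k)%:R `^ a)).
Proof.
rewrite /fspace /=; case E : (fnorm a r f) => [b| |]// _.
  by exists b => k; apply: fnorm_coef; rewrite E.
by exists 0 => k; apply: fnorm_coef; rewrite E leNye.
Qed.

Lemma vfnorm_coef (F : fvector R n) r (b : R) i k : (vfnorm a r F <= b%:E)%E ->
  nc (F i k) <= b * expR (- (r / a * (freq_norm k)%:R `^ a)).
Proof.
move=> h; apply: fnorm_coef; apply: le_trans h.
by rewrite /vfnorm; exact: (le_bigmax _ (fun i => fnorm a r (F i))).
Qed.

Lemma decay_rapid c :
  (exists D : R, forall k, nc (c k) <= D * expR (- ((freq_norm k)%:R `^ a))) -> rapid c.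
Proof.
move=> [D hD] p; have /andP[a0 _] := a01.
have D0 : 0 <= D.
  have := le_trans (nc_ge0 _) (hD 0); rewrite pmulr_lge0//; exact: expR_gt0.
have [Q Q0 hQ] := exp_dominates 1 p a0.
exists (D * (1 + (1 + 2 * Q)%N%:R ^+ p)) => k.
apply: le_trans (ler_wpM2r _ (hD k)) _; first by rewrite exprn_ge0.
rewrite -mulrA ler_wpM2l// expRN mulrC ler_pdivrMr ?expR_gt0//.
have e1 : 1 <= expR ((freq_norm k)%:R `^ a) :> R by rewrite -[leLHS]expR0 ler_expR powR_ge0.
have [kQ|Qk] := leqP (freq_norm k) Q.
  apply: le_trans (_ : (1 + 2 * Q)%N%:R ^+ p <= _).
    by rewrite lerXn2r ?nnegrE// ler_nat; lia.
  apply: le_trans (_ : (1 + (1 + 2 * Q)%N%:R ^+ p) * 1 <= _); first by rewrite mulr1 lerDr.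
  by rewrite ler_wpM2l// addr_ge0 ?exprn_ge0.
apply: le_trans (_ : 1 * expR ((freq_norm k)%:R `^ a) <= _).
  apply: le_trans (_ : 1 * (4 * freq_norm k + 1)%N%:R ^+ p <= _); last by rewrite [leRHS]mul1r; exact: hQ (ltnW Qk).
  by rewrite mul1r lerXn2r ?nnegrE// ler_nat; lia.
by rewrite ler_wpM2r ?expR_ge0// lerDl exprn_ge0.
Qed.

Lemma small_div_bound tau (om : 'rV[R]_n) : non_resonant om -> small_div a tau om ->
  exists2 Cw : R, 0 <= Cw & forall k, k != 0 ->
    `|2 * pi * freq_dot k om|^-1 <= Cw * expR (tau / a * (freq_norm k)%:R `^ a).
Proof.
move=> nr; rewrite /small_div /=; set S := ereal_sup _ => hS.
have [b hb] : exists b : R, (S <= b%:E)%E.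
  by case: S hS => [b| |]// _; [exists b|exists 0; rewrite leNye].
exists `|b| => // k k0.
have fd : `|2 * pi * freq_dot k om| != 0.
  by rewrite normr_eq0 !mulf_neq0 ?nr// gt_eqF ?pi_gt0.
have : ((`|2 * pi * freq_dot k om|%:E)^-1 * (weight a (- tau) k)%:E <= b%:E)%E.
  by apply: le_trans hb; apply: ereal_sup_ubound; exists k.
rewrite inver (negbTE fd) -EFinM lee_fin weightE mulNr mulNr expRN.
rewrite ler_pdivrMr ?expR_gt0// => h; apply: le_trans h _.
by rewrite ler_wpM2r ?expR_ge0// ler_norm.
Qed.

End Translation.

(** * Choice of the constants and conclusion *)

Section Forward.
Variables (R : realType) (n : nat).

Lemma kam_small_gt0 (a rho0 : R) K0 : 0 < kam_small n a K0 rho0.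
Proof.
rewrite /kam_small; apply: divr_gt0; first exact: expR_gt0.
apply: mulr_gt0; last by rewrite ltr0n expn_gt0.
by rewrite ltr_pwDl// !mulr_ge0 ?pi_ge0.
Qed.

Lemma kappa_choice (eta : R) : 0 < eta -> exists2 kappa : R, 0 < kappa &
  [/\ kappa <= 1 / 8, 8 * kappa <= eta, 16 * pi * n%:R * kappa <= eta,
      16 * pi * n%:R * kappa <= 1 / 2 & n%:R * (16 * pi * n%:R * kappa) <= 1 / 2].
Proof.
move=> eta0; have pi0 := @pi_ge0 R; have n0 : 0 <= n%:R :> R by [].
(* Each summand of P serves one requirement, through kappa P <= min(1, eta); the coefficients 32 = 2
   * 16 give the bounds by 1/2. *)
pose P : R := 8 + 32 * (pi * n%:R) + 32 * (pi * n%:R * n%:R).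
have q1 : 0 <= pi * n%:R :> R by exact: mulr_ge0.
have q2 : 0 <= pi * n%:R * n%:R :> R by exact: mulr_ge0.
have P0 : 0 < P by rewrite /P; lra.
pose m : R := Num.min 1 eta.
have m0 : 0 < m by rewrite lt_min ltr01.
have k0 : 0 < m / P by exact: divr_gt0.
have mE : 8 * (m / P) + 32 * (pi * n%:R * (m / P)) + 32 * (pi * n%:R * n%:R * (m / P)) = m.
  by rewrite /P; field; rewrite gt_eqF//; move: P0; rewrite /P; lra.
have r1 : 0 <= pi * n%:R * (m / P) by rewrite mulr_ge0// ltW.
have r2 : 0 <= pi * n%:R * n%:R * (m / P) by rewrite mulr_ge0// ltW.
have m1 : m <= 1 by rewrite ge_min lexx.
have m2 : m <= eta by rewrite ge_min lexx orbT.
exists (m / P) => //.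
move: (m / P) mE k0 r1 r2 => kap mE k0 r1 r2; split; lra.
Qed.

Lemma conjugacy_exists (a : R) (om : 'rV[R]_n) : 0 < a -> a < 1 -> non_resonant om ->
  small_div_infty a om -> forall eta : R, 0 < eta ->
    exists r0 eps : R, 0 < r0 /\ 0 < eps /\
      forall F : fvector R n, vfspace_infty a F ->
        (vfnorm a r0 F <= eps%:E)%E ->
        exists (lambda : 'rV[R]_n) (Phi : 'rV[R]_n -> 'rV[R]_n),
          [/\ torus_diffeo Phi,
              map_in_vfspace_infty a (fun x => Phi x - x),
              (forall x, pullback Phi (fun y => om + vfeval F y - lambda) x = om),
              `|lambda| <= eta
            & (C1_dist_id Phi <= eta%:E)%E].
Proof.
move=> a0 a1 nr [tau tau0 htau] eta eta0; have a01 : 0 < a < 1 by apply/andP.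
have [Cw Cw0 hCw] := small_div_bound nr htau.
have [kappa k0 [k8 keta kn k2 kn2]] := kappa_choice eta0.
have kappa01 : 0 < kappa <= 1 / 8 by apply/andP.
have omOm i : `|om 0 i| <= `|om| by exact: mx_norm_entry.
have omd k : k != 0 -> freq_dot k om != 0 /\
    `|2 * pi * freq_dot k om|^-1 <= Cw * expR (tau / a * (freq_norm k)%:R `^ a).
  by move=> kn0; split; [exact: nr|exact: hCw].
have [K0 K00 hK0] := exp_dominates (kam_const n `|om| Cw kappa) (2 * n + 4) a0.
have g0 := gap_gt0 a01.
have ta : 0 <= tau / a by rewrite divr_ge0 ?(ltW tau0) ?(ltW a0).
(* This also gives gap * rho0 >= 1, which lets rho grow by one unit per step within the factor 1 +
   gap. *)
pose rho0 : R := (2 * (tau / a) + 1) / gap a.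
have gr : gap a * rho0 = 2 * (tau / a) + 1 by rewrite mulrC divfK// gt_eqF.
have hrho1 : 2 * (tau / a) + 1 <= 2 * gap a * rho0 by rewrite -mulrA gr; lra.
have hrho2 : 1 <= gap a * rho0 by rewrite gr; lra.
have rho00 : 0 < rho0 by rewrite divr_gt0//; lra.
have fd0 : 0 < fdecay n a.
  by rewrite ltr_pwDr// mulr_ge0 ?(ltW (width_gt0 a01))// mulr_ge0// mulr_ge0// pi_ge0.
pose r m : R := a * (fdecay n a * (rho0 + m%:R)).
have rE m : r m / a = fdecay n a * (rho0 + m%:R) by rewrite /r mulrC mulKf// gt_eqF.
have r0 m : 0 < r m by rewrite !mulr_gt0// ltr_pwDl.
exists (r 0%N), (kam_small n a K0 rho0); split=> //; split; first exact: kam_small_gt0.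
move=> F Finf Fsmall.
have hB m : exists b : R, forall i k,
    nc (F i k) <= b * expR (- (fdecay n a * (rho0 + m%:R) * (freq_norm k)%:R `^ a)).
  have [b hb] := choice (fun i => fspace_coef (Finf i (r m) (r0 m))).
  exists (\sum_i `|b i|) => i k; rewrite -rE; apply: le_trans (hb i k) _.
  rewrite ler_wpM2r ?expR_ge0//; apply: le_trans (ler_norm _) _.
  by rewrite (bigD1 i)//= lerDl sumr_ge0.
have [B0 hB0] := choice hB.
(* Only the rate [r 0] comes with smallness. The constants at the higher rates depend on F and exist
   because F lies in every space of the scale; r0 and eps are fixed before them. *)
pose B m := if m is 0%N then kam_small n a K0 rho0 else B0 m.
have hB1 m i k : nc (F i k) <= B m * expR (- (fdecay n a * (rho0 + m%:R) * (freq_norm k)%:R `^ a)).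
  by case: m => [|m]; [rewrite -rE; exact: vfnorm_coef Fsmall|exact: hB0].
have Fsym i : csym (F i) by move=> k; exact: fcoef_conj.
have [U [lam [u [l [us [Us Usupp Uerr] [U00 lam00] [uU lU] udec]]]]] :=
  kam_limit a01 tau0 (normr_ge0 om) Cw0 kappa01 omOm omd K00 hK0 hrho1 hrho2 Fsym hB1 (lexx _).
have ur i : rapid (u i).
  apply: (decay_rapid a01); have [D hD] := udec 1 ltr01; exists D => k.
  by have := hD i k; rewrite mul1r.
have Fr i : rapid (F i).
  apply: (decay_rapid a01); have [b hb] := fspace_coef (Finf i a a0); exists b => k.
  by have := hb k; rewrite divff ?mul1r// gt_eqF.
have uA i : wsup (n + 3) (4 * kappa) (u i).
  by move=> k; have := uU 0%N i k; rewrite U00 subr0 expr0 mulr1.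
have thE : 4 * pi * n%:R * (4 * kappa) = 16 * pi * n%:R * kappa by ring.
have A1 : 4 * pi * n%:R * (4 * kappa) <= 1 / 2 by rewrite thE.
have nA : n%:R * (4 * pi * n%:R * (4 * kappa)) <= 1 / 2 by rewrite thE.
have conj x i : fev (F i) (x + vev u x) - l i = fev (dcoef (toC om) (u i)) x.
  have [FD hFD] := choice (fun i => Fr i (n + 3)%N).
  pose D := 4 * kappa + \sum_i FD i.
  have FD0 j : 0 <= FD j by exact: wsup_ge0 (hFD j).
  have D4 : 4 * kappa <= D by rewrite lerDl sumr_ge0.
  have k40 : 0 <= 4 * kappa by rewrite mulr_ge0// ltW.
  apply: (@limit_conjugacy _ _ om F u U lam l (scale K0) D) => //.
  - exact: le_trans D4.
  - move=> j k; apply: le_trans (hFD j k) _; rewrite /D (bigD1 j)//= addrCA lerDl.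
    by rewrite addr_ge0// sumr_ge0.
  - move=> j i' k; apply: le_trans (uU j i' k) _; by rewrite ler_wpM2r ?exprn_ge0.
  - move=> j i'; apply: le_trans (lU j i') _; rewrite ler_wpM2r ?exprn_ge0//.
    apply: le_trans D4; lra.
  - move=> j; apply: leq_trans (ltnW (ltn_expl j (ltnSn 1))) _.
    by rewrite /scale leq_pmull.
  - move=> e e0.
    have [J hJ] := @powR_unbounded R a a01 K0 K00 e^-1.
    exists J => j Jj i' z zs; apply: le_trans (Uerr j i' z zs) _.
    by rewrite expRN -[leRHS]invrK lef_pV2 ?posrE ?expR_gt0 ?invr_gt0//; exact: hJ.
exists (\row_i l i), (near_id u); split.
- exact: near_id_torus_diffeo uA A1 nA.
- pose f i : fourier_series R n := FourierSeries (us i).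
  exists f => [i s s0|].
    have sa : 0 < s / a by rewrite divr_gt0.
    have [D hD] := udec _ sa; rewrite /fspace /=.
    by apply: le_lt_trans (ltry D); apply: fnorm_le => k; exact: hD.
  apply/funext => x; rewrite /near_id addrC addKr; apply/rowP => i.
  by rewrite !mxE feval_fev.
- move=> x; rewrite /pullback (jacobian_near_id ur).
  rewrite (_ : om + _ - _ = om *m jac u x) ?mulmxK ?(jac_unit uA A1 nA)//.
  rewrite mulmxDr mulmx1 vjacE// -addrA; congr (_ + _).
  by apply/rowP => i; rewrite !mxE feval_fev -conj.
- apply: mx_norm_le => [|a' i]; first exact: ltW.
  rewrite mxE; have := lU 0%N i; rewrite lam00 subr0 expr0 mulr1 => h.
  by apply: le_trans h _; lra.
rewrite /C1_dist_id ge_max; apply/andP; split; apply: ge_ereal_sup => _ [x _ <-]; rewrite lee_fin.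
  rewrite /near_id addrC addKr; apply: mx_norm_le => [|a' i]; first exact: ltW.
  rewrite mxE; apply: le_trans (fev_bound x (wsup_le _ (uA i))) _; first by clear; lia.
  lra.
rewrite (jacobian_near_id ur) /jac addrC addKr; apply: mx_norm_le => [|i j]; first exact: ltW.
by apply: le_trans (vjac_entry uA A1 nA x i j) _; rewrite thE.
Qed.

End Forward.

(** * Necessity of the arithmetic condition *)

Section TwoModes.
Variables (R : realType) (n : nat) (k : 'rV[int]_n).
Hypothesis k0 : k != 0.
Implicit Types (l : 'rV[int]_n) (w : R).

Lemma freq_neqN : k != - k.
Proof.
apply: contra k0 => /eqP e; apply/eqP/rowP => i; have := congr1 (fun l : 'rV[int]_n => l 0 i) e.
by rewrite !mxE; move: (k 0 i) => z; lia.
Qed.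

Definition cos_coef w l : R[i] :=
  (w%:C)%C * ((if l == k then 1 else 0) + (if l == - k then 1 else 0)).

Lemma cos_coef_conj w l : conjc (cos_coef w l) = cos_coef w (- l).
Proof.
rewrite /cos_coef conjc_mul conjc_real conjc_add eqr_opp -[- l == k]eqr_opp opprK.
by rewrite addrC; do 2 (case: ifP => _); rewrite ?conjc0 ?conjc1.
Qed.

Definition cos_series w : fourier_series R n := FourierSeries (cos_coef_conj w).

Lemma nc_cos_coef w l : nc (cos_coef w l) = if (l == k) || (l == - k) then `|w| else 0.
Proof.
rewrite /cos_coef; case: eqVneq => [->|_].
  by rewrite (negbTE freq_neqN) addr0 mulr1 nc_real.
by case: eqVneq => [_|_]; rewrite add0r ?mulr1 ?nc_real// mulr0 nc0.
Qed.

Lemma fnorm_cos_series (a r : R) w : (fnorm a r (cos_series w) <= (`|w| * weight a r k)%:E)%E.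
Proof.
apply: ge_ereal_sup => _ [l _ <-]; rewrite lee_fin /= nc_cos_coef.
have wk : 0 <= `|w| * weight a r k by rewrite mulr_ge0 ?expR_ge0.
case: eqVneq => [->//|_] /=; case: eqVneq => [->|_]; last by rewrite mul0r.
by rewrite /weight freq_normN.
Qed.

Lemma feval_cos_series w (y : 'rV[R]_n) :
  feval (cos_series w) y = 2 * w * cos (2 * pi * freq_dot k y).
Proof.
rewrite feval_fev (@fev_supp _ _ (freq_norm k)) => [|l kl]; last first.
  apply: nc_eq0; rewrite /= nc_cos_coef; case: eqVneq kl => [->|_]; first by rewrite ltnn.
  by case: eqVneq => [->|_]//; rewrite freq_normN ltnn.
rewrite /rsum [pev _ _ _](_ : _ = (w%:C)%C * (1 * ek k (toC y) + 1 * ek (- k) (toC y))).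
  have e : ek (- k) (toC y) = conjc (ek k (toC y)).
    have := ek_conj (- k) (toC y); rewrite opprK => <-; congr ek.
    by apply/rowP => i; rewrite !mxE conjc_real.
  by rewrite e ek_toC /=; ring.
rewrite -(pev_delta _ _ (leqnn _)) -(@pev_delta _ _ (freq_norm k) 1 (- k)) ?freq_normN//.
by rewrite -pevD -pevZ.
Qed.

End TwoModes.

(** * Flow along a shear perturbation *)

Section Necessity.
Variables (R : realType) (n : nat).
Implicit Types (k : 'rV[int]_n) (x y v om lambda : 'rV[R]_n).

Lemma bounded_affine (c d B : R) : (forall t, `|c * t + d| <= B) -> c = 0.
Proof.
move=> h; apply/eqP/negPn/negP => c0.
have := h ((B + `|d| + 1) / c); rewrite mulrC divfK// => h1.
have : `|B + `|d| + 1| <= `|B + `|d| + 1 + d| + `|d|.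
  by rewrite -{1}[B + `|d| + 1](addrK d); exact: ler_normB.
have := ler_norm (B + `|d| + 1); lra.
Qed.

Lemma is_derive_line (f : 'rV[R]_n -> R) om (t d : R) :
  is_derive (t *: om) om f d -> is_derive t 1 (fun s => f (s *: om)) d.
Proof.
move=> [df fd].
have e : (fun h : R => h^-1 *: (((fun s => f (s *: om)) \o shift t) (h *: 1) - f (t *: om)))
   = (fun h : R => h^-1 *: ((f \o shift (t *: om)) (h *: om) - f (t *: om))).
  by apply/funext => h /=; rewrite [h *: 1]mulr1 scalerDl.
by apply: DeriveDef; [rewrite /derivable e|rewrite /derive e].
Qed.

Lemma is_derive_coord (Phi : 'rV[R]_n -> 'rV[R]_n) om (t : R) i :
  (forall x, differentiable Phi x) ->
  is_derive t 1 (fun s => Phi (s *: om) 0 i) ((om *m 'J Phi (t *: om)) 0 i).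
Proof.
move=> hd; apply: (@is_derive_line (fun y => Phi y 0 i)); 
  have dP : derivable Phi (t *: om) om by apply: diff_derivable; exact: hd.
apply: DeriveDef; first by have /derivable_mxP := dP; apply.
by rewrite -deriveEjacobian// derive_mx// mxE.
Qed.

Lemma is_derive_wsum (psi : 'I_n -> R -> R) (w d : 'I_n -> R) (t : R) :
  (forall i, is_derive t 1 (psi i) (d i)) ->
  is_derive t 1 (fun s => \sum_i w i * psi i s) (\sum_i w i * d i).
Proof.
move=> h; rewrite (_ : (fun s => _) = \sum_i (w i \*: psi i)); last first.
  by apply/funext => s; rewrite fct_sumE.
by apply: is_derive_sum => i; apply: is_deriveZ.
Qed.

Lemma sub_linear_cst (f : R -> R) (c : R) : (forall t : R, is_derive t (1 : R) f c) ->
  forall t, f t = f 0 + c * t.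
Proof.
move=> h t; pose g := f + (- c) \*: id.
have hg (s : R) : is_derive s (1 : R) g 0.
  have := is_deriveD (h s) (is_deriveZ (- c) (is_derive_id s 1)).
  by rewrite (_ : c + - c *: 1 = 0)// [_ *: _]mulr1 subrr.
have : g t = g 0 by exact: is_derive_0_is_cst.
by rewrite /g !fctE /= /GRing.scale /= mulr0 addr0 => <-; ring.
Qed.

Lemma is_derive_sin_affine (p q t : R) :
  is_derive t 1 (fun s => sin (p + q * s)) (cos (p + q * t) * q).
Proof.
have h : is_derive t 1 (fun s => p + q * s) q.
  have := is_deriveD (is_derive_cst p t 1) (is_deriveZ q (is_derive_id t 1)).
  by rewrite add0r [_ *: _]mulr1.
exact: (is_derive1_comp (is_derive_sin _) h).
Qed.

(** Let i1 maximize |k_j| and let i be another index, which exists as n >= 2; v is e_i minus k_i /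
    k_i1 times e_i1. Maximality bounds the entries by 1, so that the size of F is given by its
    amplitude. *)
Lemma orthogonal_direction k : (2 <= n)%N -> k != 0 ->
  exists v (i : 'I_n), [/\ freq_dot k v = 0, v 0 i = 1 & forall j, `|v 0 j| <= 1].
Proof.
move=> n2 k0.
have [i1 hi1] : exists i1 : 'I_n, forall j, (`|k 0%R j| <= `|k 0%R i1|)%N.
  have i0 : 'I_n := Ordinal (ltnW n2).
  by case: (arg_maxnP (fun j => `|k 0%R j|%N) (isT : xpredT i0)) => i _ h; exists i => j; exact: h.
have k1 : k 0 i1 != 0.
  apply: contra k0 => /eqP e; apply/eqP/rowP => j; have := hi1 j.
  by rewrite e mxE absz0 leqn0 absz_eq0 => /eqP.
have [i ii1] : exists i : 'I_n, i != i1.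
  have [->|h] := eqVneq i1 (Ordinal (ltnW n2)); first by exists (Ordinal n2).
  by exists (Ordinal (ltnW n2)); rewrite eq_sym.
have kR : (k 0 i1)%:~R != 0 :> R by rewrite intr_eq0.
pose q : R := (k 0 i)%:~R / (k 0 i1)%:~R.
exists (\row_j if j == i then 1 else if j == i1 then - q else 0), i; split.
- rewrite /freq_dot (bigD1 i)//= (bigD1 i1)/= 1?eq_sym// big1 => [|j /andP[ji ji1]].
    rewrite !mxE eqxx [i1 == i]eq_sym (negbTE ii1) eqxx addr0 mulr1 mulrN /q.
    by rewrite mulrC divfK// subrr.
  by rewrite mxE (negbTE ji) (negbTE ji1) mulr0.
- by rewrite mxE eqxx.
move=> j; rewrite mxE; case: ifP => _; first by rewrite normr1.
case: ifP => _; last by rewrite normr0.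
rewrite normrN /q normrM normfV ler_pdivrMr ?normr_gt0// mul1r -!intr_norm ler_int.
by have := hi1 i; lia.
Qed.

Lemma shear_amplitude (Phi : 'rV[R]_n -> 'rV[R]_n) om lambda k v i (b eta : R) :
  freq_dot k om != 0 -> freq_dot k v = 0 -> v 0 i = 1 ->
  (forall x, differentiable Phi x) ->
  (forall x, om + (b * cos (2 * pi * freq_dot k (Phi x))) *: v - lambda = om *m 'J Phi x) ->
  (forall x, `|Phi x - x| <= eta) ->
  `|b| * `|2 * pi * freq_dot k om|^-1 <= eta.
Proof.
move=> ko kv vi dPhi eqn bnd; pose g t := Phi (t *: om).
have dg (t : R) (j : 'I_n) : is_derive t 1 (fun s => g s 0 j)
    (om 0 j + b * cos (2 * pi * freq_dot k (g t)) * v 0 j - lambda 0 j).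
  have := is_derive_coord om t j dPhi; rewrite -eqn.
  by rewrite !mxE.
have linD y z : freq_dot k (y - z) = freq_dot k y - freq_dot k z.
  by rewrite /freq_dot -sumrB; apply: eq_bigr => j _; rewrite !mxE mulrBr.
have linZ (c : R) y : freq_dot k (c *: y) = c * freq_dot k y.
  by rewrite /freq_dot mulr_sumr; apply: eq_bigr => j _; rewrite !mxE mulrCA.
(* As v is orthogonal to k, the cosine drops out of the derivative of k.Phi(t omega). *)
have theta t : freq_dot k (g t) = freq_dot k (g 0) + (freq_dot k om - freq_dot k lambda) * t.
  apply: (sub_linear_cst (f := fun s => freq_dot k (g s))) => s.
  have h := is_derive_wsum (fun j => (k 0 j)%:~R) (dg s).
  move: h; set cs := b * _.
  rewrite [X in is_derive _ _ _ X](_ : _ = freq_dot k om + cs * freq_dot k v - freq_dot k lambda).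
    by rewrite kv mulr0 addr0.
  rewrite /freq_dot mulr_sumr -big_split -sumrB; apply: eq_bigr => j _ /=; ring.
have kl : freq_dot k lambda = 0.
  apply/eqP; rewrite -oppr_eq0; apply/eqP.
  apply: (@bounded_affine _ (freq_dot k (g 0)) (n%:R * (freq_norm k)%:R * eta)) => t.
  have -> : - freq_dot k lambda * t + freq_dot k (g 0) = freq_dot k (g t - t *: om).
    by rewrite linD linZ (theta t); ring.
  by apply: le_trans (freq_dot_norm _ _) _; rewrite ler_wpM2l ?mulr_ge0// bnd.
rewrite kl subr0 in theta.
set kap := freq_dot k om in ko theta *.
have p0 : pi != 0 :> R by rewrite gt_eqF ?pi_gt0.
pose beta := b / (2 * pi * kap).
pose p := 2 * pi * freq_dot k (g 0); pose q := 2 * pi * kap.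
have pq t : 2 * pi * freq_dot k (g t) = p + q * t by rewrite theta /p /q; ring.
have q0 : q != 0 by rewrite /q !mulf_neq0.
have X t : g t 0 i - beta * sin (p + q * t)
    = g 0 0 i - beta * sin (p + q * 0) + (om 0 i - lambda 0 i) * t.
  apply: (sub_linear_cst (f := fun s => g s 0 i - beta * sin (p + q * s))) => s.
  have := is_deriveD (dg s i) (is_deriveZ (- beta) (is_derive_sin_affine p q s)).
  rewrite (_ : _ + _ *: _ = om 0 i - lambda 0 i); last first.
    rewrite /GRing.scale /= pq vi /beta -/q; field; exact: q0.
  rewrite (_ : _ + _ \*: _ = (fun s => g s 0 i - beta * sin (p + q * s)))//.
  by apply/funext => s'; rewrite !fctE /= /GRing.scale /= mulNr.
have bi t : `|g t 0 i - t * om 0 i| <= eta.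
  have := mx_norm_entry (Phi (t *: om) - t *: om) 0 i; rewrite !mxE => h.
  exact: le_trans h (bnd _).
pose Z := g 0 0 i - beta * sin (p + q * 0).
have Y t : g t 0 i - t * om 0 i = Z - lambda 0 i * t + beta * sin (p + q * t).
  have := X t; rewrite -/Z; lra.
have sinb (t : R) : `|beta * sin t| <= `|beta|.
  by rewrite normrM ler_piMr// ler_norml sin_geN1 sin_le1.
(* Once the oscillating term is removed, the i-th coordinate of Phi(t omega) - t omega is affine in
   t and bounded. *)
have l0 : lambda 0 i = 0.
  apply/eqP; rewrite -oppr_eq0; apply/eqP.
  apply: (@bounded_affine _ Z (eta + `|beta|)) => t.
  have -> : - lambda 0 i * t + Z = (g t 0 i - t * om 0 i) - beta * sin (p + q * t).
    by rewrite Y; ring.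
  by apply: le_trans (ler_normB _ _) _; apply: lerD.
have tE (x : R) : p + q * ((x - p) / q) = x by rewrite mulrCA divff// mulr1 addrC subrK.
(* The times are those where the sine equals 1 and -1; the difference of the two values eliminates
   the unknown centre Z. *)
have h1 : `|Z + beta| <= eta.
  have := bi ((pi / 2 - p) / q); rewrite Y l0 tE.
  by rewrite sin_pihalf mulr1 mul0r subr0.
have h2 : `|Z - beta| <= eta.
  have := bi ((- (pi / 2) - p) / q); rewrite Y l0 tE.
  by rewrite sinN sin_pihalf mulrN1 mul0r subr0.
have -> : `|b| * `|2 * pi * kap|^-1 = `|beta| by rewrite /beta [in RHS]normrM normfV.
have : `|(Z + beta) - (Z - beta)| <= eta + eta.
  by apply: le_trans (ler_normB _ _) _; exact: lerD.
rewrite (_ : Z + beta - (Z - beta) = 2 * beta); last by ring.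
rewrite normrM ger0_norm//; lra.
Qed.

(** A single eta is used, and tau = r0. For each k the perturbation has amplitude proportional to
    eps exp(-r0 phi_a(|k|)), so that its r0-norm stays below eps; the bound of [shear_amplitude]
    then becomes the small divisor estimate, with the constant eta / (2 eps) for all k. *)
Lemma small_div_of_conjugacy (a : R) om : (2 <= n)%N -> 0 < a -> non_resonant om ->
  (forall eta : R, 0 < eta ->
    exists r0 eps : R, 0 < r0 /\ 0 < eps /\
      forall F : fvector R n, vfspace_infty a F ->
        (vfnorm a r0 F <= eps%:E)%E ->
        exists (lambda : 'rV[R]_n) (Phi : 'rV[R]_n -> 'rV[R]_n),
          [/\ torus_diffeo Phi,
              map_in_vfspace_infty a (fun x => Phi x - x),
              (forall x, pullback Phi (fun y => om + vfeval F y - lambda) x = om),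
              `|lambda| <= eta
            & (C1_dist_id Phi <= eta%:E)%E]) ->
  small_div_infty a om.
Proof.
move=> n2 a0 nr H; have n0 : 0 < n%:R :> R by rewrite ltr0n ltnW.
(* With eta = 1 / (2 n), the C^1 bound makes n |D Phi - I| <= 1/2, so the Jacobian is invertible and
   [invmx], whose value on singular matrices is the identity function, is a true inverse in the
   pullback equation. *)
have eta0 : 0 < (2 * n%:R)^-1 :> R by rewrite invr_gt0 mulr_gt0.
have [r0 [eps [r00 [eps0 hF]]]] := H _ eta0; set eta := _^-1 in eta0 hF.
exists r0 => //; rewrite /small_div /=.
apply: (@le_lt_trans _ _ ((eta / (2 * eps))%:E)); last exact: ltry.
apply: ge_ereal_sup => _ [k /= k0 <-].
have [v [i [kv vi v1]]] := orthogonal_direction n2 k0.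
have w0 := weight_gt0 a r0 k; have w1 := weight_gt0 a (- r0) k.
have ww : weight a (- r0) k * weight a r0 k = 1.
  by rewrite /weight mulNr -expRD addNr expR0.
(* [weight a (- r0) k] compensates the weight in the r0-norm; each of the modes k and -k carries
   half of the amplitude b of the cosine. *)
pose F : fvector R n := fun j => cos_series k (eps * weight a (- r0) k * v 0 j).
have Fj j : `|eps * weight a (- r0) k * v 0 j| * weight a r0 k <= eps.
  rewrite normrM gtr0_norm ?mulr_gt0//.
  have -> : eps * weight a (- r0) k * `|v 0 j| * weight a r0 k
    = eps * `|v 0 j| * (weight a (- r0) k * weight a r0 k) by ring.
  rewrite ww mulr1; by rewrite ler_piMr ?v1// ltW.
have Finf : vfspace_infty a F.
  move=> j r r1; rewrite /fspace /=.
  by apply: le_lt_trans (fnorm_cos_series k0 _ _ _) _; exact: ltry.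
have Fsmall : (vfnorm a r0 F <= eps%:E)%E.
  apply: bigmax_le => [|j _]; first by rewrite lee_fin ltW.
  by apply: le_trans (fnorm_cos_series k0 _ _ _) _; rewrite lee_fin.
have [lambda [Phi [[Psi [[sPhi _] _ _ _]] _ pull _ C1]]] := hF F Finf Fsmall.
have dPhi x : differentiable Phi x by have [+ _] := sPhi 1%N; exact.
move: C1; rewrite /C1_dist_id ge_max => /andP[C0 C1].
have bnd x : `|Phi x - x| <= eta.
  by rewrite -lee_fin; apply: le_trans C0; apply: ereal_sup_ubound; exists x.
have unitJ x : 'J Phi x \in unitmx.
  rewrite (_ : 'J Phi x = 1%:M + ('J Phi x - 1%:M)); last by rewrite addrC subrK.
  apply: unitmx_near1.
  have : `|'J Phi x - 1%:M| <= eta.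
    by rewrite -lee_fin; apply: le_trans C1; apply: ereal_sup_ubound; exists x.
  by move=> h; apply: le_trans (ler_wpM2l (ltW n0) h) _; apply: eq_ler; rewrite /eta; field; rewrite gt_eqF.
pose b := 2 * (eps * weight a (- r0) k).
have b0 : 0 < b by rewrite !mulr_gt0.
have eqn x : om + (b * cos (2 * pi * freq_dot k (Phi x))) *: v - lambda = om *m 'J Phi x.
  rewrite -[in RHS](pull x) /pullback mulmxKV//; congr (_ + _ - _).
  by apply/rowP => j; rewrite !mxE feval_cos_series// /b; ring.
have := shear_amplitude (nr k k0) kv vi dPhi eqn bnd.
rewrite gtr0_norm// => h.
have fd : `|2 * pi * freq_dot k om| != 0.
  by rewrite normr_eq0 !mulf_neq0 ?nr// gt_eqF ?pi_gt0.
rewrite inver (negbTE fd) -EFinM lee_fin ler_pdivlMr ?mulr_gt0//.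
by apply: le_trans h; apply: eq_ler; rewrite /b; ring.
Qed.

End Necessity.

Theorem theorem2 (R : realType) (n : nat) (a : R) (omega : 'rV[R]_n)
    (hn : (2 <= n)%N) (ha0 : 0 < a) (ha1 : a < 1)
    (homega : non_resonant omega) :
  small_div_infty a omega <->
  (forall eta : R, 0 < eta ->
    exists r0 eps : R, 0 < r0 /\ 0 < eps /\
      forall F : fvector R n, vfspace_infty a F ->
        (vfnorm a r0 F <= eps%:E)%E ->
        exists (lambda : 'rV[R]_n) (Phi : 'rV[R]_n -> 'rV[R]_n),
          [/\ torus_diffeo Phi,
              map_in_vfspace_infty a (fun x => Phi x - x),
              (forall x, pullback Phi (fun y => omega + vfeval F y - lambda) x
                         = omega),
              `|lambda| <= eta
            & (C1_dist_id Phi <= eta%:E)%E]).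
Proof.
split=> h; first exact: conjugacy_exists.
exact: small_div_of_conjugacy h.
Qed.
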